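(* Let $d\ge1$ and let $a_{ij}:\mathbb{R}^d\to\mathbb{R}$ ($1\le i,j\le d$), $\beta:\mathbb{R}^d\times\mathbb{R}\to\mathbb{R}$, $b:\mathbb{R}^d\times\mathbb{R}\to\mathbb{R}^d$ satisfy: (i) $\beta\in C^1(\mathbb{R}^d\times\mathbb{R})$, $\beta_r(x,r)\ge0$ and $\beta(x,0)=0$ for all $x\in\mathbb{R}^d$, $r\in\mathbb{R}$, and $\beta_r\in L^\infty(\mathbb{R}^d\times(-N,N))$ for every $N>0$; (ii) $a_{ij}\in C^\infty(\mathbb{R}^d)\cap C_b(\mathbb{R}^d)$, $\nabla a_{ij}\in C_b(\mathbb{R}^d;\mathbb{R}^d)$, $a_{ij}=a_{ji}$, and there is $\gamma>0$ with $\sum_{i,j=1}^da_{ij}(x)\xi_i\xi_j\ge\gamma|\xi|^2$ for all $\xi,x\in\mathbb{R}^d$; (iii) $b\in C_b(\mathbb{R}^{d+1};\mathbb{R}^d)$ and $b(x,\cdot)\in C^1(\mathbb{R};\mathbb{R}^d)$ for all $x\in\mathbb{R}^d$; (iv) for each compact $K\subseteq\mathbb{R}$ there is $\alpha_K\in(0,\infty)$ such that $|b(x,r_1)r_1-b(x,r_2)r_2|\le\alpha_K|\beta(x,r_1)-\beta(x,r_2)|$ for all $r_1,r_2\in K$, $x\in\mathbb{R}^d$. Let $T>0$, $\nu_0\in\mathcal{P}\cap L^\infty(\mathbb{R}^d)$, and let $u\in L^1((0,T)\times\mathbb{R}^d)\cap L^\infty((0,T)\times\mathbb{R}^d)$ be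 a distributional solution of $$u_t-\sum_{i,j=1}^dD^2_{ij}\big(a_{ij}(x)\beta(x,u)\big)+\operatorname{div}(b(x,u)u)=0,\qquad u(0,\cdot)=u_0.$$ If $\nu_1,\nu_2\in L^1((0,T)\times\mathbb{R}^d)\cap L^\infty((0,T)\times\mathbb{R}^d)$ are two nonnegative distributional solutions of the linearized equation with initial condition $\nu_0$, i.e. for $\nu=\nu_1,\nu_2$ and all $\varphi\in C_0^\infty([0,T)\times\mathbb{R}^d)$, $$\int_0^T\!\!\int_{\mathbb{R}^d}\Big(\partial_t\varphi+\sum_{i,j=1}^da_{ij}(x)\frac{\beta(x,u(t,x))}{u(t,x)}D^2_{ij}\varphi+b(x,u(t,x))\cdot\nabla\varphi\Big)\nu(t,x)\,dxdt+\int_{\mathbb{R}^d}\nu_0(x)\varphi(0,x)dx=0,$$ then $\nu_1\equiv\nu_2$ (a.e. on $(0,T)\times\mathbb{R}^d$).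
   Context: Notation: $\mathcal{P}=\{\rho\in L^1(\mathbb{R}^d):\rho\ge0\text{ a.e.},\int_{\mathbb{R}^d}\rho\,dx=1\}$; $C_b$ denotes bounded continuous functions; $\beta_r=\partial\beta/\partial r$; $D^2_{ij}=\partial^2/\partial x_i\partial x_j$; $\beta(x,u)$ stands for $\beta(x,u(t,x))$. Convention: $\beta(x,r)/r:=\beta_r(x,0)$ at $r=0$. Distributional solution of the nonlinear equation with initial condition $u_0\in L^1(\mathbb{R}^d)$: $u\in L^1_{loc}([0,T)\times\mathbb{R}^d)$ with $a_{ij}(x)\beta(x,u)\in L^1_{loc}([0,T)\times\mathbb{R}^d)$, $b(x,u)u\in L^1_{loc}([0,T)\times\mathbb{R}^d;\mathbb{R}^d)$ and, for all $\varphi\in C_0^\infty([0,T)\times\mathbb{R}^d)$, $$\int_0^T\!\!\int_{\mathbb{R}^d}\Big(u\,\partial_t\varphi+\sum_{i,j}a_{ij}(x)\beta(x,u)D^2_{ij}\varphi+u\,b(x,u)\cdot\nabla\varphi\Big)dxdt+\int_{\mathbb{R}^d}u_0\varphi(0,\cdot)dx=0.$$ *)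

(* Defs.v *)
From HB Require Import structures.
From mathcomp Require Import all_boot all_order all_algebra.
From mathcomp Require Import all_classical all_reals all_analysis.

Set Implicit Arguments.
Unset Strict Implicit.
Unset Printing Implicit Defensive.

Import Order.TTheory GRing.Theory Num.Theory.
Import numFieldNormedType.Exports.

Local Open Scope classical_set_scope.
Local Open Scope ring_scope.

(* Row vectors carry the product sigma-algebra, generated by the coordinates,
   as the library does for tuples; open_measurable_rV shows that it contains
   the Borel sets of R^n. *)
Fact rV_display : measure_display. Proof. exact: default_measure_display. Qed.

Section rV_measurable.
Context {R : realType} (n : nat).

Let coord (i : 'I_n) (x : 'rV[R]_n) : measurableTypeR R := x ord0 i.

Let coord_set0 : g_sigma_preimage coord set0.
Proof. exact: sigma_algebra0. Qed.

Let coord_setC A : g_sigma_preimage coord A -> g_sigma_preimage coord (~` A).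
Proof. exact: sigma_algebraC. Qed.

Let coord_bigcup (F : (set 'rV[R]_n)^nat) :
  (forall i, g_sigma_preimage coord (F i)) ->
  g_sigma_preimage coord (\bigcup_i (F i)).
Proof. exact: sigma_algebra_bigcup. Qed.

HB.instance Definition _ := @isMeasurable.Build rV_display
  'rV[R]_n (g_sigma_preimage coord) coord_set0 coord_setC coord_bigcup.

Lemma measurable_coord (i : 'I_n) :
  measurable_fun [set: 'rV[R]_n] (fun x => x ord0 i : measurableTypeR R).
Proof.
move=> _ Y mY; rewrite setTI; apply: sub_sigma_algebra => /=.
rewrite -bigcup_seq/=; exists i => /=; first by rewrite mem_index_enum.
by exists Y => //; rewrite setTI.
Qed.

Lemma measurable_fun_rV d (T : measurableType d) (f : T -> 'rV[R]_n) :
  (forall i, measurable_fun setT (fun t => f t ord0 i : measurableTypeR R)) ->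
  measurable_fun setT f.
Proof.
move=> mf _ A mA.
have : preimage_set_system setT f (g_sigma_preimage coord) (setT `&` f @^-1` A).
  by exists A.
rewrite -g_sigma_preimage_comp; apply: smallest_sub.
  exact: sigma_algebra_measurable.
rewrite -bigcup_seq; apply: bigcup_sub => i _ B [C mC <-].
exact: mf.
Qed.

End rV_measurable.


Lemma open_measurable_rV (R : realType) n (A : set 'rV[R]_n) :
  open A -> measurable A.
Proof.
move=> oA; pose c (q : 'rV[rat]_n) : 'rV[R]_n := map_mx ratr q.
pose e (k : nat) : R := k.+1%:R^-1.
pose P (p : 'rV[rat]_n * nat) := ball (c p.1) (e p.2) `<=` A.
have -> : A = \bigcup_(p in P) ball (c p.1) (e p.2).
  apply/seteqP; split => [x Ax|x [p pA] /pA//].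
  have /nbhs_ballP[r/= r0 xrA] := open_nbhs_nbhs (conj oA Ax).
  have [k kr] : exists k, e k < r / 2.
    have r20 : 0 < r / 2 by rewrite divr_gt0.
    have [k _ /(_ k (leqnn k)) ek] := near_infty_natSinv_lt (PosNum r20).
    by exists k.
  have ek0 : 0 < e k by rewrite invr_gt0.
  have [q xq] : exists q, ball (c q) (e k) x.
    have /choice[f xf] : forall i, exists f : rat,
        ball (ratr f : R) (e k) (x ord0 i).
      move=> i; have [f] := @dense_rat R (ball (x ord0 i) (e k))
        (ex_intro _ _ (ballxx _ ek0)) (ball_open _ _).
      by move=> [xf [g _ gf]]; exists g; rewrite gf; exact: ball_sym.
    exists (\row_i f i); split=> // i j; rewrite !mxE !ord1; exact: xf.
  exists (q, k) => //= y qy; apply: xrA.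
  have : ball x (e k + e k) y by apply: ball_triangle qy; exact: ball_sym.
  by apply: le_ball; rewrite (splitr r) lerD// ltW.
rewrite bigcup_mkcond; apply: countable_bigcupT_measurable => // p.
case: ifP => // _; have ep0 : 0 < e p.2 by rewrite invr_gt0.
rewrite (_ : ball _ _ = \bigcap_(i in [set: 'I_n])
    ((fun x : 'rV[R]_n => x ord0 i) @^-1` ball (c p.1 ord0 i) (e p.2))).
  apply: fin_bigcap_measurable => // i _; rewrite -[X in measurable X]setTI.
  by apply: measurable_coord => //; rewrite ball_itv; exact: measurable_itv.
apply/seteqP; split => x /=; first by move=> [_ px] i _; exact: px.
by move=> px; split => // i j; rewrite !ord1; exact: px.
Qed.

Lemma sigma_finite_product d1 d2 (T1 : measurableType d1)
    (T2 : measurableType d2) (R : realType)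
    (m1 : {sigma_finite_measure set T1 -> \bar R})
    (m2 : {sigma_finite_measure set T2 -> \bar R}) :
  sigma_finite setT (m1 \x m2)%E.
Proof.
have /sigma_finiteP[F [TF ndF Foo]] := sigma_finiteT m1.
have /sigma_finiteP[G [TG ndG Goo]] := sigma_finiteT m2.
exists (fun n => F n `*` G n).
  rewrite -setXTT TF TG predeqE => -[x y]; split.
    move=> [/= [n _ Fnx] [k _ Gky]]; exists (maxn n k) => //; split.
    - by move: x Fnx; exact/subsetPset/ndF/leq_maxl.
    - by move: y Gky; exact/subsetPset/ndG/leq_maxr.
  by move=> [n _ []/= ? ?]; split; exists n.
move=> k; have [? ?] := Foo k; have [? ?] := Goo k.
split; first exact: measurableX.
by rewrite product_measure1E// lte_mul_pinfty// ge0_fin_numE.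
Qed.

Section lebesgue_rV.
Context {R : realType}.

Definition cons_rV n (p : measurableTypeR R * 'rV[R]_n) : 'rV[R]_n.+1 :=
  \row_i oapp (p.2 ord0) p.1 (unlift ord0 i).

Definition uncons_rV n (x : 'rV[R]_n.+1) : measurableTypeR R * 'rV[R]_n :=
  (x ord0 ord0, \row_i x ord0 (lift ord0 i)).

Lemma cons_rVK n : cancel (@cons_rV n) (@uncons_rV n).
Proof.
move=> [t x]; rewrite /uncons_rV /cons_rV mxE unlift_none/=; congr pair.
by apply/rowP => i; rewrite !mxE liftK.
Qed.

Lemma measurable_cons_rV n : measurable_fun setT (@cons_rV n).
Proof.
apply: measurable_fun_rV => i; case: (unliftP ord0 i) => [j|] ->.
- rewrite (_ : (fun _ => _) = (fun x : 'rV[R]_n => x ord0 j) \o snd).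
    by apply: measurableT_comp => //; exact: measurable_coord.
  by apply/funext => p /=; rewrite mxE liftK.
- rewrite (_ : (fun _ => _) = fst)//.
  by apply/funext => p /=; rewrite mxE unlift_none.
Qed.

Lemma measurable_uncons_rV n : measurable_fun setT (@uncons_rV n).
Proof.
apply: measurable_fun_pair; first exact: measurable_coord.
apply: measurable_fun_rV => i.
rewrite (_ : (fun _ => _) = (fun x : 'rV[R]_n.+1 => x ord0 (lift ord0 i))).
  exact: measurable_coord.
by apply/funext => x /=; rewrite mxE.
Qed.

HB.instance Definition _ n := isMeasurableFun.Build _ _ _ _ (@cons_rV n)
  (@measurable_cons_rV n).

Section step.
Variables (n : nat) (m : {sigma_finite_measure set 'rV[R]_n -> \bar R}).

Definition lebesgue_rV_step : set 'rV[R]_n.+1 -> \bar R :=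
  pushforward (@lebesgue_measure R \x m)%E (@cons_rV n).

Let lebesgue_rV_step0 : lebesgue_rV_step set0 = 0%E.
Proof. exact: measure0. Qed.

Let lebesgue_rV_step_ge0 A : (0 <= lebesgue_rV_step A)%E.
Proof. exact: measure_ge0. Qed.

Let lebesgue_rV_step_sigma_additive : semi_sigma_additive lebesgue_rV_step.
Proof. exact: measure_semi_sigma_additive. Qed.

HB.instance Definition _ := isMeasure.Build _ _ _ lebesgue_rV_step
  lebesgue_rV_step0 lebesgue_rV_step_ge0 lebesgue_rV_step_sigma_additive.

Let lebesgue_rV_step_sigma_finite : sigma_finite setT lebesgue_rV_step.
Proof.
have [F TF Foo] := sigma_finite_product (@lebesgue_measure R) m.
exists (fun k => @uncons_rV n @^-1` F k).
  by rewrite -preimage_bigcup -TF preimage_setT.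
move=> k; have [mF ?] := Foo k; split.
  by rewrite -[X in measurable X]setTI; exact: measurable_uncons_rV.
rewrite /lebesgue_rV_step /pushforward -comp_preimage.
by rewrite (_ : _ \o _ = id)// funeqE; exact: cons_rVK.
Qed.

HB.instance Definition _ := Measure_isSigmaFinite.Build _ _ _
  lebesgue_rV_step lebesgue_rV_step_sigma_finite.

End step.

(* Lebesgue measure on R^n: the n-fold product of lebesgue_measure, transported
   along R * R^n ~ R^n.+1; see lebesgue_rV_box. *)
Fixpoint lebesgue_rV n : {sigma_finite_measure set 'rV[R]_n -> \bar R} :=
  if n is n'.+1 then lebesgue_rV_step (lebesgue_rV n')
  else dirac (0 : 'rV[R]_0).

End lebesgue_rV.

Lemma lebesgue_rV_box (R : realType) n (A : 'I_n -> set (measurableTypeR R)) :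
  (forall i, measurable (A i)) ->
  lebesgue_rV n [set x | forall i, A i (x ord0 i)] =
  (\prod_(i < n) lebesgue_measure (A i))%E.
Proof.
elim: n A => [|n IHn] A mA.
  by rewrite big_ord0 [LHS]diracE mem_set// => -[].
rewrite big_ord_recl -IHn//= /lebesgue_rV_step /pushforward.
pose B := [set x : 'rV[R]_n | forall i, A (lift ord0 i) (x ord0 i)].
rewrite (_ : _ @^-1` _ = A ord0 `*` B); last first.
  apply/seteqP; split => [[t x]/= Ax|[t x]/= [At Bx] i].
    split=> [|i]; first by have := Ax ord0; rewrite mxE unlift_none.
    by have := Ax (lift ord0 i); rewrite mxE liftK.
  by case: (unliftP ord0 i) => [j|] ->; rewrite mxE ?liftK ?unlift_none.
rewrite product_measure1E//.
rewrite (_ : B = \bigcap_(i in [set: 'I_n])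
    ((fun x : 'rV[R]_n => x ord0 i) @^-1` A (lift ord0 i))).
  apply: fin_bigcap_measurable => // i _; rewrite -[X in measurable X]setTI.
  exact: measurable_coord.
by apply/seteqP; split => x /= Bx i; [move=> _|]; exact: Bx.
Qed.

Section analysis.
Context {R : realType}.

Definition enorm n (v : 'rV[R]_n) : R := Num.sqrt (\sum_(i < n) v ord0 i ^+ 2).

(* The norm of the library on 'rV is the sup norm; boundedness and continuity do
   not depend on the choice of the norm. *)
Definition Cb (V W : normedModType R) (f : V -> W) : Prop :=
  continuous f /\ bounded_fun f.

(* Class C^k; meant for finite-dimensional V, where continuity of all the
   directional derivatives is continuity of the differential. *)
Fixpoint Ck (k : nat) (V W : normedModType R) (f : V -> W) : Prop :=
  if k is k'.+1 then
    (forall x, differentiable f x) /\ forall v, Ck k' ('D_v f)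
  else continuous f.

Definition Cinfty (V W : normedModType R) (f : V -> W) : Prop :=
  forall k, Ck k f.

Definition pd n (i : 'I_n) (f : 'rV[R]_n -> R) : 'rV[R]_n -> R :=
  'D_(delta_mx ord0 i) f.

Definition grad n (f : 'rV[R]_n -> R) (x : 'rV[R]_n) : 'rV[R]_n :=
  \row_i pd i f x.

End analysis.

Section Lebesgue_spaces.
Context d (X : measurableType d) (R : realType).
Variable mu : {measure set X -> \bar R}.

Definition L1 (D : set X) (f : X -> R) : Prop := mu.-integrable D (EFin \o f).

Definition Linfty (D : set X) (f : X -> R) : Prop :=
  measurable_fun D f /\ finite_norm mu +oo (f \_ D).

End Lebesgue_spaces.

Section Fokker_Planck.
Context {R : realType} {d : nat}.

(* Time is typed by measurableTypeR R, the copy of R that carries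
   lebesgue_measure. *)
Definition leb_tx :
    {measure set (measurableTypeR R * 'rV[R]_d)%type -> \bar R} :=
  (lebesgue_measure \x lebesgue_rV d)%E.

Definition leb_xr :
    {measure set ('rV[R]_d * measurableTypeR R)%type -> \bar R} :=
  (lebesgue_rV d \x lebesgue_measure)%E.

Definition prob_density (rho : 'rV[R]_d -> R) : Prop :=
  [/\ L1 (lebesgue_rV d) setT rho,
      {ae lebesgue_rV d, forall x, 0 <= rho x} &
      \int[lebesgue_rV d]_x rho x = 1].

Definition QT (T : R) : set (R * 'rV[R]_d) := [set z | 0 < z.1 < T].

(* L^1_loc([0,T) x R^d): integrability near t = 0 is required, but since {t = 0}
   is negligible, f matters only on (0,T) x R^d. *)
Definition L1loc0 (T : R) (f : R * 'rV[R]_d -> R) : Prop :=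
  measurable_fun (QT T : set (measurableTypeR R * 'rV[R]_d)) f /\
  forall K : set (R * 'rV[R]_d), compact K -> K `<=` [set z | 0 <= z.1 < T] ->
    L1 leb_tx (K `&` QT T) f.

(* C_0^oo([0,T) x R^d): only the values for 0 <= t < T are used below; as usual,
   these are the restrictions of the smooth functions on R x R^d with compact
   support in (-oo,T) x R^d. *)
Definition test_fun (T : R) (phi : R * 'rV[R]_d -> R) : Prop :=
  Cinfty phi /\
  exists K : set (R * 'rV[R]_d),
    [/\ compact K, K `<=` [set z | z.1 < T] & forall z, ~ K z -> phi z = 0].

Definition dt (phi : R * 'rV[R]_d -> R) : R * 'rV[R]_d -> R :=
  'D_((1, 0) : R * 'rV[R]_d) phi.

Definition dx (i : 'I_d) (phi : R * 'rV[R]_d -> R) : R * 'rV[R]_d -> R :=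
  'D_((0, delta_mx ord0 i) : R * 'rV[R]_d) phi.

Definition beta_r (beta : 'rV[R]_d * R -> R) (p : 'rV[R]_d * R) : R :=
  derive1 (fun r => beta (p.1, r)) p.2.

Definition beta_quot (beta : 'rV[R]_d * R -> R) (x : 'rV[R]_d) (r : R) : R :=
  if r == 0 then beta_r beta (x, 0) else beta (x, r) / r.

Definition nonlinear_FP_solution (a : 'rV[R]_d -> 'M[R]_d)
    (beta : 'rV[R]_d * R -> R) (b : 'rV[R]_d * R -> 'rV[R]_d) (T : R)
    (u0 : 'rV[R]_d -> R) (u : R * 'rV[R]_d -> R) : Prop :=
  [/\ L1loc0 T u,
      (forall i j, L1loc0 T (fun z => a z.2 i j * beta (z.2, u z))),
      (forall i, L1loc0 T (fun z => b (z.2, u z) ord0 i * u z)) &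
      forall phi, test_fun T phi ->
        \int[leb_tx]_(z in QT T)
          (u z * dt phi z
           + \sum_(i < d) \sum_(j < d)
               a z.2 i j * beta (z.2, u z) * dx i (dx j phi) z
           + u z * \sum_(i < d) b (z.2, u z) ord0 i * dx i phi z)
        + \int[lebesgue_rV d]_x (u0 x * phi (0, x)) = 0].

Definition linearized_FP_solution (a : 'rV[R]_d -> 'M[R]_d)
    (beta : 'rV[R]_d * R -> R) (b : 'rV[R]_d * R -> 'rV[R]_d) (T : R)
    (u : R * 'rV[R]_d -> R) (nu0 : 'rV[R]_d -> R) (nu : R * 'rV[R]_d -> R) :
    Prop :=
  forall phi, test_fun T phi ->
    \int[leb_tx]_(z in QT T)
      ((dt phi z
        + \sum_(i < d) \sum_(j < d)
            a z.2 i j * beta_quot beta z.2 (u z) * dx i (dx j phi) z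
        + \sum_(i < d) b (z.2, u z) ord0 i * dx i phi z) * nu z)
    + \int[lebesgue_rV d]_x (nu0 x * phi (0, x)) = 0.

End Fokker_Planck.

(* Main.v *)
(** The difference [v] of two solutions solves the linear equation with zero initial
    datum.  Put [w = (beta(x,u)/u) v]; then [w^2 <= C v w] and the drift term satisfies
    [|b v| <= alpha |w|].  Test the equation with a mollifier in space times a smooth
    step in time, both of scale [e].  This gives [N = \sum_i d_i J_i], where [N] is a
    mollification of [v] and [J_i = \sum_j a_ij P_j + Gam_i]: the [P_j] are the time
    primitives of the space derivatives [p_j] of the mollification [W] of [w], and
    [Gam_i] collects the drift and the commutator of [a] with the mollification.
    Testing with [exp(-lambda s) W] and integrating by parts in space leaves
    [- \int exp(-lambda s) \sum_i J_i p_i].  As [p_i] is the time derivative of [P_i],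
    ellipticity bounds it by [(K/lambda) \int exp(-lambda s) |Gam'|^2], and
    [|Gam'|] is bounded by an average of [|w|] independently of [e].  As [e] tends to 0,
    [\int exp(-lambda s) v w <= (K'/lambda) \int exp(-lambda s) w^2], so that [w = 0] for
    [lambda] large; then the drift term vanishes as well and the equation gives [v = 0]. *)

From HB Require Import structures.
Require Import Defs.
From mathcomp Require Import all_boot all_order all_algebra.
From mathcomp Require Import all_classical all_reals all_analysis.
From mathcomp Require Import measurable_realfun ring lra.
Import Order.TTheory GRing.Theory Num.Theory.
Import numFieldNormedType.Exports.

Local Open Scope classical_set_scope.
Local Open Scope ring_scope.

Set Implicit Arguments.
Unset Strict Implicit.
Unset Printing Implicit Defensive.

(** * Smooth functions and the smooth step *)

(** The factor [beta(x,u)/u] may vanish, so an energy estimate for [v] itself degenerates. Testing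
    with the mollified [w] leads instead to an energy quadratic in the space gradient of the time
    primitive of [w]. The time factor of the test function is a step because its derivative is an
    approximate Dirac mass: a single test function produces a mollification of [v] on one side and
    time-integrated fluxes on the other. The step is one-sided, so the mollifier sees only the past.
    Hence all primitives vanish at time 0, the test functions are admissible at every time before
    [T], and the averages are compatible with the decreasing weight [exp(-lambda s)]. The obstacle
    is the dependence of [a] on [x]: with two space derivatives on the mollifier the commutator
    would cost a power of [e]. Once the equation is in divergence form, a single derivative meets
    the difference of two values of [a], which is of order [e], and nothing is lost. Integrations by
    parts are made between the mollifier kernels, so that the solutions need only be integrable. *)

Section Ck_theory.
Context {R : realType} {V : normedModType R}.
Implicit Types f g : V -> R.

Lemma Ck_continuous k f : Ck k f -> continuous f.
Proof. by case: k => // k [df _] x; exact: differentiable_continuous. Qed.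

Lemma Ck_pred k f : Ck k.+1 f -> Ck k f.
Proof.
elim: k f => [|k IH] f [df Df]; first by move=> x; exact: differentiable_continuous.
by split=> // v; apply: IH.
Qed.

Lemma Ck_cst k (c : R) : Ck k (fun _ : V => c).
Proof.
elim: k c => [|k IH] c /=; first by move=> x; exact: cvg_cst.
split=> [x|v]; first exact: differentiable_cst.
rewrite (_ : 'D_v _ = fun _ => 0); first exact: IH.
by apply/funext => x; exact: derive_cst.
Qed.

Lemma CkD k f g : Ck k f -> Ck k g -> Ck k (fun x => f x + g x).
Proof.
elim: k f g => [|k IH] f g /=.
  by move=> cf cg x; apply: cvgD; [exact: cf|exact: cg].
move=> [df Df] [dg Dg]; split=> [x|v]; first exact: differentiableD.
rewrite (_ : 'D_v _ = fun x => 'D_v f x + 'D_v g x); first exact: IH.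
by apply/funext => x; rewrite -deriveD//; exact: diff_derivable.
Qed.

Lemma CkM k f g : Ck k f -> Ck k g -> Ck k (fun x => f x * g x).
Proof.
elim: k f g => [|k IH] f g.
  by move=> cf cg x; apply: cvgM; [exact: cf|exact: cg].
move=> fk gk; have fk' := Ck_pred fk; have gk' := Ck_pred gk.
case: fk gk => [df Df] [dg Dg]; split=> [x|v]; first exact: differentiableM.
rewrite (_ : 'D_v _ = fun x => f x * 'D_v g x + g x * 'D_v f x).
  by apply: CkD; apply: IH; [exact: fk'|exact: Dg|exact: gk'|exact: Df].
by apply/funext => x; apply: (@deriveM _ _ f g); exact: diff_derivable.
Qed.

Lemma CkV k f : (forall x, f x != 0) -> Ck k f -> Ck k (fun x => (f x)^-1).
Proof.
move=> f0; elim: k => [|k IH].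
  by move=> cf x; apply: cvgV; [exact: f0|exact: cf].
move=> fk; have fk' := Ck_pred fk; case: fk => [df Df].
split=> [x|v]; first exact: differentiableV.
rewrite (_ : 'D_v _ =
    fun x => (-1 * ((f x)^-1 * (f x)^-1)) * 'D_v f x).
  apply: CkM; last exact: Df.
  apply: CkM; first exact: Ck_cst.
  by apply: CkM; apply: IH.
apply/funext => x; rewrite deriveV//; last exact: diff_derivable.
by rewrite /GRing.scale/= mulN1r expr2 invfM.
Qed.

Lemma Ck_prod k (I : Type) (r : seq I) (F : I -> V -> R) :
  (forall i, Ck k (F i)) -> Ck k (fun x => \prod_(i <- r) F i x).
Proof.
move=> Fk; elim: r => [|i r IH].
  by rewrite (_ : (fun _ => _) = fun=> 1) ?funeqE => [|x]; [exact: Ck_cst|rewrite big_nil].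
rewrite (_ : (fun _ => _) = fun x => F i x * \prod_(j <- r) F j x); first exact: CkM.
by apply/funext => x; rewrite big_cons.
Qed.

(** Reduces a directional derivative of an explicit formula to one-variable calculus; the partial
    derivatives of the test functions are computed this way. *)
Lemma derive_line f (z v : V) (g : R -> R) :
  (forall h, f (h *: v + z) = g h) -> 'D_v f z = derive1 g 0.
Proof.
move=> fg; have fz : f z = g 0 by rewrite -fg scale0r add0r.
rewrite /derive /derive1 fz.
have -> : (fun h => h^-1 *: ((f \o shift z) (h *: v) - g 0)) =
    (fun h : R => h^-1 *: (g (h + 0) - g 0)) by apply/funext => h /=; rewrite fg addr0.
by [].
Qed.

(** The successive derivatives are carried as a family [F], so that differentiating only shifts the
    index [m]; [l], whose directional derivatives are constant, contributes a scalar factor. This is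
    how one-variable profiles are composed with the coordinates. *)
Lemma Ck_comp_affine k m (F : nat -> R -> R) (l : V -> R) :
  (forall j (x : R), is_derive x (1 : R) (F j) (F j.+1 x)) ->
  (forall x, differentiable l x) ->
  (forall v, exists c : R, forall x, 'D_v l x = c) -> Ck k (F m \o l).
Proof.
move=> dF dl Dl; elim: k m => [|k IH] m.
  move=> x; apply: continuous_comp; first exact: differentiable_continuous.
  by apply/differentiable_continuous/derivable1_diffP; have [] := dF m (l x).
have dFl x : differentiable (F m) (l x).
  by apply/derivable1_diffP; have [] := dF m (l x).
split=> [x|v]; first exact: differentiable_comp.
have [c Dc] := Dl v.
rewrite (_ : 'D_v _ = fun x => c * (F m.+1 \o l) x).
  by apply: CkM; [exact: Ck_cst|exact: IH].
apply/funext => x; rewrite deriveE; last exact: differentiable_comp.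
rewrite diff_comp//= -[X in 'd (F m) _ X](deriveE _ (dl x)) Dc diff1E//.
by rewrite /GRing.scale/= derive1E; have [_ ->] := dF m (l x).
Qed.

End Ck_theory.

Lemma Cinfty_is_derive (R : realType) (f : R -> R) : Cinfty f ->
  forall j (x : R), is_derive x (1 : R) (derive1n j f) (derive1n j.+1 f x).
Proof.
move=> fi; have fj j : Cinfty (derive1n j f).
  elim: j => // j IH k; have [_ /(_ (1 : R)) Dk] := IH k.+1.
  have <- : 'D_(1 : R) (derive1n j f) = derive1n j.+1 f.
    by apply/funext => x; rewrite derive1nS derive1E.
  exact: Dk.
move=> j x; have [/(_ x) dj _] := fj j 1%N.
by rewrite derive1nS derive1E; apply: derivableP; exact/derivable1_diffP.
Qed.

Section smooth_step.
Context {R : realType}.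

(** The function [exp(-1/x)] with all its multiples by [x ^- n]: derivatives of members of the
    family are linear combinations of members, which makes smoothness an induction. *)
Let flat (n : nat) (x : R) : R := if 0 < x then x ^- n * expR (- x^-1) else 0.

(** With [y = 1/x], the single term [y ^ (n+1) / (n+1)!] of the series bounds [exp y] from below.
    The bound is a multiple of [|x|], hence gives convergence to 0 at the origin. *)
Let flat_bound n x : 0 <= flat n x <= (n.+1)`!%:R * `|x|.
Proof.
rewrite /flat; case: ifPn => x0; last by rewrite lexx/= mulr_ge0.
have xi : 0 < x^-1 by rewrite invr_gt0.
rewrite mulr_ge0 ?expR_ge0 ?invr_ge0 ?exprn_ge0 ?(ltW x0)//=.
have := expR_ge1Dxn n (ltW xi); set y := x^-1 in xi *.
have f0 : 0 < (n.+1)`!%:R :> R by rewrite ltr0n fact_gt0.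
have p0 : 0 < y ^+ n.+1 / (n.+1)`!%:R by rewrite divr_gt0// exprn_gt0.
move=> h; rewrite expRN (gtr0_norm x0).
have : (expR y)^-1 <= (y ^+ n.+1 / (n.+1)`!%:R)^-1.
  by rewrite lef_pV2 ?posrE ?expR_gt0//; apply: le_trans h; rewrite lerDr.
move=> h2; rewrite -exprVn -/y.
apply: (le_trans (ler_wpM2l _ h2)); first by rewrite exprn_ge0// ltW.
rewrite invf_div mulrCA exprS invfM [y ^+ n * _]mulrCA mulfV ?mulr1 ?invrK//.
by rewrite expf_neq0// gt_eqF.
Qed.

Let flat_derive n (x : R) :
  is_derive x (1 : R) (flat n) (- n%:R * flat n.+1 x + flat n.+2 x).
Proof.
have [x0|x0|->] := ltgtP x 0.
- rewrite /flat [0 < x]ltNge (ltW x0)/= mulr0 addr0.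
  apply: (@near_eq_is_derive _ _ _ (cst 0)).
  near=> y; rewrite /= ifF//; apply: negbTE; rewrite -leNgt ltW//.
  by near: y; exact: lt_nbhsl.
- rewrite /flat x0.
  apply: (@near_eq_is_derive _ _ _ ((fun y : R => y^-1) ^+ n *
      (expR \o (- (fun y : R => y^-1))))).
  + near=> y; rewrite /= ifT; last by near: y; exact: lt_nbhsr.
    transitivity (((fun y : R => y^-1) ^+ n) y * expR (- y^-1)) => //.
    by rewrite exprfctE exprVn.
  + have xn0 : x != 0 by rewrite gt_eqF.
    have xnn0 : x ^+ n != 0 by rewrite expf_neq0.
    have dV : is_derive x (1 : R) (fun y : R => y^-1) (- x ^- 2 *: 1) by exact: is_deriveV.
    have dE := @is_derive1_comp _ expR (- (fun y : R => y^-1)) x _ _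
      (is_derive_expR (- x^-1)) (is_deriveN dV).
    apply: (is_derive_eq (is_deriveM (is_deriveX n dV) dE)).
    rewrite /GRing.scale/= !exprfctE/= !mulr1 -[(- _) x]/(- x^-1) -!exprVn.
    set y := x^-1; set E := expR _.
    by case: n xnn0 => [|n] _; rewrite /= ?expr0 ?exprS; ring.
- have f0 k : flat k 0 = 0 by rewrite /flat ltxx.
  rewrite !f0 mulr0 addr0.
  have cv : (fun h : R => h^-1 *: ((flat n \o shift 0) (h *: 1) - flat n 0))
      @ 0^' --> (0 : R).
    (* At the origin the difference quotient of [flat n] is [flat n.+1] itself, which [flat_bound]
       squeezes to 0. *)
    have : (fun h => flat n.+1 h) @ 0^' --> (0 : R).
      apply: (@squeeze_cvgr _ _ _ _ (cst 0) (fun h => (n.+2)`!%:R * `|h|)).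
      + by near=> h; exact: flat_bound.
      + exact: cvg_cst.
      + rewrite -[X in _ --> X](mulr0 (n.+2)`!%:R); apply: cvgMr.
        by rewrite -[X in _ --> X](@normr0 _ R); apply: cvg_norm; exact: nbhs_dnbhs.
    apply: cvg_trans; apply: near_eq_cvg; near=> h => /=.
    have h0 : h != 0 by near: h; exact: nbhs_dnbhs_neq.
    rewrite f0 subr0 addr0 /flat /GRing.scale/= mulr1.
    by case: ifPn; rewrite ?mulr0// exprS invfM mulrA.
  by apply: DeriveDef; [apply/cvg_ex; exists 0|apply/cvg_lim].
Unshelve. all: by end_near. Qed.

Let flat_Ck k n : Ck k (flat n : R -> R).
Proof.
elim: k n => [|k IH] n.
  by move=> x; apply/differentiable_continuous/derivable1_diffP; have [] := flat_derive n x.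
split=> [x|v]; first by apply/derivable1_diffP; have [] := flat_derive n x.
rewrite (_ : 'D_v _ = fun x => v * (- n%:R * flat n.+1 x + flat n.+2 x)).
  apply: CkM; first exact: Ck_cst.
  apply: CkD; last exact: IH.
  by apply: CkM; [exact: Ck_cst|exact: IH].
apply/funext => x; have [d e] := flat_derive n x.
rewrite deriveE ?diff1E; try exact/derivable1_diffP.
by rewrite derive1E e.
Qed.

Let flat_ge0 n x : 0 <= flat n x. Proof. by have /andP[] := flat_bound n x. Qed.

Let flat_sum_gt0 x : 0 < flat 0 x + flat 0 (1 - x).
Proof.
have flat_gt0 (y : R) : 0 < y -> 0 < flat 0 y.
  by move=> y0; rewrite /flat y0 expr0 invr1 mul1r expR_gt0.
have [x0|x0] := ltP 0 x; first by rewrite ltr_pwDl// flat_gt0.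
by rewrite ltr_wpDl// flat_gt0// subr_gt0 (le_lt_trans x0).
Qed.

(** The denominator never vanishes because [x] and [1 - x] are not both nonpositive; the transition
    from 0 to 1 takes place on [[0, 1]]. *)
Definition step (x : R) : R := flat 0 x / (flat 0 x + flat 0 (1 - x)).

Lemma step_Cinfty : Cinfty step.
Proof.
move=> k; have f1 : Ck k (fun x : R => flat 0 (1 - x)).
  rewrite (_ : (fun _ => _) = derive1n 0 (flat 0) \o (fun x : R => 1 - x))//.
  apply: (@Ck_comp_affine _ _ k 0 (fun n => derive1n n (flat 0))).
  - by apply: Cinfty_is_derive => j; exact: flat_Ck.
  - by move=> x; exact: differentiableB.
  - move=> v; exists (- v) => x.
    by rewrite deriveB// derive_cst derive_id sub0r.
apply: CkM; first exact: flat_Ck.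
apply: CkV => [x|]; first by rewrite gt_eqF// flat_sum_gt0.
by apply: CkD => //; exact: flat_Ck.
Qed.

Lemma step_le0 x : x <= 0 -> step x = 0.
Proof. by move=> x0; rewrite /step /flat [0 < x]ltNge x0 mul0r. Qed.

Lemma step_ge1 x : 1 <= x -> step x = 1.
Proof.
move=> x1; rewrite /step /flat subr_gt0 [x < 1]ltNge x1 addr0 divff// gt_eqF//.
by have := flat_sum_gt0 x; rewrite /flat subr_gt0 [x < 1]ltNge x1 addr0.
Qed.

Lemma step_ge0_le1 x : 0 <= step x <= 1.
Proof.
rewrite divr_ge0 ?(ltW (flat_sum_gt0 _))//=.
by rewrite ler_pdivrMr ?flat_sum_gt0// mul1r lerDl.
Qed.

End smooth_step.

(** * One-dimensional profiles at scale e and their box majorants *)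

Section profiles.
Context {R : realType}.
Local Notation mu := (@lebesgue_measure R).
Implicit Types (e s t x y : R) (m n : nat).

(* [profile e 0] is a smooth step of width [e]; [profile e 1] is a smooth
   approximation of the Dirac mass supported in [[0, e]]. *)
Definition profile e m s : R := e ^- m * derive1n m step (s / e).

Lemma is_derive_profile e m s :
  is_derive s (1 : R) (profile e m) (profile e m.+1 s).
Proof.
have dm := Cinfty_is_derive (@step_Cinfty R) m (s / e).
have de : is_derive s (1 : R) (fun s : R => s / e) e^-1.
  apply: (is_derive_eq (is_deriveM (is_derive_id s (1 : R)) (is_derive_cst e^-1 s (1 : R)))).
  by rewrite scaler0 add0r /GRing.scale/= mulr1.
apply: (is_derive_eq (@is_deriveZ _ _ _ _ (e ^- m) _ _ _
  (@is_derive1_comp _ (derive1n m step) (fun s : R => s / e) s _ _ dm de))).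
by rewrite /profile /GRing.scale/= exprS invfM; ring.
Qed.

Lemma continuous_profile e m : continuous (profile e m).
Proof.
move=> s; apply/differentiable_continuous/derivable1_diffP.
by have [] := is_derive_profile e m s.
Qed.

Lemma measurable_profile e m :
  measurable_fun setT (profile e m : measurableTypeR R -> measurableTypeR R).
Proof. by apply: continuous_measurable_fun; exact: continuous_profile. Qed.

Lemma profile_le0 e s : 0 < e -> s <= 0 -> profile e 0 s = 0.
Proof.
move=> e0 s0; rewrite /profile derive1n0 step_le0 ?mulr0//.
by rewrite pmulr_lle0// invr_gt0.
Qed.

Lemma profile_ge e s : 0 < e -> e <= s -> profile e 0 s = 1.
Proof.
move=> e0 es; rewrite /profile derive1n0 expr0 invr1 mul1r step_ge1//.
by rewrite ler_pdivlMr// mul1r.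
Qed.

(** Beyond [e] the profile of order 0 is constant; its derivatives vanish where it is constant on a
    neighbourhood, whence the strict inequality. *)
Lemma profile_gt e m s : 0 < e -> e < s -> profile e m.+1 s = 0.
Proof.
move=> e0; elim: m s => [|m IH] s es.
  have [_ <-] := is_derive_profile e 0 s.
  rewrite (@near_eq_derive _ _ _ _ (cst (1 : R))) ?derive_cst//.
  by near=> y; rewrite profile_ge// ltW//; near: y; exact: lt_nbhsr.
have [_ <-] := is_derive_profile e m.+1 s.
rewrite (@near_eq_derive _ _ _ _ (cst (0 : R))) ?derive_cst//.
by near=> y; rewrite IH//; near: y; exact: lt_nbhsr.
Unshelve. all: by end_near. Qed.

Lemma profile_lt0 e m s : 0 < e -> s < 0 -> profile e m s = 0.
Proof.
move=> e0; elim: m s => [|m IH] s es; first by rewrite profile_le0// ltW.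
have [_ <-] := is_derive_profile e m s.
rewrite (@near_eq_derive _ _ _ _ (cst (0 : R))) ?derive_cst//.
by near=> y; rewrite IH//; near: y; exact: lt_nbhsl.
Unshelve. all: by end_near. Qed.

(** The normalized indicator of [[-e, e]]. Derivatives of the profiles are dominated in absolute
    value by multiples of it, and the estimates are made on this even probability kernel. *)
Definition box e s : R := (2 * e)^-1 * (`|s| <= e)%R%:R.

Lemma box_ge0 e s : 0 < e -> 0 <= box e s.
Proof. by move=> e0; rewrite mulr_ge0// invr_ge0 mulr_ge0// ltW. Qed.

Lemma box_sym e s t : box e (s - t) = box e (t - s).
Proof. by rewrite /box distrC. Qed.

Lemma box_bound e s : 0 < e -> box e s <= (2 * e)^-1.
Proof.
move=> e0; rewrite /box; case: (`|s| <= e)%R; rewrite ?mulr1 ?mulr0//.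
by rewrite invr_ge0 mulr_ge0// ltW.
Qed.

Lemma measurable_box e :
  measurable_fun setT (box e : measurableTypeR R -> measurableTypeR R).
Proof.
apply: measurable_funM => //.
have -> : (fun x : measurableTypeR R => (`|x| <= e)%R%:R) = (\1_(`[- e, e] : set (measurableTypeR R)) : measurableTypeR R -> R).
  apply/funext => x; rewrite indicE; congr (nat_of_bool _)%:R.
  by rewrite ler_norml; apply/idP/idP => [h|]; rewrite inE/= in_itv/=.
by apply: measurable_indic; exact: measurable_itv.
Qed.

Lemma integral_box e y : 0 < e -> (\int[mu]_x (box e (x - y))%:E = 1)%E.
Proof.
move=> e0.
have -> : (\int[mu]_x (box e (x - y))%:E =
  \int[mu]_x ((2 * e)^-1%:E * (\1_(`[y - e, y + e] : set (measurableTypeR R)) x)%:E))%E.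
  apply: eq_integral => x _; rewrite /box EFinM indicE; congr (_ * _%:E)%E.
  congr (nat_of_bool _)%:R; rewrite ler_norml.
  apply/idP/idP => [h|]; rewrite ?inE/= ?in_itv/=; last lra.
  by lra.
rewrite ge0_integralZl//; last 2 first.
- by apply/measurable_EFinP; apply: measurable_indic; exact: measurable_itv.
- by rewrite lee_fin invr_ge0 mulr_ge0// ltW.
rewrite integral_indic//.
rewrite setIT [X in (_ * X)%E](_ : _ = (2 * e)%:E).
  by rewrite -EFinM mulVf// gt_eqF// mulr_gt0.
apply: (etrans (lebesgue_measure_itv `[y - e, y + e])).
rewrite /= lte_fin ifT; last lra.
by rewrite -EFinB; congr EFin; ring.
Qed.

(** For positive order the derivative of [step] is continuous and vanishes outside [[0, 1]], hence
    is bounded; rescaling contributes [e ^- m]. *)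
Lemma profile_bound m : exists2 C, 0 <= C & forall e s, 0 < e ->
  `|profile e m s| <= C * e ^- m.
Proof.
have [C C0 HC] : exists2 C, 0 <= C & forall s, `|derive1n m step s| <= C.
  case: m => [|m].
    exists 1 => // s; rewrite derive1n0; have /andP[s0 s1] := step_ge0_le1 s.
    by rewrite ger0_norm.
  have prof1 s : derive1n m.+1 step s = profile 1 m.+1 s.
    by rewrite /profile expr1n invr1 mul1r mulr1.
  have : compact (profile 1 m.+1 @` `[0, 1]%classic).
    apply: continuous_compact; last exact: segment_compact.
    by apply: continuous_subspaceT; exact: continuous_profile.
  move=> /compact_bounded[M [Mr HM]].
  exists (`|M| + 1) => [|s]; first by rewrite addr_ge0.
  rewrite prof1; have [s0|s0] := ltP s 0; first by rewrite profile_lt0// normr0 addr_ge0.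
  have [s1|s1] := ltP 1 s; first by rewrite profile_gt// normr0 addr_ge0.
  apply: HM; last by exists s => //=; rewrite in_itv/= s0 s1.
  by rewrite (le_lt_trans (ler_norm M))// ltrDl.
exists C => // e s e0; rewrite /profile normrM mulrC ler_pM//.
by rewrite ger0_norm// invr_ge0 exprn_ge0// ltW.
Qed.

(** Of the [m.+1] factors [1/e], one is spent on the height [1/(2e)] of [box], hence [e ^- m] and
    the doubled constant; for [m = 0] the bound is uniform in [e]. The factor [0 <= s] records that
    the profiles see only the past. *)
Lemma profile_box m : exists2 C, 0 <= C & forall e s, 0 < e ->
  `|profile e m.+1 s| <= C * e ^- m * ((0 <= s)%R%:R * box e s).
Proof.
have [C C0 HC] := profile_bound m.+1; exists (2 * C) => [|e s e0]; first by rewrite mulr_ge0.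
have b0 := box_ge0 s e0.
have r0 (c : bool) : 0 <= 2 * C * e ^- m * (c%:R * box e s).
  by apply: mulr_ge0; apply: mulr_ge0 => //; rewrite ?mulr_ge0// invr_ge0 exprn_ge0// ltW.
have em0 : 0 <= e ^- m by rewrite invr_ge0 exprn_ge0// ltW.
have [s0|s0] := ltP s 0; first by rewrite profile_lt0// normr0.
have [s1|s1] := ltP e s; first by rewrite profile_gt// normr0.
rewrite mul1r /box (ger0_norm s0) s1 mulr1 (le_trans (HC _ _ e0))// le_eqVlt; apply/orP; left.
by apply/eqP; rewrite exprS; field; rewrite (gt_eqF e0) expf_neq0// gt_eqF.
Qed.

Lemma Rintegral_FTC (F f : R -> R) a b : a < b ->
  (forall s, is_derive s (1 : R) F (f s)) -> continuous f ->
  (forall s, s < a \/ b < s -> f s = 0) ->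
  mu.-integrable setT (EFin \o f) /\ \int[mu]_s f s = F b - F a.
Proof.
move=> ab dF cf f0.
have fE : f = f \_ `[a, b].
  apply/funext => s; rewrite patchE; case: ifPn => //; rewrite notin_setE/= in_itv/=.
  move=> /negP; rewrite negb_and -!ltNge => /orP h; exact: f0.
have cF : continuous F.
  move=> s; apply/differentiable_continuous/derivable1_diffP.
  by have [] := dF s.
have if1 : mu.-integrable `[a, b] (EFin \o f).
  apply: continuous_compact_integrable; first exact: segment_compact.
  exact: continuous_subspaceT.
split.
  have mab : measurable (`[a, b]%classic : set (measurableTypeR R)) by exact: measurable_itv.
  have := (@integrable_restrict _ _ _ mu _ mab setT measurableT (EFin \o f)).1.
  by rewrite setTI restrict_EFin -fE; apply.
rewrite fE -Rintegral_mkcond /Rintegral (@continuous_FTC2 _ f F)//.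
- exact: continuous_subspaceT.
- split.
  + by move=> s _; have [] := dF s.
  + exact/cvg_at_right_filter/cF.
  + exact/cvg_at_left_filter/cF.
- by move=> s _; rewrite derive1E; have [_ ->] := dF s.
Qed.

Lemma is_derive_profile_shift e m y s :
  is_derive s (1 : R) (fun s => profile e m (s - y)) (profile e m.+1 (s - y)).
Proof.
have d := is_derive_profile e m (s - y).
have := @is_derive1_comp _ (profile e m) (shift (- y)) s _ _ d (is_derive_shift s (1 : R) (- y)).
by rewrite mulr1.
Qed.

Lemma continuous_profile_shift e m y : continuous (fun s => profile e m (s - y)).
Proof.
move=> s; apply/differentiable_continuous/derivable1_diffP.
by have [] := is_derive_profile_shift e m y s.
Qed.

Lemma integrable_profile e m y : 0 < e ->
  mu.-integrable setT (EFin \o (fun s => profile e m.+1 (s - y))).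
Proof.
move=> e0; apply: (@Rintegral_FTC (fun s => profile e m (s - y)) _ (y - e) (y + e) _ _ _ _).1.
- by lra.
- by move=> s; exact: is_derive_profile_shift.
- exact: continuous_profile_shift.
- move=> s [sy|sy]; first by rewrite profile_lt0//; lra.
  by rewrite profile_gt//; lra.
Qed.

Lemma Rintegral_profile e y : 0 < e -> \int[mu]_x profile e 1 (y - x) = 1.
Proof.
move=> e0.
have dF s : is_derive s (1 : R) (fun x => - profile e 0 (y - x)) (profile e 1 (y - s)).
  have d := is_derive_profile e 0 (y - s).
  have db := is_deriveB (is_derive_cst y s (1 : R)) (is_derive_id s (1 : R)).
  have := is_deriveN (@is_derive1_comp _ (profile e 0) (cst y - id) s _ _ d db).
  by rewrite sub0r mulrN1 opprK.
have cf : continuous (fun s => profile e 1 (y - s)).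
  move=> s; apply: (@continuous_comp _ _ _ (fun s => y - s) (profile e 1)); last exact: continuous_profile.
  by apply: cvgB; [exact: cvg_cst|exact: cvg_id].
have := @Rintegral_FTC _ _ (y - (e + e)) (y + e) _ dF cf.
case.
- by lra.
- move=> s [sy|sy]; first by rewrite profile_gt//; lra.
  by rewrite profile_lt0//; lra.
- move=> _ ->; rewrite profile_le0//; last by lra.
  by rewrite profile_ge//; lra.
Qed.

(** The derivative of the product is integrated over [[x - e, x + 2e]], which strictly contains the
    support [[x, x + e]] of the first factor, so that no boundary term remains. Orders start at 1
    because the profile of order 0 does not have compact support. *)
Lemma profile_by_parts e m n x y : 0 < e ->
  \int[mu]_s (profile e m.+2 (s - x) * profile e n.+1 (s - y)) =
  - \int[mu]_s (profile e m.+1 (s - x) * profile e n.+2 (s - y)).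
Proof.
move=> e0; pose P k z := fun s => profile e k (s - z).
have iP k l : mu.-integrable setT (EFin \o (fun s => P k.+1 x s * P l.+1 y s)).
  have [C C0 HC] := profile_bound l.+1.
  have := @integrableMl _ _ _ mu setT measurableT (EFin \o P k.+1 x) (P l.+1 y)
    (integrable_profile k x e0).
  apply.
    by apply: continuous_measurable_fun; exact: continuous_profile_shift.
  exists (C * e ^- l.+1); split; first exact: num_real.
  by move=> M CM s _; apply: le_trans (ltW CM); exact: HC.
have := @Rintegral_FTC (fun s => P m.+1 x s * P n.+1 y s)
  (fun s => P m.+2 x s * P n.+1 y s + P m.+1 x s * P n.+2 y s) (x - e) (x + (e + e)).
case.
- by lra.
- move=> s; have dx := is_derive_profile_shift e m.+1 x s.
  have dy := is_derive_profile_shift e n.+1 y s.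
  apply: (is_derive_eq (is_deriveM dx dy)).
  by rewrite /GRing.scale/= addrC (mulrC (P n.+1 y s)).
- move=> s; apply: cvgD; apply: cvgM; exact: continuous_profile_shift.
- move=> s [sx|sx]; first by rewrite /P !(@profile_lt0 _ _ (s - x))// ?mul0r ?addr0//; lra.
  by rewrite /P !(@profile_gt _ _ (s - x))// ?mul0r ?addr0//; lra.
move=> _; rewrite RintegralD//; try exact: iP.
rewrite /P !(@profile_lt0 _ _ (x - e - x))//; last by lra.
rewrite (@profile_gt _ _ (x + (e + e) - x))//; last by lra.
by rewrite !mul0r subr0 => /eqP; rewrite addr_eq0 => /eqP.
Qed.

End profiles.

(** * Integrable functions and kernel operators *)

Section L1_calculus.
Context d (T : measurableType d) {R : realType}.
Variable mu : {measure set T -> \bar R}.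
Implicit Types f g : T -> R.

Lemma L1_measurable f : L1 mu setT f -> measurable_fun setT f.
Proof. by move=> /integrableP[/measurable_EFinP]. Qed.

Lemma L1_le f g : measurable_fun setT f -> (forall x, `|f x| <= g x) ->
  L1 mu setT g -> L1 mu setT f.
Proof.
move=> mf fg; apply: le_integrable => //; first exact/measurable_EFinP.
by move=> x _ /=; rewrite lee_fin (le_trans (fg x))// ler_norm.
Qed.

Lemma L1_norm f : L1 mu setT f -> L1 mu setT (fun x => `|f x|).
Proof. exact: integrable_norm. Qed.

Lemma L1D f g : L1 mu setT f -> L1 mu setT g -> L1 mu setT (fun x => f x + g x).
Proof. by move=> If Ig; exact: (integrableD measurableT If Ig). Qed.

Lemma L1B f g : L1 mu setT f -> L1 mu setT g -> L1 mu setT (fun x => f x - g x).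
Proof. by move=> If Ig; exact: (integrableB measurableT If Ig). Qed.

Lemma L1Zl (r : R) f : L1 mu setT f -> L1 mu setT (fun x => r * f x).
Proof. by move=> If; exact: (integrableZl measurableT r If). Qed.

Lemma L10 : L1 mu setT (fun=> 0).
Proof. exact: integrable0. Qed.

Lemma L1_sum I (s : seq I) (F : I -> T -> R) :
  (forall i, L1 mu setT (F i)) -> L1 mu setT (fun x => \sum_(i <- s) F i x).
Proof.
move=> IF; elim: s => [|i s IH].
  by rewrite (_ : (fun _ => _) = fun=> 0); [exact: L10|apply/funext => x; rewrite big_nil].
rewrite (_ : (fun _ => _) = fun x => F i x + \sum_(j <- s) F j x); first exact: L1D.
by apply/funext => x; rewrite big_cons.
Qed.

Lemma Rintegral_sum I (s : seq I) (F : I -> T -> R) :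
  (forall i, L1 mu setT (F i)) ->
  \int[mu]_x (\sum_(i <- s) F i x) = \sum_(i <- s) \int[mu]_x F i x.
Proof.
move=> IF; elim: s => [|i s IH].
  rewrite big_nil -[RHS](mul0r (fine (mu setT))) -Rintegral_cst//.
  by apply: eq_Rintegral => x _; rewrite big_nil.
rewrite big_cons -IH -RintegralD//; [|exact: IF|exact: L1_sum].
by apply: eq_Rintegral => x _; rewrite big_cons.
Qed.

Lemma L1Ml f g (M : R) : L1 mu setT f -> measurable_fun setT g ->
  (forall x, `|g x| <= M) -> L1 mu setT (fun x => f x * g x).
Proof.
move=> If mg gM; apply: (@L1_le _ (fun x => M * `|f x|)).
- by apply: measurable_funM => //; exact: L1_measurable.
- by move=> x; rewrite normrM mulrC ler_wpM2r.
- exact/L1Zl/L1_norm.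
Qed.

Lemma L1Mr f g (M : R) : L1 mu setT f -> measurable_fun setT g ->
  (forall x, `|g x| <= M) -> L1 mu setT (fun x => g x * f x).
Proof.
move=> If mg gM; under eq_fun do rewrite mulrC.
exact: L1Ml gM.
Qed.

Lemma EFin_Rintegral f : L1 mu setT f ->
  (\int[mu]_x f x)%:E = (\int[mu]_x (f x)%:E)%E.
Proof. by move=> If; rewrite /Rintegral fineK//; exact: (integrable_fin_num measurableT If). Qed.

Lemma normr_Rintegral f : L1 mu setT f ->
  `|\int[mu]_x f x| <= \int[mu]_x `|f x|.
Proof. by move=> If; exact: le_normr_Rintegral. Qed.

Lemma ge0_L1 f : measurable_fun setT f -> (forall x, 0 <= f x) ->
  (\int[mu]_x (f x)%:E < +oo)%E -> L1 mu setT f.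
Proof.
move=> mf f0 foo; apply/integrableP; split; first exact/measurable_EFinP.
by under eq_integral => x _ do rewrite /= ger0_norm//.
Qed.

(** An integrable extended-real function is finite almost everywhere. This brings Fubini's theorem,
    whose inner integrals are extended reals, to iterated real integrals. *)
Lemma L1_fine (h : T -> \bar R) : mu.-integrable setT h ->
  L1 mu setT (fine \o h) /\ (\int[mu]_x (fine (h x))%:E = \int[mu]_x h x)%E.
Proof.
move=> ih; have mh := measurable_int _ ih.
have mfh : measurable_fun setT (fine \o h) by exact: measurableT_comp.
have aeh : ae_eq mu setT (EFin \o (fine \o h)) h.
  by apply: filterS (integrable_ae measurableT ih) => x hx xT /=; rewrite fineK// hx.
have e : (\int[mu]_x (fine (h x))%:E = \int[mu]_x h x)%E.
  by apply: ae_eq_integral => //; exact/measurable_EFinP.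
split=> //; apply/integrableP; split; first exact/measurable_EFinP.
have /integrableP[_] := ih; apply: le_lt_trans.
apply: ge0_le_integral => //.
- by apply: measurableT_comp => //; exact/measurable_EFinP.
- exact: measurableT_comp.
- by move=> x _ /=; case: (h x) => [r||]//=; rewrite ?normr0 ?leey.
Qed.

End L1_calculus.

Section Fubini_real.
Context d1 d2 (X : measurableType d1) (Y : measurableType d2) {R : realType}.
Variables (m1 : {sigma_finite_measure set X -> \bar R})
  (m2 : {sigma_finite_measure set Y -> \bar R}).
Implicit Types f : X * Y -> R.

(** No integrability is assumed: Tonelli makes the integrals of the positive and negative parts
    measurable, and [fine] of their difference is measurable whatever its value. *)
Lemma measurable_Rintegral1 f : measurable_fun setT f ->
  measurable_fun setT (fun x => \int[m2]_y f (x, y)).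
Proof.
move=> mf; have mEf : measurable_fun setT (EFin \o f) by exact/measurable_EFinP.
rewrite /Rintegral; apply: measurableT_comp => //.
under eq_fun do rewrite integralE.
apply: emeasurable_funB.
- rewrite (_ : (fun _ => _) = fun x => (\int[m2]_y (EFin \o f)^\+ (x, y))%E); last first.
    by apply/funext => x; apply: eq_integral => y _; rewrite -[RHS]/((((EFin \o f)^\+)%E \o pair x) y) -funepos_comp.
  by apply: measurable_fun_fubini_tonelli_F => //; exact: measurable_funepos.
- rewrite (_ : (fun _ => _) = fun x => (\int[m2]_y (EFin \o f)^\- (x, y))%E); last first.
    by apply/funext => x; apply: eq_integral => y _; rewrite -[RHS]/((((EFin \o f)^\-)%E \o pair x) y) -funeneg_comp.
  by apply: measurable_fun_fubini_tonelli_F => //; exact: measurable_funeneg.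
Qed.

Lemma L1_product f (g : X -> R) : measurable_fun setT f -> L1 m1 setT g ->
  (forall x, (\int[m2]_y `|f (x, y)|%:E <= (g x)%:E)%E) -> L1 (m1 \x m2)%E setT f.
Proof.
move=> mf /integrableP[mg goo] fg.
apply/(integrable12ltyP m1 m2); first exact/measurable_EFinP.
apply: le_lt_trans goo; apply: ge0_le_integral => //.
- by move=> x _; exact: integral_ge0.
- apply: (measurable_fun_fubini_tonelli_F (abse \o (EFin \o f))) => //=.
  by apply: measurableT_comp => //; exact/measurable_EFinP.
- by apply: measurableT_comp.
- by move=> x _; rewrite (le_trans (fg x))//= lee_fin ler_norm.
Qed.

Lemma L1_Rintegral1 f : L1 (m1 \x m2)%E setT f ->
  L1 m1 setT (fun x => \int[m2]_y f (x, y)) /\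
  \int[m1]_x \int[m2]_y f (x, y) = \int[(m1 \x m2)%E]_z f z.
Proof.
move=> If; have [l e] := L1_fine (integrable_fubini_F If).
split; first exact: l.
by rewrite /Rintegral -(integral12_prod_meas1 If); congr fine.
Qed.

Let L1_swap f : L1 (m1 \x m2)%E setT f ->
  L1 (m2 \x m1)%E setT (fun p => f (p.2, p.1)).
Proof.
move=> If; have mf := L1_measurable If.
apply/(integrable12ltyP m2 m1).
  by apply/measurable_EFinP; apply: measurableT_comp => //; exact: measurable_swap.
by have /(integrable21ltyP m1 m2) := If; apply; exact/measurable_EFinP.
Qed.

Lemma L1_Rintegral2 f : L1 (m1 \x m2)%E setT f ->
  L1 m2 setT (fun y => \int[m1]_x f (x, y)) /\
  \int[m2]_y \int[m1]_x f (x, y) = \int[(m1 \x m2)%E]_z f z.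
Proof.
move=> If; have [l e] := L1_fine (integrable_fubini_F (L1_swap If)).
split; first exact: l.
by rewrite /Rintegral -(integral21_prod_meas1 If); congr fine.
Qed.

Lemma Rintegral_swap f : L1 (m1 \x m2)%E setT f ->
  \int[m1]_x \int[m2]_y f (x, y) = \int[m2]_y \int[m1]_x f (x, y).
Proof. by move=> If; rewrite (L1_Rintegral1 If).2 (L1_Rintegral2 If).2. Qed.

Lemma L1_tensor (f : X -> R) (g : Y -> R) : L1 m1 setT f -> L1 m2 setT g ->
  L1 (m1 \x m2)%E setT (fun z => f z.1 * g z.2) /\
  \int[(m1 \x m2)%E]_z (f z.1 * g z.2) = \int[m1]_x f x * \int[m2]_y g y.
Proof.
move=> If Ig; have mf := L1_measurable If; have mg := L1_measurable Ig.
have IF : L1 (m1 \x m2)%E setT (fun z => f z.1 * g z.2).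
  apply: (@L1_product _ (fun x => `|f x| * \int[m2]_y `|g y|)).
  - by apply: measurable_funM; apply: measurableT_comp.
  - under eq_fun do rewrite mulrC.
    exact/L1Zl/L1_norm.
  - move=> x; rewrite EFinM EFin_Rintegral; last exact: L1_norm.
    rewrite -ge0_integralZl//; last by apply/measurable_EFinP/measurableT_comp.
    rewrite le_eqVlt; apply/orP; left; apply/eqP.
    by apply: eq_integral => y _; rewrite /= normrM EFinM.
split=> //; rewrite -(L1_Rintegral1 IF).2 -RintegralZr//.
by apply: eq_Rintegral => x _; rewrite /= RintegralZl.
Qed.

End Fubini_real.

Section kernels.
Context d1 d2 (Y : measurableType d1) (Z : measurableType d2) {R : realType}.
Variables (my : {sigma_finite_measure set Y -> \bar R})
  (mz : {sigma_finite_measure set Z -> \bar R}).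
Implicit Types (K L : Y * Z -> R) (f g : Z -> R).

Definition kop K f (y : Y) : R := \int[mz]_z (f z * K (y, z)).

Lemma measurable_kop K f : measurable_fun setT K -> measurable_fun setT f ->
  measurable_fun setT (kop K f).
Proof.
move=> mK mf; apply: (@measurable_Rintegral1 _ _ _ _ _ mz (fun p => f p.2 * K p)).
by apply: measurable_funM => //; apply: measurableT_comp.
Qed.

Lemma L1_kop_section K f (M : R) y : measurable_fun setT K -> L1 mz setT f ->
  (forall p, `|K p| <= M) -> L1 mz setT (fun z => f z * K (y, z)).
Proof.
move=> mK If KM; apply: (@L1Ml _ _ _ _ _ _ M) => //.
exact: measurable_fun_pair2.
Qed.

Lemma kop_bound K f (M : R) y : measurable_fun setT K -> L1 mz setT f ->
  (forall p, `|K p| <= M) -> `|kop K f y| <= M * \int[mz]_z `|f z|.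
Proof.
move=> mK If KM; have IfK := L1_kop_section y mK If KM.
apply: (le_trans (normr_Rintegral IfK)); rewrite -RintegralZl//; last exact: L1_norm.
apply: le_Rintegral => //; [exact: L1_norm|exact/L1Zl/L1_norm|].
by move=> z _; rewrite normrM mulrC ler_wpM2r.
Qed.

(** The L1 half of Schur's test: what matters is the mass of [K] in its first variable, uniformly in
    the second. *)
Lemma L1_kop_product K f (M : R) : measurable_fun setT K -> L1 mz setT f ->
  (forall z, (\int[my]_y `|K (y, z)|%:E <= M%:E)%E) ->
  L1 (my \x mz)%E setT (fun p => f p.2 * K p).
Proof.
move=> mK If KM; have mf := L1_measurable If.
have mfK : measurable_fun setT (fun p => f p.2 * K p).
  by apply: measurable_funM => //; apply: measurableT_comp.
apply/(integrable21ltyP my mz); first exact/measurable_EFinP.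
have /integrableP[_] := L1Zl M (L1_norm If); apply: le_lt_trans.
apply: ge0_le_integral => //.
- by move=> z _; exact: integral_ge0.
- apply: (measurable_fun_fubini_tonelli_G (abse \o (EFin \o (fun p => f p.2 * K p)))) => //=.
  by apply: measurableT_comp => //; exact/measurable_EFinP.
- by apply: measurableT_comp => //; apply/measurable_EFinP; exact: L1_measurable (L1Zl M (L1_norm If)).
- move=> z _ /=; under eq_integral do rewrite normrM EFinM.
  rewrite ge0_integralZl//; last first.
    by apply/measurable_EFinP; apply: measurableT_comp => //; exact: measurable_fun_pair1.
  apply: (@le_trans _ _ (`|f z|%:E * M%:E)%E); first exact: lee_wpmul2l.
  by rewrite -EFinM mulrC lee_fin ler_norm.
Qed.

Lemma L1_kop K f (M : R) : measurable_fun setT K -> L1 mz setT f ->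
  (forall z, (\int[my]_y `|K (y, z)|%:E <= M%:E)%E) -> L1 my setT (kop K f).
Proof.
by move=> mK If KM; have [] := L1_Rintegral1 (L1_kop_product mK If KM).
Qed.

(** Fubini moves the operator onto [G] as its transpose. The sup bound on [K] makes the sections
    integrable, the mass bound makes the double integral converge. *)
Lemma Rintegral_kopM K f (G : Y -> R) (M M' B : R) :
  measurable_fun setT K -> L1 mz setT f -> measurable_fun setT G ->
  (forall p, `|K p| <= M) ->
  (forall z, (\int[my]_y `|K (y, z)|%:E <= M'%:E)%E) ->
  (forall y, `|G y| <= B) ->
  \int[my]_y (kop K f y * G y) =
  \int[mz]_z (f z * \int[my]_y (K (y, z) * G y)).
Proof.
move=> mK If mG KM KM' GB.
have IP : L1 (my \x mz)%E setT (fun p => f p.2 * K p * G p.1).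
  apply: (L1Ml (L1_kop_product mK If KM') _ (fun p => GB p.1)).
  exact: measurableT_comp.
transitivity (\int[my]_y \int[mz]_z (f z * K (y, z) * G y)).
  by apply: eq_Rintegral => y _; rewrite RintegralZr//; exact: L1_kop_section KM.
rewrite (Rintegral_swap IP) /=; apply: eq_Rintegral => z _.
rewrite -RintegralZl//; first by apply: eq_Rintegral => y _; rewrite mulrA.
apply: (L1Ml _ mG GB).
have := KM' z; have := @measurable_fun_pair1 _ _ _ _ _ _ K z mK.
move=> mKz h; apply/integrableP; split; first exact/measurable_EFinP.
exact: le_lt_trans h (ltry _).
Qed.

(** Once both operators are expanded, the pairing depends on the kernels only through the integral
    in [y] of [K (y, z) * L (y, z')]. An integration by parts proved for kernels thus transfers to
    all functions they produce from integrable data. *)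
Lemma kop_transfer K L K' L' f g (M : R) :
  measurable_fun setT K -> measurable_fun setT L ->
  measurable_fun setT K' -> measurable_fun setT L' ->
  L1 mz setT f -> L1 mz setT g ->
  (forall p, `|K p| <= M) -> (forall p, `|L p| <= M) ->
  (forall p, `|K' p| <= M) -> (forall p, `|L' p| <= M) ->
  (forall z, (\int[my]_y `|K (y, z)|%:E <= M%:E)%E) ->
  (forall z, (\int[my]_y `|L (y, z)|%:E <= M%:E)%E) ->
  (forall z, (\int[my]_y `|K' (y, z)|%:E <= M%:E)%E) ->
  (forall z, (\int[my]_y `|L' (y, z)|%:E <= M%:E)%E) ->
  (forall z z', \int[my]_y (K (y, z) * L (y, z')) =
     \int[my]_y (K' (y, z) * L' (y, z'))) ->
  \int[my]_y (kop K f y * kop L g y) = \int[my]_y (kop K' f y * kop L' g y).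
Proof.
move=> mK mL mK' mL' If Ig KM LM K'M L'M IK IL IK' IL' KL.
have mf := L1_measurable If; have mg := L1_measurable Ig.
have pull (N P : Y * Z -> R) : measurable_fun setT N -> measurable_fun setT P ->
    (forall p, `|N p| <= M) -> (forall p, `|P p| <= M) ->
    (forall z, (\int[my]_y `|N (y, z)|%:E <= M%:E)%E) ->
    (forall z, (\int[my]_y `|P (y, z)|%:E <= M%:E)%E) ->
    \int[my]_y (kop N f y * kop P g y) =
    \int[mz]_z (f z * \int[mz]_z' (g z' * \int[my]_y (N (y, z) * P (y, z')))).
  move=> mN mP NM PM IN IP.
  apply: (etrans (@Rintegral_kopM N f (kop P g) M M (M * \int[mz]_z `|g z|) mN If
    (measurable_kop mP mg) NM IN (fun y => kop_bound y mP Ig PM))).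
  apply: eq_Rintegral => z _; congr (_ * _).
  under eq_Rintegral do rewrite mulrC.
  have mNz := @measurable_fun_pair1 _ _ _ _ _ _ N z mN.
  apply: (etrans (@Rintegral_kopM P g (fun y => N (y, z)) M M M mP Ig mNz PM IP
    (fun y => NM (y, z)))).
  apply: eq_Rintegral => z' _; congr (_ * _).
  by apply: eq_Rintegral => y _; rewrite mulrC.
rewrite (pull K L mK mL KM LM IK IL) (pull K' L' mK' mL' K'M L'M IK' IL').
apply: eq_Rintegral => z _; congr (_ * _); apply: eq_Rintegral => z' _.
by rewrite KL.
Qed.

End kernels.

(** * Approximate identities *)

Section modulus.
Context d (X : measurableType d) {R : realType}.
Variable m : {sigma_finite_measure set X -> \bar R}.
Implicit Types (k : X * X -> R) (f g h : X -> R).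

(** The L1 modulus of continuity of [f], averaged over translations by [k]. *)
Definition modulus k f : \bar R :=
  (\int[m]_y \int[m]_x (k (y, x) * `|f x - f y|)%:E)%E.

(** Both marginals are normalized: mass 1 in [x] makes [k] an average, mass 1 in [y] makes that
    average a contraction of L1. *)
Definition markov_kernel k := [/\ measurable_fun setT k, forall p, 0 <= k p,
  forall y, (\int[m]_x (k (y, x))%:E = 1)%E &
  forall x, (\int[m]_y (k (y, x))%:E = 1)%E].

(** Stated through [modulus] rather than as convergence of the averages: in this form it passes to
    every kernel dominated by a multiple of [k n], without any sign condition, as the mollifiers
    will require, and it is stable under products. *)
Definition approximate_identity (k : nat -> X * X -> R) :=
  (forall n, markov_kernel (k n)) /\
  forall f, L1 m setT f -> modulus (k n) f @[n --> \oo] --> 0%E.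

Section fixed_kernel.
Variable k : X * X -> R.
Hypothesis mk : markov_kernel k.

Let measurable_k : measurable_fun setT k. Proof. by have [] := mk. Qed.
Let k_ge0 p : 0 <= k p. Proof. by have [] := mk. Qed.

Lemma measurable_modulus f : measurable_fun setT f ->
  measurable_fun setT (fun p : X * X => k p * `|f p.2 - f p.1|).
Proof.
move=> mf; apply: measurable_funM => //; apply: measurableT_comp => //.
by apply: measurable_funB; apply: measurableT_comp.
Qed.

Lemma measurable_modulus1 f : measurable_fun setT f ->
  measurable_fun setT (fun y => (\int[m]_x (k (y, x) * `|f x - f y|)%:E)%E).
Proof.
move=> mf.
apply: (measurable_fun_fubini_tonelli_F (fun p => (k p * `|f p.2 - f p.1|)%:E)).
  by apply/measurable_EFinP; exact: measurable_modulus.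
by move=> p; rewrite lee_fin mulr_ge0.
Qed.

Let kernel_left f : measurable_fun setT f ->
  (\int[m]_y \int[m]_x (k (y, x) * `|f y|)%:E = \int[m]_y `|f y|%:E)%E.
Proof.
move=> mf; have [_ _ k1 _] := mk; apply: eq_integral => y _.
under eq_integral do rewrite mulrC EFinM.
rewrite ge0_integralZl//; first by rewrite k1 mule1.
- by apply/measurable_EFinP; exact: measurable_fun_pair2.
- by move=> x _; rewrite lee_fin.
Qed.

Let kernel_right f : measurable_fun setT f ->
  (\int[m]_y \int[m]_x (k (y, x) * `|f x|)%:E = \int[m]_x `|f x|%:E)%E.
Proof.
move=> mf; have [_ _ _ k2] := mk.
rewrite (fubini_tonelli (fun p => (k p * `|f p.2|)%:E)); last 2 first.
- apply/measurable_EFinP; apply: measurable_funM => //.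
  by apply: measurableT_comp => //; exact: measurableT_comp.
- by move=> p; rewrite lee_fin mulr_ge0.
apply: eq_integral => x _ /=.
under eq_integral do rewrite mulrC EFinM.
rewrite ge0_integralZl//; first by rewrite k2 mule1.
- by apply/measurable_EFinP; exact: measurable_fun_pair1.
- by move=> y _; rewrite lee_fin.
Qed.

(** The increments of [f] and [g] differ by the values of [f - g] at [x] and at [y]. Each
    contributes one L1 norm, the first through the mass of [k] in [y], the second through its mass
    in [x]; hence the factor 2. *)
Lemma modulus_triangle f g : measurable_fun setT f -> measurable_fun setT g ->
  (modulus k f <= modulus k g + 2%:E * \int[m]_x `|f x - g x|%:E)%E.
Proof.
move=> mf mg; pose h x := f x - g x.
have mh : measurable_fun setT h by exact: measurable_funB.
have mE2 (F : X * X -> R) y : measurable_fun setT F ->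
    measurable_fun setT (fun x => (F (y, x))%:E).
  by move=> mF; apply/measurable_EFinP; exact: measurable_fun_pair2.
have mE1 (F : X * X -> R) : measurable_fun setT F -> (forall p, 0 <= F p) ->
    measurable_fun setT (fun y => (\int[m]_x (F (y, x))%:E)%E).
  move=> mF F0; apply: (measurable_fun_fubini_tonelli_F (EFin \o F)).
    exact/measurable_EFinP.
  by move=> p; rewrite lee_fin.
pose F1 (p : X * X) := k p * `|g p.2 - g p.1|.
pose F2 (p : X * X) := k p * `|h p.2|.
pose F3 (p : X * X) := k p * `|h p.1|.
have mF1 : measurable_fun setT F1 by exact: measurable_modulus.
have mF2 : measurable_fun setT F2.
  by apply: measurable_funM => //; apply: measurableT_comp => //; exact: measurableT_comp.
have mF3 : measurable_fun setT F3.
  by apply: measurable_funM => //; apply: measurableT_comp => //; exact: measurableT_comp.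
have F10 p : 0 <= F1 p by rewrite mulr_ge0.
have F20 p : 0 <= F2 p by rewrite mulr_ge0.
have F30 p : 0 <= F3 p by rewrite mulr_ge0.
have -> : (2%:E * \int[m]_x `|f x - g x|%:E =
    \int[m]_y \int[m]_x (F2 (y, x))%:E + \int[m]_y \int[m]_x (F3 (y, x))%:E)%E.
  by rewrite kernel_right// kernel_left// -[2%R]/(1 + 1)%R EFinD ge0_muleDl// mul1e.
rewrite -ge0_integralD//; last 4 first.
- by move=> y _; apply: integral_ge0 => x _; rewrite lee_fin.
- exact: mE1.
- by move=> y _; apply: integral_ge0 => x _; rewrite lee_fin.
- exact: mE1.
rewrite -ge0_integralD//; last 4 first.
- by move=> y _; apply: integral_ge0 => x _; rewrite lee_fin mulr_ge0.
- exact: (mE1 F1).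
- by move=> y _; apply: adde_ge0; apply: integral_ge0 => x _; rewrite lee_fin.
- by apply: emeasurable_funD; exact: mE1.
apply: ge0_le_integral => //.
- by move=> y _; apply: integral_ge0 => x _; rewrite lee_fin mulr_ge0.
- exact: measurable_modulus1.
- apply: emeasurable_funD; first exact: (mE1 F1).
  by apply: emeasurable_funD; exact: mE1.
move=> y _.
rewrite -ge0_integralD//; last 4 first.
- by move=> x _; rewrite lee_fin.
- exact: mE2.
- by move=> x _; rewrite lee_fin.
- exact: mE2.
rewrite -ge0_integralD//; last 4 first.
- by move=> x _; rewrite lee_fin mulr_ge0.
- exact: (mE2 F1).
- by move=> x _; apply: adde_ge0; rewrite lee_fin.
- by apply: emeasurable_funD; exact: mE2.
apply: ge0_le_integral => //.
- by move=> x _; rewrite lee_fin mulr_ge0.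
- by apply: (mE2 (fun p => k p * `|f p.2 - f p.1|)); exact: measurable_modulus.
- apply: emeasurable_funD; first exact: (mE2 F1).
  by apply: emeasurable_funD; exact: mE2.
move=> x _; rewrite -!EFinD lee_fin /F2 /F3 -!mulrDr ler_wpM2l//= /h.
have -> : f x - f y = (g x - g y) + ((f x - g x) - (f y - g y)) by ring.
by rewrite (le_trans (ler_normD _ _))// lerD2l ler_normB.
Qed.

Lemma modulus_ge0 f : (0 <= modulus k f)%E.
Proof. by apply: integral_ge0 => y _; apply: integral_ge0 => x _; rewrite lee_fin mulr_ge0. Qed.

Lemma modulus_le f : measurable_fun setT f ->
  (modulus k f <= 2%:E * \int[m]_x `|f x|%:E)%E.
Proof.
move=> mf; have := @modulus_triangle f (cst 0) mf (@measurable_cst _ _ _ _ _ _).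
rewrite (_ : modulus k (cst 0) = 0%E).
  by rewrite add0e; under [X in (_ <= _ * X)%E -> _]eq_integral do rewrite subr0.
rewrite /modulus integral0_eq// => y _; rewrite integral0_eq// => x _.
by rewrite subr0 normr0 mulr0.
Qed.

End fixed_kernel.
End modulus.

Lemma ge0_cvge0 {R : realType} (u : nat -> \bar R) : (forall n, 0 <= u n)%E ->
  (forall e : R, 0 < e -> \forall n \near \oo, (u n <= e%:E)%E) ->
  u n @[n --> \oo] --> 0%E.
Proof.
move=> u0 ue; apply/fine_cvgP; split.
  by near=> n; rewrite ge0_fin_numE//; apply: (@le_lt_trans _ _ 1%E); rewrite ?ltry//;
    near: n; exact: ue.
apply/cvgrPdist_le => e e0; near=> n.
have une : (u n <= e%:E)%E by near: n; exact: ue.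
rewrite sub0r normrN /=; move: une (u0 n); case: (u n) => [r||]//=.
by rewrite !lee_fin => ? ?; rewrite ger0_norm.
Unshelve. all: by end_near. Qed.

Lemma cvge0_le {R : realType} (u : nat -> \bar R) (e : R) : 0 < e ->
  u n @[n --> \oo] --> 0%E -> \forall n \near \oo, (u n <= e%:E)%E.
Proof.
move=> e0 /fine_cvgP[fu /cvgrPdist_le/(_ _ e0)]; apply: filterS2 fu => n fn.
rewrite sub0r normrN => h; rewrite -(fineK fn) lee_fin.
by rewrite (le_trans (ler_norm _)).
Qed.

Lemma L1_indic d (T : measurableType d) {R : realType}
    (mu : {measure set T -> \bar R}) (A : set T) :
  measurable A -> (mu A < +oo)%E -> L1 mu setT (\1_A : T -> R).
Proof.
move=> mA Aoo; apply: ge0_L1 => //.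
by rewrite integral_indic// setIT.
Qed.

Lemma lebesgue_measure_segment_lty {R : realType} (a b : R) :
  (lebesgue_measure (`[a, b]%classic : set R) < +oo)%E.
Proof. by rewrite lebesgue_measure_itv/=; case: ifP => _; rewrite ?ltry// -EFinB ltry. Qed.

Lemma box_eq0 {R : realType} (e s : R) : e < `|s| -> box e s = 0.
Proof. by move=> es; rewrite /box leNgt es mulr0. Qed.

Section approximate_identity_R.
Context {R : realType}.
Local Notation mu := (@lebesgue_measure R).
Local Notation T := (measurableTypeR R).

Definition boxk (e : R) (p : T * T) : R := box e (p.1 - p.2).

Lemma measurable_boxk e : measurable_fun setT (boxk e).
Proof.
apply: (measurableT_comp (measurable_box e)).
by apply: measurable_funB.
Qed.

Lemma markov_boxk e : 0 < e -> markov_kernel mu (boxk e).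
Proof.
move=> e0; split.
- exact: measurable_boxk.
- by move=> p; exact: box_ge0.
- by move=> y; under eq_integral do rewrite /boxk box_sym; exact: integral_box.
- by move=> x; exact: integral_box.
Qed.

Let rad (n : nat) : R := n.+1%:R^-1.

Let rad_gt0 n : 0 < rad n. Proof. by rewrite invr_gt0. Qed.

Let rad_le1 n : rad n <= 1. Proof. by rewrite invf_le1// ler1n. Qed.

Let modulus_cvg_pw (h : T -> R) (M : R) (y : R) : measurable_fun setT h ->
  {for y, continuous (h : R -> R)} ->
  (\int[mu]_x (boxk (rad n) (y, x) * `|h x - h y|)%:E @[n --> \oo] --> 0)%E.
Proof.
move=> mh ch; apply: ge0_cvge0.
  by move=> n; apply: integral_ge0 => x _; rewrite lee_fin mulr_ge0// box_ge0.
move=> e e0.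
have /cvgrPdist_le/(_ _ e0)/nbhs_ballP[r/= r0 hr] := ch.
have [N _ HN] := near_infty_natSinv_lt (PosNum r0).
exists N => // n Nn.
have [mk k0 k1 _] := markov_boxk (rad_gt0 n).
apply: (@le_trans _ _ (\int[mu]_x (e%:E * (boxk (rad n) (y, x))%:E))%E); last first.
  rewrite ge0_integralZl//; last 3 first.
  - by apply/measurable_EFinP; exact: measurable_fun_pair2.
  - by move=> x _; rewrite lee_fin.
  - by rewrite lee_fin ltW.
  by rewrite k1 mule1.
apply: ge0_le_integral => //.
- by move=> x _; rewrite lee_fin mulr_ge0.
- apply/measurable_EFinP; apply: measurable_funM; first exact: measurable_fun_pair2.
  by apply: measurableT_comp => //; exact: measurable_funB.
- apply/measurable_EFinP; apply: measurable_funM => //; exact: measurable_fun_pair2.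
move=> x _; rewrite -EFinM lee_fin mulrC.
have [xy|xy] := leP `|y - x| (rad n); last first.
  by rewrite /boxk box_eq0// !mulr0.
rewrite ler_wpM2r// distrC; apply: hr; rewrite /ball/= (le_lt_trans xy)//.
exact: HN.
Qed.

Lemma modulus_cvg_cont (h : T -> R) (M N : R) : measurable_fun setT h -> 0 < N ->
  (forall x, `|h x| <= M) -> (forall x, N < `|x| -> h x = 0) ->
  (forall y : R, `|y| != N -> {for y, continuous (h : R -> R)}) ->
  modulus mu (boxk (rad n)) h @[n --> \oo] --> 0%E.
Proof.
move=> mh N0 hM h0 ch.
have M0 : 0 <= M by apply: le_trans (hM 0).
pose f_ n (y : T) := (\int[mu]_x (boxk (rad n) (y, x) * `|h x - h y|)%:E)%E.
have mf_ n : measurable_fun setT (f_ n).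
  by apply: measurable_modulus1 => //; exact: markov_boxk.
(* The radii [rad n] are at most 1, so that beyond [N + 1] the kernel meets only zeros of [h]. *)
pose E : set T := `[- (N + 1), N + 1]%classic.
have mE : measurable E by exact: measurable_itv.
pose g (y : T) : \bar R := ((M + M) * \1_E y)%:E.
have f0 n y : (0 <= f_ n y)%E.
  by apply: integral_ge0 => x _; rewrite lee_fin mulr_ge0// box_ge0.
have fg n y : (f_ n y <= g y)%E.
  have [mk k0 k1 _] := markov_boxk (rad_gt0 n).
  rewrite /g indicE; have [yE|yE] := boolP (y \in E).
    rewrite mulr1; apply: (@le_trans _ _ (\int[mu]_x ((M + M)%:E * (boxk (rad n) (y, x))%:E))%E); last first.
      rewrite ge0_integralZl//; last 3 first.
      - by apply/measurable_EFinP; exact: measurable_fun_pair2.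
      - by move=> x _; rewrite lee_fin.
      - by rewrite lee_fin addr_ge0.
      by rewrite k1 mule1.
    apply: ge0_le_integral => //.
    - by move=> x _; rewrite lee_fin mulr_ge0.
    - apply/measurable_EFinP; apply: measurable_funM; first exact: measurable_fun_pair2.
      by apply: measurableT_comp => //; exact: measurable_funB.
    - apply/measurable_EFinP; apply: measurable_funM => //; exact: measurable_fun_pair2.
    move=> x _; rewrite -EFinM lee_fin mulrC ler_wpM2r//.
    by rewrite (le_trans (ler_normB _ _))// lerD.
  have Ny : N + 1 < `|y|.
    rewrite ltNge; apply: contra yE; rewrite ler_norml => h'.
    by apply/mem_set; rewrite /E/= in_itv.
  rewrite mulr0 /f_ integral0_eq// => x _.
  have [xy|xy] := leP `|y - x| (rad n); last by rewrite /boxk box_eq0// mul0r.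
  rewrite !h0 ?subrr ?normr0 ?mulr0//; first by apply: lt_trans Ny; rewrite ltrDl.
  have : `|y| - `|x| <= `|y - x| by exact: lerB_dist.
  by have := rad_le1 n; lra.
have ig : mu.-integrable setT g.
  apply: (@L1Zl _ T R mu (M + M)); apply: L1_indic => //.
  exact: lebesgue_measure_segment_lty.
have cf_ : {ae mu, forall y, setT y -> f_ n y @[n --> \oo] --> (cst 0%E y : \bar R)}.
  have mNN : measurable ([set N; - N] : set T).
    by apply: measurableU; exact: measurable_set1.
  exists [set N; - N]; split => //.
    apply: countable_lebesgue_measure0.
    by apply: finite_set_countable; exact: finite_set2.
  move=> y /= Hy; apply: contrapT => yN; apply: Hy => _.
  apply: (modulus_cvg_pw M mh (ch y _)).
  apply: contra_notN yN; rewrite eqr_norml (ltW N0) andbT => /orP[/eqP|/eqP]; [by left|by right].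
have fg_ : {ae mu, forall y n, setT y -> (`|f_ n y| <= g y)%E}.
  by apply: aeW => y n _; rewrite gee0_abs.
have [_ _] := @dominated_convergence _ T R mu setT measurableT f_ (cst 0%E) g mf_
  (@measurable_cst _ _ _ _ _ _) cf_ ig fg_.
by rewrite integral0.
Qed.

Lemma approximate_identity_R : approximate_identity mu (fun n => boxk (rad n)).
Proof.
split=> [n|f If]; first exact: markov_boxk.
have mf := L1_measurable If.
apply: ge0_cvge0 => [n|e e0].
  by apply: modulus_ge0; exact: markov_boxk.
(* One fifth is for the modulus of the approximation [h]. The distance from [f] to [h] counts twice,
   and consists of the tail outside [E N] and of the approximation error inside, one fifth each. *)
have e5 : 0 < e / 5 by rewrite divr_gt0.
pose E (N : nat) : set T := `[- N.+1%:R, N.+1%:R]%classic.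
have mE N : measurable (E N) by exact: measurable_itv.
have EN N x : E N x <-> `|x| <= N.+1%:R :> R.
  by rewrite /E/= in_itv/= ler_norml.
have [N HN] : exists N, (\int[mu]_(x in ~` E N) `|f x|%:E <= (e / 5)%:E)%E.
  pose f_ N x := (`|(f \_ (~` E N)) x|%:E)%E.
  have mf_ N : measurable_fun setT (f_ N).
    apply/measurable_EFinP; apply: measurableT_comp => //.
    apply/(measurable_restrictT f (measurableC (mE N))).
    exact: measurable_funTS.
  have cf_ : {ae mu, forall x, setT x -> f_ n x @[n --> \oo] --> (cst 0%E x : \bar R)}.
    apply: aeW => x _; apply: cvg_near_cst.
    near=> n; rewrite /f_ patchE ifF ?normr0//; apply/negbTE.
    rewrite notin_setE /setC/=; apply; apply/EN.
    rewrite (@le_trans _ _ n%:R)//; last by rewrite ler_nat.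
    by near: n; exact: nbhs_infty_ger.
  have fg_ : {ae mu, forall x n, setT x -> (`|f_ n x| <= `|f x|%:E)%E}.
    apply: aeW => x n _; rewrite /f_ /= normr_id lee_fin patchE; case: ifPn => //.
    by rewrite normr0.
  have [_ _] := @dominated_convergence _ T R mu setT measurableT f_ (cst 0%E)
    (fun x => `|f x|%:E) mf_ (@measurable_cst _ _ _ _ _ _) cf_ (L1_norm If) fg_.
  rewrite integral0 => /(cvge0_le e5)[N _ HN]; exists N.
  have := HN N (leqnn N); rewrite /=; congr (_ <= _)%E.
  rewrite [RHS]integral_mkcond; apply: eq_integral => x _.
  by rewrite /f_ !patchE; case: ifP => //; rewrite normr0.
have Eoo : (mu (E N) < +oo)%E by exact: lebesgue_measure_segment_lty.
have IfE : mu.-integrable (E N) (EFin \o f).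
  exact: (integrableS measurableT (mE N) (@subsetT _ _) If).
have [g_ [cg ig gcv]] := approximation_continuous_integrable (mE N) Eoo IfE.
have [n0 _ /(_ n0 (leqnn n0)) fgn] := cvge0_le e5 gcv.
pose g := g_ n0; pose h : T -> R := g \_ (E N).
have mh : measurable_fun setT h.
  apply/(measurable_restrictT g (mE N)); apply: measurable_funTS.
  by apply: continuous_measurable_fun; exact: cg.
have [M hM] : exists M, forall x, `|h x| <= M.
  have /compact_bounded[M [Mr HM]] : compact (g @` (E N : set R)).
    apply: continuous_compact; last exact: segment_compact.
    by apply: continuous_subspaceT; exact: cg.
  exists (`|M| + 1) => x; rewrite /h patchE; case: ifPn => xE.
    apply: HM; last by exists x => //; exact: set_mem.
    by rewrite (le_lt_trans (ler_norm M))// ltrDl.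
  by rewrite normr0 addr_ge0.
have N0 : (0 : R) < N.+1%:R by [].
have h0 x : N.+1%:R < `|x| -> h x = 0.
  move=> xN; rewrite /h patchE ifF//; apply/negbTE; rewrite notin_setE => /EN.
  by rewrite leNgt xN.
have ch (y : R) : `|y| != N.+1%:R -> {for y, continuous (h : R -> R)}.
  rewrite neq_lt => /orP[yN|yN].
    have hg : {near y, (h : R -> R) =1 g}.
      near=> x; rewrite /h patchE ifT//; apply/mem_set/EN/ltW.
      near: x; have := @norm_continuous _ R^o y.
      by move=> /cvgr_lt; apply.
    move=> A; rewrite (nbhs_singleton hg) => /cg gA.
    change (nbhs y [set x | A ((h : R -> R) x)]).
    have gA' : nbhs y [set x | A (g x)] := gA.
    by apply: filterS2 hg gA' => x /= ->.
  have hg : {near y, (h : R -> R) =1 cst 0}.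
    near=> x; rewrite h0//; near: x; have := @norm_continuous _ R^o y.
    by move=> /cvgr_gt; apply.
  move=> A; rewrite (nbhs_singleton hg) => /nbhs_singleton A0.
  change (nbhs y [set x | A ((h : R -> R) x)]).
  by apply: filterS hg => x /= ->.
have fh : (\int[mu]_x `|f x - h x|%:E <= (e / 5 + e / 5)%:E)%E.
  rewrite -(setUv (E N)) ge0_integral_setU//=; last 3 first.
  - exact: measurableC.
  - by rewrite setUv; apply/measurable_EFinP; apply: measurableT_comp => //; exact: measurable_funB.
  - by apply/disj_setPS; rewrite setICr.
  rewrite EFinD leeD//.
    apply: le_trans fgn; rewrite le_eqVlt; apply/orP; left; apply/eqP.
    by apply: eq_integral => x xE; rewrite /h patchE xE.
  apply: le_trans HN; rewrite le_eqVlt; apply/orP; left; apply/eqP.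
  by apply: eq_integral => x; rewrite inE => xE; rewrite /h patchE memNset// subr0.
near=> n.
have e5n : (modulus mu (boxk (rad n)) h <= (e / 5)%:E)%E.
  near: n; apply: cvge0_le => //.
  exact: modulus_cvg_cont hM h0 ch.
apply: (le_trans (modulus_triangle (markov_boxk (rad_gt0 n)) mf mh)).
apply: (@le_trans _ _ ((e / 5)%:E + 2%:E * (e / 5 + e / 5)%:E)%E).
  by apply: leeD => //; apply: lee_wpmul2l.
by rewrite -EFinM -EFinD lee_fin; lra.
Unshelve. all: by end_near. Qed.

End approximate_identity_R.

Section sigma_finite_product_instance.
Context d1 d2 (X1 : measurableType d1) (X2 : measurableType d2) {R : realType}.
Variables (m1 : {sigma_finite_measure set X1 -> \bar R})
  (m2 : {sigma_finite_measure set X2 -> \bar R}).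

(* The library's canonical sigma-finite structure on [m1 \x m2] only covers
   subprobabilities. *)
Definition pairm : {sigma_finite_measure set (X1 * X2)%type -> \bar R} :=
  HB.pack (m1 \x m2)%E (Measure_isSigmaFinite.Build _ _ _ (m1 \x m2)%E
    (sigma_finite_product m1 m2)).

End sigma_finite_product_instance.

Section product_kernel.
Context d1 d2 (X1 : measurableType d1) (X2 : measurableType d2) {R : realType}.
Variables (m1 : {sigma_finite_measure set X1 -> \bar R})
  (m2 : {sigma_finite_measure set X2 -> \bar R}).
Local Notation X := (X1 * X2)%type.

Definition kprod (k1 : X1 * X1 -> R) (k2 : X2 * X2 -> R) (p : X * X) : R :=
  k1 (p.1.1, p.2.1) * k2 (p.1.2, p.2.2).

Lemma measurable_kprod k1 k2 : measurable_fun setT k1 -> measurable_fun setT k2 ->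
  measurable_fun setT (kprod k1 k2).
Proof.
move=> mk1 mk2; apply: measurable_funM.
  apply: (measurableT_comp mk1); apply: measurable_fun_pair.
    exact: (measurableT_comp measurable_fst measurable_fst).
  exact: (measurableT_comp measurable_fst measurable_snd).
apply: (measurableT_comp mk2); apply: measurable_fun_pair.
  exact: (measurableT_comp measurable_snd measurable_fst).
exact: (measurableT_comp measurable_snd measurable_snd).
Qed.

Lemma ge0_integral_tensor (f : X1 -> R) (g : X2 -> R) :
  measurable_fun setT f -> measurable_fun setT g ->
  (forall x, 0 <= f x) -> (forall x, 0 <= g x) ->
  (\int[(pairm m1 m2)]_z (f z.1 * g z.2)%:E =
   (\int[m1]_x (f x)%:E) * (\int[m2]_x (g x)%:E))%E.
Proof.
move=> mf mg f0 g0; apply: (etrans (fubini_tonelli1 _ _ _)).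
- by apply/measurable_EFinP; apply: measurable_funM; apply: measurableT_comp.
- by move=> z; rewrite lee_fin mulr_ge0.
rewrite -ge0_integralZr//; last 3 first.
- exact/measurable_EFinP.
- by move=> x _; rewrite lee_fin.
- by apply: integral_ge0 => x _; rewrite lee_fin.
apply: eq_integral => x _; rewrite /fubini_F /=.
under eq_integral do rewrite EFinM.
by rewrite ge0_integralZl//; [exact/measurable_EFinP|move=> ? _; rewrite lee_fin|rewrite lee_fin].
Qed.

Lemma markov_kprod k1 k2 : markov_kernel m1 k1 -> markov_kernel m2 k2 ->
  markov_kernel (pairm m1 m2) (kprod k1 k2).
Proof.
move=> [mk1 k10 k1l k1r] [mk2 k20 k2l k2r]; split.
- exact: measurable_kprod.
- by move=> p; rewrite mulr_ge0.
- move=> [y1 y2].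
  rewrite (@ge0_integral_tensor (fun x => k1 (y1, x)) (fun x => k2 (y2, x)))//.
  + by rewrite k1l k2l mule1.
  + exact: measurable_fun_pair2.
  + exact: measurable_fun_pair2.
- move=> [x1 x2].
  rewrite (@ge0_integral_tensor (fun y => k1 (y, x1)) (fun y => k2 (y, x2)))//.
  + by rewrite k1r k2r mule1.
  + exact: measurable_fun_pair1.
  + exact: measurable_fun_pair1.
Qed.

(** The triangle inequality through the intermediate point [(y1, x2)]. Each of the two increments is
    independent of one variable, in which the other kernel integrates to 1: [y2] for the first
    increment, [x1] for the second. *)
Let sum_of_moduli k1 k2 (f : X -> R) : markov_kernel m1 k1 -> markov_kernel m2 k2 ->
  measurable_fun setT f ->
  (modulus (pairm m1 m2) (kprod k1 k2) f <=
   \int[m2]_x2 modulus m1 k1 (fun x1 => f (x1, x2)) +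
   \int[m1]_y1 modulus m2 k2 (fun x2 => f (y1, x2)))%E.
Proof.
move=> mk1 mk2 mf; have mkp := markov_kprod mk1 mk2.
have [mk1' k10 k1l k1r] := mk1; have [mk2' k20 k2l k2r] := mk2.
have mfst1 : measurable_fun setT (fun p : X * X => p.1.1).
  exact: (measurableT_comp measurable_fst measurable_fst).
have mfst2 : measurable_fun setT (fun p : X * X => p.1.2).
  exact: (measurableT_comp measurable_snd measurable_fst).
have msnd1 : measurable_fun setT (fun p : X * X => p.2.1).
  exact: (measurableT_comp measurable_fst measurable_snd).
have msnd2 : measurable_fun setT (fun p : X * X => p.2.2).
  exact: (measurableT_comp measurable_snd measurable_snd).
pose h1 (p : X * X) : R := k1 (p.1.1, p.2.1) * `|f (p.2.1, p.2.2) - f (p.1.1, p.2.2)|.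
pose h2 (p : X * X) : R := k2 (p.1.2, p.2.2) * `|f (p.1.1, p.2.2) - f (p.1.1, p.1.2)|.
have mh1 : measurable_fun setT h1.
  apply: measurable_funM.
    by apply: (measurableT_comp mk1'); exact: measurable_fun_pair.
  apply: measurableT_comp => //; apply: measurable_funB;
    by apply: (measurableT_comp mf); exact: measurable_fun_pair.
have mh2 : measurable_fun setT h2.
  apply: measurable_funM.
    by apply: (measurableT_comp mk2'); exact: measurable_fun_pair.
  apply: measurableT_comp => //; apply: measurable_funB;
    by apply: (measurableT_comp mf); exact: measurable_fun_pair.
have h10 p : 0 <= h1 p by rewrite mulr_ge0.
have h20 p : 0 <= h2 p by rewrite mulr_ge0.
pose G1 (p : X * X) : R := h1 p * k2 (p.1.2, p.2.2).
pose G2 (p : X * X) : R := h2 p * k1 (p.1.1, p.2.1).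
have mG1 : measurable_fun setT G1.
  apply: measurable_funM => //.
  by apply: (measurableT_comp mk2'); exact: measurable_fun_pair.
have mG2 : measurable_fun setT G2.
  apply: measurable_funM => //.
  by apply: (measurableT_comp mk1'); exact: measurable_fun_pair.
have G10 p : 0 <= G1 p by rewrite mulr_ge0.
have G20 p : 0 <= G2 p by rewrite mulr_ge0.
have mE (G : X * X -> R) : measurable_fun setT G -> (forall p, 0 <= G p) ->
    measurable_fun setT (fun y => \int[(pairm m1 m2)]_x (G (y, x))%:E)%E.
  move=> mG G0; apply: (measurable_fun_fubini_tonelli_F (EFin \o G)).
    exact/measurable_EFinP.
  by move=> p; rewrite lee_fin.
apply: (@le_trans _ _ (\int[(pairm m1 m2)]_y \int[(pairm m1 m2)]_x (G1 (y, x))%:E +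
    \int[(pairm m1 m2)]_y \int[(pairm m1 m2)]_x (G2 (y, x))%:E)%E).
  rewrite -ge0_integralD//; last 4 first.
  - by move=> y _; apply: integral_ge0 => x _; rewrite lee_fin.
  - exact: mE.
  - by move=> y _; apply: integral_ge0 => x _; rewrite lee_fin.
  - exact: mE.
  apply: ge0_le_integral => //.
  - by move=> y _; apply: integral_ge0 => x _; rewrite lee_fin !mulr_ge0.
  - exact: measurable_modulus1.
  - by apply: emeasurable_funD; exact: mE.
  move=> y _; rewrite -ge0_integralD//; last 4 first.
  - by move=> x _; rewrite lee_fin.
  - by apply/measurable_EFinP; exact: measurable_fun_pair2.
  - by move=> x _; rewrite lee_fin.
  - by apply/measurable_EFinP; exact: measurable_fun_pair2.
  apply: ge0_le_integral => //.
  - by move=> x _; rewrite lee_fin !mulr_ge0.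
  - apply/measurable_EFinP.
    exact: (@measurable_fun_pair2 _ _ _ _ _ _ (fun p : X * X =>
      kprod k1 k2 p * `|f p.2 - f p.1|) y (measurable_modulus mkp mf)).
  - by apply: emeasurable_funD; apply/measurable_EFinP; exact: measurable_fun_pair2.
  move=> x _; rewrite -EFinD lee_fin /G1 /G2 /h1 /h2 /kprod /=.
  case: y x => y1 y2 [x1 x2] /=.
  set K1 := k1 _; set K2 := k2 _.
  have K10 : 0 <= K1 := k10 _.
  have K20 : 0 <= K2 := k20 _.
  have -> : K1 * `|f (x1, x2) - f (y1, x2)| * K2 + K2 * `|f (y1, x2) - f (y1, y2)| * K1 =
    K1 * K2 * (`|f (x1, x2) - f (y1, x2)| + `|f (y1, x2) - f (y1, y2)|) by ring.
  rewrite ler_wpM2l ?mulr_ge0//.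
  by rewrite (le_trans _ (ler_normD _ _))// addrA subrK.
apply: leeD.
- rewrite le_eqVlt; apply/orP; left; apply/eqP.
  apply: (etrans (fubini_tonelli1 _ _ _)).
  + exact: mE.
  + by move=> y; apply: integral_ge0 => x _; rewrite lee_fin.
  transitivity (\int[m1]_y1 \int[m2]_x2 \int[m1]_x1
      (k1 (y1, x1) * `|f (x1, x2) - f (y1, x2)|)%:E)%E.
    apply: eq_integral => y1 _; rewrite /fubini_F.
    transitivity (\int[(pairm m1 m2)]_x \int[m2]_y2 (G1 ((y1, y2), x))%:E)%E.
      apply: (@fubini_tonelli _ _ _ _ _ m2 (pairm m1 m2) (fun q => (G1 ((y1, q.1), q.2))%:E)).
        apply/measurable_EFinP; apply: (measurableT_comp mG1).
        by apply: measurable_fun_pair => //; exact: measurable_fun_pair.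
      by move=> q; rewrite lee_fin.
    (* [h1] does not depend on [y2], nor [h2] on [x1], so [point] is an arbitrary placeholder here
       and below. *)
    transitivity (\int[(pairm m1 m2)]_x (h1 ((y1, point), x))%:E)%E.
      apply: eq_integral => x _.
      transitivity (\int[m2]_y2 ((h1 ((y1, point), x))%:E * (k2 (y2, x.2))%:E))%E.
        by apply: eq_integral.
      rewrite ge0_integralZl//; first by rewrite k2r mule1.
      - by apply/measurable_EFinP; exact: measurable_fun_pair1.
      - by move=> y2 _; rewrite lee_fin.
      - by rewrite lee_fin.
    apply: (fubini_tonelli2 (fun x => (h1 ((y1, point), x))%:E)).
      by apply/measurable_EFinP; exact: measurable_fun_pair2.
    by move=> x; rewrite lee_fin.
  apply: (@fubini_tonelli _ _ _ _ _ m1 m2 (fun q => \int[m1]_x1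
      (k1 (q.1, x1) * `|f (x1, q.2) - f (q.1, q.2)|)%:E)%E).
    apply: (measurable_fun_fubini_tonelli_F (fun p : X * X1 => (k1 (p.1.1, p.2) * `|f (p.2, p.1.2) - f (p.1.1, p.1.2)|)%:E)).
      apply/measurable_EFinP; apply: measurable_funM.
        apply: (measurableT_comp mk1'); apply: measurable_fun_pair => //.
        exact: (measurableT_comp measurable_fst measurable_fst).
      apply: measurableT_comp => //; apply: measurable_funB.
        apply: (measurableT_comp mf); apply: measurable_fun_pair => //.
        exact: (measurableT_comp measurable_snd measurable_fst).
      apply: (measurableT_comp mf); apply: measurable_fun_pair.
        exact: (measurableT_comp measurable_fst measurable_fst).
      exact: (measurableT_comp measurable_snd measurable_fst).
    by move=> p; rewrite lee_fin mulr_ge0.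
  by move=> q; apply: integral_ge0 => x1 _; rewrite lee_fin mulr_ge0.
- rewrite le_eqVlt; apply/orP; left; apply/eqP.
  apply: (etrans (fubini_tonelli1 _ _ _)).
  + exact: mE.
  + by move=> y; apply: integral_ge0 => x _; rewrite lee_fin.
  apply: eq_integral => y1 _; apply: eq_integral => y2 _.
  apply: (etrans (fubini_tonelli2 _ _ _)).
  + by apply/measurable_EFinP; exact: measurable_fun_pair2.
  + by move=> x; rewrite lee_fin.
  apply: eq_integral => x2 _; rewrite /fubini_G.
  transitivity (\int[m1]_x1 ((h2 ((y1, y2), (point, x2)))%:E * (k1 (y1, x1))%:E))%E.
    by apply: eq_integral.
  rewrite ge0_integralZl//; first by rewrite k1l mule1.
  - by apply/measurable_EFinP; exact: measurable_fun_pair2.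
  - by move=> x1 _; rewrite lee_fin.
  - by rewrite lee_fin.
Qed.

(** Almost every slice of [f] is integrable, so its modulus in one variable tends to 0; it is
    dominated by twice the L1 norm of the slice. Dominated convergence over the slices then makes
    both terms of [sum_of_moduli] vanish. *)
Lemma approximate_identity_prod (k1 : nat -> X1 * X1 -> R) (k2 : nat -> X2 * X2 -> R) :
  approximate_identity m1 k1 -> approximate_identity m2 k2 ->
  approximate_identity (pairm m1 m2) (fun n => kprod (k1 n) (k2 n)).
Proof.
move=> [mk1 ck1] [mk2 ck2]; split=> [n|f If]; first exact: markov_kprod.
have mf := L1_measurable If.
pose A n : \bar R := (\int[m2]_x2 modulus m1 (k1 n) (fun x1 => f (x1, x2)))%E.
pose B n : \bar R := (\int[m1]_y1 modulus m2 (k2 n) (fun x2 => f (y1, x2)))%E.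
have A0 n : (0 <= A n)%E by apply: integral_ge0 => x _; exact: modulus_ge0.
have B0 n : (0 <= B n)%E by apply: integral_ge0 => x _; exact: modulus_ge0.
have mabs : measurable_fun setT (abse \o (EFin \o f)).
  by apply: measurableT_comp => //; exact/measurable_EFinP.
have cA : A n @[n --> \oo] --> 0%E.
  pose g x2 := (2%:E * \int[m1]_x1 `|f (x1, x2)|%:E)%E.
  have mA n : measurable_fun setT (fun x2 => modulus m1 (k1 n) (fun x1 => f (x1, x2))).
    have [mk1n k1n0 _ _] := mk1 n.
    pose H (p : (X2 * X1) * X1) : \bar R :=
      (k1 n (p.1.2, p.2) * `|f (p.2, p.1.1) - f (p.1.2, p.1.1)|)%:E.
    have mH : measurable_fun setT H.
      apply/measurable_EFinP; apply: measurable_funM.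
        apply: (measurableT_comp mk1n); apply: measurable_fun_pair => //.
        exact: (measurableT_comp measurable_snd measurable_fst).
      apply: measurableT_comp => //; apply: measurable_funB.
        apply: (measurableT_comp mf); apply: measurable_fun_pair => //.
        exact: (measurableT_comp measurable_fst measurable_fst).
      apply: (measurableT_comp mf); apply: measurable_fun_pair.
        exact: (measurableT_comp measurable_snd measurable_fst).
      exact: (measurableT_comp measurable_fst measurable_fst).
    have H0 p : (0 <= H p)%E by rewrite lee_fin mulr_ge0.
    apply: (measurable_fun_fubini_tonelli_F (fun q : X2 * X1 => \int[m1]_x1 H (q, x1))%E).
      exact: measurable_fun_fubini_tonelli_F.
    by move=> q; exact: integral_ge0.
  have ig : m2.-integrable setT g.
    have : m2.-integrable setT (fun x2 => \int[m1]_x1 `|(EFin \o f) (x1, x2)|)%E.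
      apply/integrableP; split; first exact: (measurable_fun_fubini_tonelli_G _ mabs (fun x => abse_ge0 _)).
      under eq_integral => y _ do rewrite gee0_abs ?integral_ge0//.
      by apply/(integrable21ltyP m1 m2) => //; exact/measurable_EFinP.
    exact: integrableZl.
  have cf_ : {ae m2, forall x2, setT x2 ->
      modulus m1 (k1 n) (fun x1 => f (x1, x2)) @[n --> \oo] --> (cst 0%E x2 : \bar R)}.
    by apply: filterS (ae_integrable2 If) => x2 Ix2 _; exact: ck1.
  have fg_ : {ae m2, forall x2 n, setT x2 ->
      (`|modulus m1 (k1 n) (fun x1 => f (x1, x2))| <= g x2)%E}.
    apply: aeW => x2 n _; rewrite gee0_abs; last exact: modulus_ge0.
    by apply: modulus_le => //; exact: measurable_fun_pair1.
  have [_ _] := dominated_convergence measurableT mA (@measurable_cst _ _ _ _ _ _) cf_ ig fg_.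
  by rewrite integral0.
have cB : B n @[n --> \oo] --> 0%E.
  pose g y1 := (2%:E * \int[m2]_x2 `|f (y1, x2)|%:E)%E.
  have mB n : measurable_fun setT (fun y1 => modulus m2 (k2 n) (fun x2 => f (y1, x2))).
    have [mk2n k2n0 _ _] := mk2 n.
    pose H (p : (X1 * X2) * X2) : \bar R :=
      (k2 n (p.1.2, p.2) * `|f (p.1.1, p.2) - f (p.1.1, p.1.2)|)%:E.
    have mH : measurable_fun setT H.
      apply/measurable_EFinP; apply: measurable_funM.
        apply: (measurableT_comp mk2n); apply: measurable_fun_pair => //.
        exact: (measurableT_comp measurable_snd measurable_fst).
      apply: measurableT_comp => //; apply: measurable_funB.
        apply: (measurableT_comp mf); apply: measurable_fun_pair => //.
        exact: (measurableT_comp measurable_fst measurable_fst).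
      apply: (measurableT_comp mf); apply: measurable_fun_pair.
        exact: (measurableT_comp measurable_fst measurable_fst).
      exact: (measurableT_comp measurable_snd measurable_fst).
    have H0 p : (0 <= H p)%E by rewrite lee_fin mulr_ge0.
    apply: (measurable_fun_fubini_tonelli_F (fun q : X1 * X2 => \int[m2]_x2 H (q, x2))%E).
      exact: measurable_fun_fubini_tonelli_F.
    by move=> q; exact: integral_ge0.
  have ig : m1.-integrable setT g.
    have : m1.-integrable setT (fun y1 => \int[m2]_x2 `|(EFin \o f) (y1, x2)|)%E.
      apply/integrableP; split; first exact: (measurable_fun_fubini_tonelli_F _ mabs (fun x => abse_ge0 _)).
      under eq_integral => y _ do rewrite gee0_abs ?integral_ge0//.
      by apply/(integrable12ltyP m1 m2) => //; exact/measurable_EFinP.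
    exact: integrableZl.
  have cf_ : {ae m1, forall y1, setT y1 ->
      modulus m2 (k2 n) (fun x2 => f (y1, x2)) @[n --> \oo] --> (cst 0%E y1 : \bar R)}.
    by apply: filterS (ae_integrable1 If) => y1 Iy1 _; exact: ck2.
  have fg_ : {ae m1, forall y1 n, setT y1 ->
      (`|modulus m2 (k2 n) (fun x2 => f (y1, x2))| <= g y1)%E}.
    apply: aeW => y1 n _; rewrite gee0_abs; last exact: modulus_ge0.
    by apply: modulus_le => //; exact: measurable_fun_pair2.
  have [_ _] := dominated_convergence measurableT mB (@measurable_cst _ _ _ _ _ _) cf_ ig fg_.
  by rewrite integral0.
apply: ge0_cvge0 => [n|e e0]; first by apply: modulus_ge0; exact: markov_kprod.
have e20 : 0 < e / 2 by rewrite divr_gt0.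
apply: filterS2 (cvge0_le e20 cA) (cvge0_le e20 cB) => n An Bn.
apply: (le_trans (sum_of_moduli (mk1 n) (mk2 n) mf)).
by rewrite [e in leRHS]splitr EFinD; exact: leeD.
Qed.

End product_kernel.

(** * Integration and box kernels on R^n and on space-time *)

Section rV_integrals.
Context {R : realType}.
Local Notation mu := (@lebesgue_measure R).
Local Notation T := (measurableTypeR R).

Lemma ge0_integral_rVS n (f : 'rV[R]_n.+1 -> \bar R) : measurable_fun setT f ->
  (forall x, 0 <= f x)%E ->
  (\int[lebesgue_rV n.+1]_x f x = \int[pairm mu (lebesgue_rV n)]_p f (cons_rV p))%E.
Proof.
move=> mf f0.
exact: (@ge0_integral_pushforward _ _ _ _ R (@cons_rV R n) (@measurable_cons_rV R n)
  (mu \x lebesgue_rV n)%E setT f measurableT mf (fun x _ => f0 x)).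
Qed.

Lemma L1_rVS n (f : 'rV[R]_n.+1 -> R) : measurable_fun setT f ->
  L1 (pairm mu (lebesgue_rV n)) setT (f \o @cons_rV R n) <->
  L1 (lebesgue_rV n.+1) setT f.
Proof.
move=> mf; have mEf : measurable_fun setT (EFin \o f) by exact/measurable_EFinP.
have mfc : measurable_fun setT (f \o @cons_rV R n).
  by apply: measurableT_comp => //; exact: measurable_cons_rV.
split=> /integrableP[_ foo]; apply/integrableP; split.
- exact/measurable_EFinP.
- by rewrite ge0_integral_rVS//; exact: measurableT_comp.
- exact/measurable_EFinP.
- by move: foo; rewrite ge0_integral_rVS//; exact: measurableT_comp.
Qed.

Lemma Rintegral_rVS n (f : 'rV[R]_n.+1 -> R) : L1 (lebesgue_rV n.+1) setT f ->
  \int[lebesgue_rV n.+1]_x f x = \int[pairm mu (lebesgue_rV n)]_p f (cons_rV p).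
Proof.
move=> If; have mf := L1_measurable If.
congr fine; apply: (@integral_pushforward _ _ _ _ R (@cons_rV R n)
  (@measurable_cons_rV R n) (mu \x lebesgue_rV n)%E setT (EFin \o f)) => //.
  exact/measurable_EFinP.
by apply/(L1_rVS mf).
Qed.

Lemma cons_rV0 n (p : T * 'rV[R]_n) : cons_rV p ord0 ord0 = p.1.
Proof. by rewrite mxE unlift_none. Qed.

Lemma cons_rV_lift n (p : T * 'rV[R]_n) i : cons_rV p ord0 (lift ord0 i) = p.2 ord0 i.
Proof. by rewrite mxE liftK. Qed.

Lemma uncons_rVK n (x : 'rV[R]_n.+1) : cons_rV (uncons_rV x) = x.
Proof.
apply/rowP => i; rewrite mxE; case: (unliftP ord0 i) => [j|] ->.
  by rewrite /= mxE.
by [].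
Qed.

Lemma measurable_rV_prod n (f : 'I_n -> R -> R) :
  (forall i, measurable_fun setT (f i : T -> R)) ->
  measurable_fun setT (fun x : 'rV[R]_n => \prod_i f i (x ord0 i)).
Proof.
move=> mf.
apply: (@measurable_prod _ _ _ _ _ (index_enum 'I_n) (fun i (x : 'rV[R]_n) => f i (x ord0 i))).
by move=> i _; apply: (measurableT_comp (mf i)); exact: measurable_coord.
Qed.

(** Induction on the dimension through [cons_rV]; in dimension 0 the measure is a Dirac mass and the
    empty product is 1. *)
Lemma integral_rV_prod n (f : 'I_n -> R -> R) : (forall i, L1 mu setT (f i)) ->
  L1 (lebesgue_rV n) setT (fun x => \prod_i f i (x ord0 i)) /\
  \int[lebesgue_rV n]_x (\prod_i f i (x ord0 i)) = \prod_i \int[mu]_t f i t.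
Proof.
elim: n f => [|n IHn] f If.
  have E : (fun x : 'rV[R]_0 => \prod_i f i (x ord0 i)) = cst 1.
    by apply/funext => x; rewrite big_ord0.
  rewrite E big_ord0; split.
    apply: ge0_L1 => //=.
    by rewrite integral_dirac//= diracE mem_set// mul1e ltry.
  by rewrite /Rintegral/= integral_dirac// diracE mem_set// mul1e.
have mf i := L1_measurable (If i).
pose g (t : T) := f ord0 t.
pose h (x : 'rV[R]_n) := \prod_i f (lift ord0 i) (x ord0 i).
have [Ih ih] := IHn (fun i => f (lift ord0 i)) (fun i => If (lift ord0 i)).
have E : (fun x : 'rV[R]_n.+1 => \prod_i f i (x ord0 i)) \o @cons_rV R n =
    fun p => g p.1 * h p.2.
  apply/funext => p /=; rewrite big_ord_recl cons_rV0; congr (_ * _).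
  by apply: eq_bigr => i _; rewrite cons_rV_lift.
have [Igh igh] := L1_tensor (m1 := mu) (If ord0) Ih.
have IF : L1 (lebesgue_rV n.+1) setT (fun x => \prod_i f i (x ord0 i)).
  by apply/L1_rVS; [exact: measurable_rV_prod|rewrite E; exact: Igh].
split=> //; rewrite Rintegral_rVS// big_ord_recl -ih -[RHS]igh.
by apply: eq_Rintegral => p _; have := congr1 (fun F => F p) E.
Qed.

Definition box_rV n (e : R) (p : 'rV[R]_n * 'rV[R]_n) : R :=
  \prod_i box e (p.1 ord0 i - p.2 ord0 i).

Lemma box_rV_ge0 n e p : 0 < e -> 0 <= @box_rV n e p.
Proof. by move=> e0; apply: prodr_ge0 => i _; exact: box_ge0. Qed.

Lemma box_rV_cons n e (p q : T * 'rV[R]_n) :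
  box_rV e (cons_rV p, cons_rV q) = kprod (boxk e) (@box_rV n e) (p, q).
Proof.
rewrite /box_rV big_ord_recl !cons_rV0; congr (_ * _).
by apply: eq_bigr => i _; rewrite !cons_rV_lift.
Qed.

Lemma measurable_box_rV n e : measurable_fun setT (@box_rV n e).
Proof.
apply: (@measurable_prod _ _ _ _ _ (index_enum 'I_n)
  (fun i (p : 'rV[R]_n * 'rV[R]_n) => box e (p.1 ord0 i - p.2 ord0 i))).
move=> i _; apply: (measurableT_comp (measurable_box e)); apply: measurable_funB.
  exact: (measurableT_comp (measurable_coord i) measurable_fst).
exact: (measurableT_comp (measurable_coord i) measurable_snd).
Qed.

Lemma markov_box_rV n e : 0 < e -> markov_kernel (lebesgue_rV n) (@box_rV n e).
Proof.
move=> e0; elim: n => [|n IHn].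
  have box1 p : @box_rV 0 e p = 1 by rewrite /box_rV big_ord0.
  split=> [|p|y|x]; first exact: measurable_box_rV.
  - by rewrite box1.
  - under eq_integral do rewrite box1.
    by rewrite /= integral_dirac//= diracE mem_set// mul1e.
  - under eq_integral do rewrite box1.
    by rewrite /= integral_dirac//= diracE mem_set// mul1e.
have [_ _ kl kr] := markov_kprod (markov_boxk e0) IHn.
split.
- exact: measurable_box_rV.
- by move=> p; exact: box_rV_ge0.
- move=> y; rewrite ge0_integral_rVS; last 2 first.
  + by apply/measurable_EFinP; apply: measurable_fun_pair2; exact: measurable_box_rV.
  + by move=> x; rewrite lee_fin box_rV_ge0.
  rewrite -(kl (uncons_rV y)); apply: eq_integral => p _; rewrite -box_rV_cons.
  by rewrite uncons_rVK.
- move=> x; rewrite ge0_integral_rVS; last 2 first.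
  + by apply/measurable_EFinP; apply: measurable_fun_pair1; exact: measurable_box_rV.
  + by move=> y; rewrite lee_fin box_rV_ge0.
  rewrite -(kr (uncons_rV x)); apply: eq_integral => p _; rewrite -box_rV_cons.
  by rewrite uncons_rVK.
Qed.

(** The product of approximate identities is transported by [cons_rV]; in dimension 0 there is a
    single point and the modulus is 0. *)
Lemma approximate_identity_rV n :
  approximate_identity (@lebesgue_rV R n) (fun k => box_rV k.+1%:R^-1).
Proof.
elim: n => [|n IHn].
  split=> [k|f If]; first by apply: markov_box_rV.
  rewrite (_ : (fun k => _) = cst 0%E); first exact: cvg_cst.
  apply/funext => k; rewrite /modulus integral0_eq// => y _; rewrite integral0_eq// => x _.
  have -> : x = y by apply/rowP => -[].
  by rewrite subrr normr0 mulr0.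
have [_ ck] := approximate_identity_prod (@approximate_identity_R R) IHn.
split=> [k|f If]; first by apply: markov_box_rV.
have mf := L1_measurable If.
have Ifc : L1 (pairm mu (lebesgue_rV n)) setT (f \o @cons_rV R n) by exact/L1_rVS.
rewrite (_ : (fun k => _) = fun k => modulus (pairm mu (lebesgue_rV n))
  (kprod (boxk k.+1%:R^-1) (box_rV k.+1%:R^-1)) (f \o @cons_rV R n)); first exact: ck.
apply/funext => k.
pose G (p : 'rV[R]_n.+1 * 'rV[R]_n.+1) : \bar R :=
  (box_rV k.+1%:R^-1 p * `|f p.2 - f p.1|)%:E.
have mG : measurable_fun setT G.
  apply/measurable_EFinP; apply: measurable_funM; first exact: measurable_box_rV.
  by apply: measurableT_comp => //; apply: measurable_funB; apply: measurableT_comp.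
have G0 p : (0 <= G p)%E by rewrite lee_fin mulr_ge0// box_rV_ge0.
rewrite /modulus.
transitivity (\int[lebesgue_rV n.+1]_y \int[lebesgue_rV n.+1]_x G (y, x))%E; first by [].
rewrite ge0_integral_rVS; last 2 first.
- exact: (measurable_fun_fubini_tonelli_F G mG G0).
- by move=> y; exact: integral_ge0.
apply: eq_integral => q _; rewrite ge0_integral_rVS//; last exact: measurable_fun_pair2.
by apply: eq_integral => p _; rewrite /G box_rV_cons.
Qed.

Section space_time.
Variable d : nat.
Local Notation Z := (T * 'rV[R]_d)%type.

(** The same measure as [leb_tx], packed with the sigma-finiteness that the kernel lemmas require;
    the two are convertible. *)
Definition mtx : {sigma_finite_measure set Z -> \bar R} := pairm mu (lebesgue_rV d).

Definition boxtx (e : R) : Z * Z -> R := kprod (boxk e) (@box_rV d e).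

Lemma markov_boxtx e : 0 < e -> markov_kernel mtx (boxtx e).
Proof. by move=> e0; apply: markov_kprod; [exact: markov_boxk|exact: markov_box_rV]. Qed.

Lemma approximate_identity_tx : approximate_identity mtx (fun k => boxtx k.+1%:R^-1).
Proof. exact: (approximate_identity_prod (@approximate_identity_R R) (approximate_identity_rV d)). Qed.

End space_time.

End rV_integrals.

(** * Mollifiers *)

Section eta.
Context {R : realType} (d : nat).
Local Notation mu := (@lebesgue_measure R).
Local Notation T := (measurableTypeR R).
Local Notation V := 'rV[R]_d.
Implicit Types (e : R) (n m : 'I_d -> nat).

Lemma L1_box e y : 0 < e -> L1 mu setT (fun t => box e (y - t)).
Proof.
move=> e0; have [mk k0 kl _] := markov_boxk e0.
apply: ge0_L1; first exact: (@measurable_fun_pair2 _ _ _ _ _ _ (boxk e) y mk).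
- by move=> t; exact: (k0 (y, t)).
- by have := kl y; rewrite /boxk /= => ->; exact: ltry.
Qed.

Lemma L1_profile e k y : 0 < e -> L1 mu setT (fun t => profile e k.+1 (y - t)).
Proof.
move=> e0; have [C C0 HC] := @profile_box R k.
apply: (@L1_le _ T R mu _ (fun t => C * e ^- k * box e (y - t))).
- apply: (measurableT_comp (measurable_profile e k.+1)).
  exact: measurable_funB.
- move=> t; apply: (le_trans (HC _ _ e0)); apply: ler_wpM2l.
    by rewrite mulr_ge0// invr_ge0 exprn_ge0// ltW.
  by case: (0 <= _)%R; rewrite ?mul1r ?mul0r// box_ge0.
- by apply: L1Zl; exact: L1_box.
Qed.

(* The partial derivative of multi-index [n], in the variable [p.1], of the
   mollifier [\prod_k profile e 1 (p.1 k - p.2 k)]. *)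
Definition eta e n (p : V * V) : R :=
  \prod_k profile e (n k).+1 (p.1 ord0 k - p.2 ord0 k).

Definition addi n (i : 'I_d) : 'I_d -> nat := fun k => (n k + (k == i))%N.

Definition mzero0 : 'I_d -> nat := fun=> 0%N.

Lemma measurable_eta e n : measurable_fun setT (eta e n).
Proof.
apply: (@measurable_prod _ _ _ _ _ (index_enum 'I_d)
  (fun k (p : V * V) => profile e (n k).+1 (p.1 ord0 k - p.2 ord0 k))).
move=> k _; apply: (measurableT_comp (measurable_profile e (n k).+1)).
apply: measurable_funB.
  exact: (measurableT_comp (measurable_coord k) measurable_fst).
exact: (measurableT_comp (measurable_coord k) measurable_snd).
Qed.

(** The exponent is the order of the multi-index: each space derivative costs one factor [1/e],
    while the mollifier itself is dominated by [box_rV] uniformly in [e]. *)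
Lemma eta_box n : exists2 C, 0 <= C & forall e p, 0 < e ->
  `|eta e n p| <= C * e ^- (\sum_k n k) * box_rV e p.
Proof.
have /choice[C HC] : forall k : 'I_d, exists C : R, 0 <= C /\ forall e s, 0 < e ->
    `|profile e (n k).+1 s| <= C * e ^- n k * box e s.
  move=> k; have [C C0 HC] := @profile_box R (n k); exists C; split=> // e s e0.
  apply: (le_trans (HC _ _ e0)); apply: ler_wpM2l.
    by rewrite mulr_ge0// invr_ge0 exprn_ge0// ltW.
  by case: (0 <= _)%R; rewrite ?mul1r ?mul0r// box_ge0.
exists (\prod_k C k) => [|e p e0]; first by apply: prodr_ge0 => k _; have [] := HC k.
rewrite /eta normr_prod -exprVn -prodrXr -!big_split/=.
apply: ler_prod => k _; rewrite normr_ge0/= exprVn.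
by have [_] := HC k; apply.
Qed.

Lemma box_rV_bound e (p : V * V) : 0 < e -> box_rV e p <= (2 * e) ^- d.
Proof.
move=> e0; rewrite /box_rV -exprVn.
have -> : (2 * e)^-1 ^+ d = \prod_(k < d) (2 * e)^-1 by rewrite prodr_const card_ord.
by apply: ler_prod => k _; rewrite box_ge0//= box_bound.
Qed.

Lemma box_rV_eq0 e (p : V * V) k : e < `|p.1 ord0 k - p.2 ord0 k| -> box_rV e p = 0.
Proof. by move=> h; rewrite /box_rV (bigD1 k)//= box_eq0// mul0r. Qed.

(** Here [M] may depend on [e]: these bounds only justify Fubini. Estimates that must survive the
    limit in [e] go through [eta_box]. The two summands of [M] serve the masses and the supremum. *)
Lemma eta_bounds e n : 0 < e -> exists2 M, 0 <= M &
  [/\ forall p, `|eta e n p| <= M,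
   forall x, (\int[lebesgue_rV d]_y `|eta e n (y, x)|%:E <= M%:E)%E &
   forall y, (\int[lebesgue_rV d]_x `|eta e n (y, x)|%:E <= M%:E)%E].
Proof.
move=> e0; have [C C0 HC] := eta_box n.
pose D := C * e ^- (\sum_k n k).
have D0 : 0 <= D by rewrite mulr_ge0// invr_ge0 exprn_ge0// ltW.
have B0 : 0 <= (2 * e) ^- d by rewrite invr_ge0 exprn_ge0// mulr_ge0// ltW.
have [mk k0 kl kr] := @markov_box_rV R d _ e0.
have mE := measurable_eta e n.
exists (D + D * (2 * e) ^- d); first by rewrite addr_ge0// mulr_ge0.
split=> [p|x|y].
- apply: (le_trans (HC _ _ e0)); rewrite -[C * _]/D.
  apply: (@le_trans _ _ (D * (2 * e) ^- d)); last by rewrite lerDr.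
  by rewrite ler_wpM2l// box_rV_bound.
- apply: (@le_trans _ _ (\int[lebesgue_rV d]_y (D%:E * (box_rV e (y, x))%:E))%E).
    apply: ge0_le_integral => //.
    + by apply/measurable_EFinP; apply: measurableT_comp => //; exact: measurable_fun_pair1.
    + by apply: emeasurable_funM => //; apply/measurable_EFinP; exact: measurable_fun_pair1.
    + by move=> y _; rewrite -EFinM lee_fin; exact: HC.
  rewrite ge0_integralZl//; last 2 first.
  + by apply/measurable_EFinP; exact: measurable_fun_pair1.
  + by move=> y _; rewrite lee_fin.
  by rewrite kr mule1 lee_fin lerDl mulr_ge0.
- apply: (@le_trans _ _ (\int[lebesgue_rV d]_x (D%:E * (box_rV e (y, x))%:E))%E).
    apply: ge0_le_integral => //.
    + by apply/measurable_EFinP; apply: measurableT_comp => //; exact: measurable_fun_pair2.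
    + by apply: emeasurable_funM => //; apply/measurable_EFinP; exact: measurable_fun_pair2.
    + by move=> x _; rewrite -EFinM lee_fin; exact: HC.
  rewrite ge0_integralZl//; last 2 first.
  + by apply/measurable_EFinP; exact: measurable_fun_pair2.
  + by move=> x _; rewrite lee_fin.
  by rewrite kl mule1 lee_fin lerDl mulr_ge0.
Qed.

Lemma integral_eta e y : 0 < e ->
  L1 (lebesgue_rV d) setT (fun x => eta e mzero0 (y, x)) /\
  \int[lebesgue_rV d]_x eta e mzero0 (y, x) = 1.
Proof.
move=> e0; have [I i] := @integral_rV_prod R d (fun k t => profile e 1 (y ord0 k - t))
  (fun k => L1_profile 0 _ e0).
split; first exact: I.
rewrite -[LHS]/(\int[lebesgue_rV d]_x \prod_k profile e 1 (y ord0 k - x ord0 k)).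
by rewrite i big1// => k _; rewrite Rintegral_profile.
Qed.

(** Both sides factor over the coordinates and only the factor [i] changes, by [profile_by_parts].
    The sign is attached to the first kernel so that both sides have the form compared in
    [kop_transfer]. *)
Lemma eta_by_parts e n m i x x' : 0 < e ->
  \int[lebesgue_rV d]_y (eta e (addi n i) (y, x) * eta e m (y, x')) =
  \int[lebesgue_rV d]_y (- eta e n (y, x) * eta e (addi m i) (y, x')).
Proof.
move=> e0.
have L1p k l (a b : R) : L1 mu setT (fun t => profile e k.+1 (t - a) * profile e l.+1 (t - b)).
  have [C C0 HC] := @profile_bound R l.+1.
  apply: (@L1Ml _ _ _ _ _ _ (C * e ^- l.+1)).
  - exact: integrable_profile.
  - by apply: (measurableT_comp (measurable_profile e l.+1)); exact: measurable_funB.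
  - by move=> t; exact: HC.
pose J p q k := \int[mu]_t (profile e p.+1 (t - x ord0 k) * profile e q.+1 (t - x' ord0 k)).
have prodE n1 n2 : \int[lebesgue_rV d]_y (eta e n1 (y, x) * eta e n2 (y, x')) =
    \prod_k J (n1 k) (n2 k) k.
  rewrite -(integral_rV_prod (fun k => L1p (n1 k) (n2 k) (x ord0 k) (x' ord0 k))).2.
  by apply: eq_Rintegral => y _; rewrite -big_split.
have HJ p q k : J p.+1 q k = - J p q.+1 k by exact: profile_by_parts.
have L1e n1 n2 : L1 (lebesgue_rV d) setT (fun y => eta e n1 (y, x) * eta e n2 (y, x')).
  have := (integral_rV_prod (fun k => L1p (n1 k) (n2 k) (x ord0 k) (x' ord0 k))).1.
  by under eq_fun do rewrite big_split.
transitivity (- 1 * \int[lebesgue_rV d]_y (eta e n (y, x) * eta e (addi m i) (y, x'))); last first.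
  rewrite -RintegralZl//; last exact: L1e.
  by apply: eq_Rintegral => y _; rewrite mulN1r mulNr.
rewrite (prodE (addi n i) m) (prodE n (addi m i)); move: HJ; clearbody J => {prodE} HJ.
rewrite (bigD1 i)//= [in RHS](bigD1 i)//= /addi eqxx !addn1.
rewrite HJ mulN1r mulNr; congr (- (_ * _)).
by apply: eq_bigr => k /negbTE ->; rewrite !addn0.
Qed.

End eta.

(** * The energy inequality *)

Section energy_inequality.
Context {R : realType} (d : nat).
Local Notation mu := (@lebesgue_measure R).
Variables (A : 'I_d -> 'I_d -> R) (gamma lambda T : R).
Hypotheses (A_sym : forall i j, A i j = A j i) (gamma_gt0 : 0 < gamma)
  (A_ge : forall xi : 'I_d -> R,
    gamma * \sum_i xi i ^+ 2 <= \sum_i \sum_j A i j * xi i * xi j)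
  (lambda_gt0 : 0 < lambda) (T_gt0 : 0 < T).
Variables P p Gam G : 'I_d -> R -> R.
Hypotheses (dP : forall i (s : R), is_derive s (1 : R) (P i) (p i s))
  (dGam : forall i (s : R), is_derive s (1 : R) (Gam i) (G i s))
  (cp : forall i, continuous (p i)) (cG : forall i, continuous (G i))
  (P0 : forall i, P i 0 = 0) (Gam0 : forall i, Gam i 0 = 0).

Let sumD (h dh : 'I_d -> R -> R) (s : R) :
  (forall i, is_derive s (1 : R) (h i) (dh i s)) ->
  is_derive s (1 : R) (fun s => \sum_i h i s) (\sum_i dh i s).
Proof.
move=> H; have := is_derive_sum H.
by rewrite (_ : \sum_(i < d) h i = fun s => \sum_i h i s)//; apply/funext => t; rewrite fct_sumE.
Qed.

Let prodD (f g : R -> R) (df dg s : R) : is_derive s (1 : R) f df ->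
  is_derive s (1 : R) g dg -> is_derive s (1 : R) (fun s => f s * g s) (f s * dg + df * g s).
Proof.
move=> hf hg; apply: (is_derive_eq (is_deriveM hf hg)).
by rewrite /GRing.scale/= (mulrC df).
Qed.

Let w (s : R) : R := expR (- (lambda * s)).

Let dw (s : R) : is_derive s (1 : R) w (- lambda * w s).
Proof.
have d1 : is_derive s (1 : R) (fun s => - (lambda * s)) (- lambda).
  apply: (is_derive_eq (is_deriveN (@is_deriveZ _ _ _ id lambda s 1 _ (is_derive_id s (1 : R))))).
  by rewrite /GRing.scale/= mulr1.
have := @is_derive1_comp _ expR (fun s => - (lambda * s)) s _ _
  (is_derive_expR (- (lambda * s))) d1.
by rewrite mulrC.
Qed.

Let Q (s : R) : R := \sum_i \sum_j A i j * (P i s * P j s).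
Let U (s : R) : R := \sum_i Gam i s * P i s.
Let N (s : R) : R := \sum_i Gam i s * Gam i s.
(* The functional [exp(-lambda s) E0 s] vanishes at 0, is nonnegative, and its
   derivative is at most the integrand of [energy_inequality]; the term in [N]
   compensates the indefinite cross term [U]. *)
Let E0 (s : R) : R := 2^-1 * Q s + (U s + 2 / gamma * N s).

Let dQ' (s : R) : R := \sum_i \sum_j A i j * (P i s * p j s + p i s * P j s).
Let dU' (s : R) : R := \sum_i (Gam i s * p i s + G i s * P i s).
Let dN' (s : R) : R := \sum_i (Gam i s * G i s + G i s * Gam i s).
Let dE0' (s : R) : R := 2^-1 * dQ' s + (dU' s + 2 / gamma * dN' s).

Let dZ (k : R) (f : R -> R) (df s : R) : is_derive s (1 : R) f df ->
  is_derive s (1 : R) (fun s => k * f s) (k * df).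
Proof. by move=> h; exact: is_deriveZ. Qed.

Let dQ s : is_derive s (1 : R) Q (dQ' s).
Proof.
apply: (sumD (h := fun i s => \sum_j A i j * (P i s * P j s))
  (dh := fun i s => \sum_j A i j * (P i s * p j s + p i s * P j s))) => i.
apply: (sumD (h := fun j s => A i j * (P i s * P j s))
  (dh := fun j s => A i j * (P i s * p j s + p i s * P j s))) => j.
by apply: dZ; exact: prodD.
Qed.

Let dU s : is_derive s (1 : R) U (dU' s).
Proof.
apply: (sumD (h := fun i s => Gam i s * P i s)
  (dh := fun i s => Gam i s * p i s + G i s * P i s)) => i.
exact: prodD.
Qed.

Let dN s : is_derive s (1 : R) N (dN' s).
Proof.
apply: (sumD (h := fun i s => Gam i s * Gam i s)
  (dh := fun i s => Gam i s * G i s + G i s * Gam i s)) => i.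
exact: prodD.
Qed.

Let dE0 s : is_derive s (1 : R) E0 (dE0' s).
Proof.
apply: (is_deriveD (dZ _ (dQ s))).
exact: (is_deriveD (dU s) (dZ _ (dN s))).
Qed.

Let E s := w s * E0 s.
Let dE' s := w s * dE0' s + - lambda * w s * E0 s.

Let dE s : is_derive s (1 : R) E (dE' s).
Proof. exact: prodD (dw s) (dE0 s). Qed.

Let dcont (f df : R -> R) : (forall s, is_derive s (1 : R) f (df s)) -> continuous f.
Proof.
move=> h s; apply/differentiable_continuous/derivable1_diffP.
by have [] := h s.
Qed.

Let cP i : continuous (P i). Proof. exact: dcont. Qed.
Let cGam i : continuous (Gam i). Proof. exact: dcont. Qed.

Let cM (f g : R -> R) : continuous f -> continuous g -> continuous (fun s => f s * g s).
Proof. by move=> cf cg s; apply: cvgM; [exact: cf|exact: cg]. Qed.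

Let cD (f g : R -> R) : continuous f -> continuous g -> continuous (fun s => f s + g s).
Proof. by move=> cf cg s; apply: cvgD; [exact: cf|exact: cg]. Qed.

Let csum (h : 'I_d -> R -> R) : (forall i, continuous (h i)) ->
  continuous (fun s => \sum_i h i s).
Proof.
move=> ch; elim: (index_enum _) => [|i r IH].
  by rewrite (_ : (fun _ => _) = cst 0); [move=> s; exact: cvg_cst|apply/funext => s; rewrite big_nil].
rewrite (_ : (fun _ => _) = fun s => h i s + \sum_(j <- r) h j s); first exact: cD.
by apply/funext => s; rewrite big_cons.
Qed.

Let ccst (k : R) : continuous (fun _ : R => k).
Proof. by move=> s; exact: cvg_cst. Qed.

Let Phi (s : R) : R := w s * \sum_i (\sum_j A i j * P j s + Gam i s) * p i s.
Let S (s : R) : R := w s * \sum_i G i s ^+ 2.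

Let cPhi : continuous Phi.
Proof.
apply: cM; first exact: dcont dw.
apply: csum => i; apply: cM => //; apply: cD => //; apply: csum => j.
by apply: cM.
Qed.

Let cS : continuous S.
Proof.
apply: cM; first exact: dcont dw.
by apply: csum => i; apply: cM.
Qed.

Let cdE : continuous dE'.
Proof.
have cw : continuous w by exact: dcont dw.
apply: cD; apply: cM => //.
- apply: cD; first apply: cM => //.
    apply: csum => i; apply: csum => j; apply: cM => //.
    by apply: cD; apply: cM.
  apply: cD; first by apply: csum => i; apply: cD; apply: cM.
  by apply: cM => //; apply: csum => i; apply: cD; apply: cM.
- by apply: cM.
- exact: dcont dE0.
Qed.

Let quad (x g : R) (k : R) : 0 < k -> 0 <= k * x ^+ 2 - x * g + (4 * k)^-1 * g ^+ 2.
Proof.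
move=> k0; have -> : k * x ^+ 2 - x * g + (4 * k)^-1 * g ^+ 2 =
    k * (x - (2 * k)^-1 * g) ^+ 2 by field; rewrite gt_eqF.
by rewrite mulr_ge0 ?sqr_ge0// ltW.
Qed.

Let sumP2 s := \sum_i P i s ^+ 2.
Let sumG2 s := \sum_i Gam i s ^+ 2.

(** Ellipticity gives [Q / 2] at least [gamma / 2] times the square of [P]. Half of this absorbs the
    cross term [U] by Young's inequality, which also consumes half of the coefficient [2 / gamma] of
    [N]. *)
Let E0_ge s : gamma / 4 * sumP2 s + gamma^-1 * sumG2 s <= E0 s.
Proof.
have hQ : gamma * sumP2 s <= Q s.
  apply: (le_trans (A_ge (fun i => P i s))).
  by apply: ler_sum => i _; apply: ler_sum => j _; rewrite mulrA.
have hN : N s = sumG2 s by apply: eq_bigr => i _.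
have hU : 0 <= gamma / 4 * sumP2 s + U s + gamma^-1 * sumG2 s.
  rewrite /sumP2 /U /sumG2 !mulr_sumr -!big_split/=; apply: sumr_ge0 => i _.
  have g40 : 0 < gamma / 4 by rewrite divr_gt0.
  have := quad (P i s) (- Gam i s) g40.
  have -> : (4 * (gamma / 4))^-1 = gamma^-1 by congr (_^-1); field.
  by rewrite mulrN opprK sqrrN (mulrC (P i s)).
rewrite /E0 hN; have -> : 2 / gamma = gamma^-1 + gamma^-1 by field; rewrite gt_eqF.
rewrite mulrDl.
have : 2^-1 * (gamma * sumP2 s) <= 2^-1 * Q s by rewrite ler_wpM2l.
have : 2^-1 * (gamma * sumP2 s) = gamma / 4 * sumP2 s + gamma / 4 * sumP2 s by field.
move: hU; set a := gamma / 4 * _; set b := gamma^-1 * _; set c := 2^-1 * Q s.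
by move=> hU ->; lra.
Qed.

(** Differentiating the weight produces [- lambda * E0], whose coercivity absorbs the cross terms
    [G P] and [4 / gamma * Gam G] of the derivative of [E0]. Completing one square in [P] and one in
    [Gam] leaves [1 + 4 = 5] times the square of [G] over [gamma * lambda]. *)
Let key s : dE' s <= Phi s + 5 / (gamma * lambda) * S s.
Proof.
have w0 : 0 <= w s by exact: expR_ge0.
pose gP := \sum_i G i s * P i s.
pose gG := \sum_i Gam i s * G i s.
pose pp := \sum_i (\sum_j A i j * P j s + Gam i s) * p i s.
have hdE : dE0' s = pp + gP + 4 / gamma * gG.
  have h1 : dQ' s = 2 * \sum_i (\sum_j A i j * P j s) * p i s.
    rewrite /dQ' mulr2n mulrDl mul1r.
    have -> : \sum_i (\sum_j A i j * P j s) * p i s =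
      \sum_i \sum_j A i j * (p i s * P j s).
      by apply: eq_bigr => i _; rewrite mulr_suml; apply: eq_bigr => j _; ring.
    (* Symmetry of [A] identifies the two halves of the derivative of [Q]. *)
    have e2 : \sum_i \sum_j A i j * (p i s * P j s) = \sum_i \sum_j A i j * (P i s * p j s).
      rewrite exchange_big/=; apply: eq_bigr => i _; apply: eq_bigr => j _.
      by rewrite A_sym mulrC (mulrC (p j s)) mulrC.
    rewrite {1}e2 -big_split/=; apply: eq_bigr => i _; rewrite -big_split/=.
    by apply: eq_bigr => j _; rewrite mulrDr.
  have h2 : dU' s = \sum_i Gam i s * p i s + gP by rewrite -big_split.
  have h3 : dN' s = 2 * gG.
    rewrite mulr2n mulrDl mul1r -big_split/=; apply: eq_bigr => i _.
    by rewrite (mulrC (G i s)).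
  have h4 : pp = \sum_i (\sum_j A i j * P j s) * p i s + \sum_i Gam i s * p i s.
    by rewrite -big_split/=; apply: eq_bigr => i _; rewrite mulrDl.
  rewrite /dE0' h1 h2 h3 h4; field; by rewrite gt_eqF.
have hE0 := E0_ge s.
have hg : 0 < gamma * lambda by rewrite mulr_gt0.
have main : 0 <= lambda * E0 s - gP - 4 / gamma * gG +
    5 / (gamma * lambda) * \sum_i G i s ^+ 2.
  have : lambda * (gamma / 4 * sumP2 s + gamma^-1 * sumG2 s) <= lambda * E0 s.
    by rewrite ler_wpM2l// ltW.
  suff : 0 <= lambda * (gamma / 4 * sumP2 s + gamma^-1 * sumG2 s) - gP - 4 / gamma * gG +
    5 / (gamma * lambda) * \sum_i G i s ^+ 2.
    by move: (lambda * E0 s) (lambda * (_ + _)) => x y; lra.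
  rewrite /sumP2 /sumG2 /gP /gG !mulr_sumr -big_split/= mulr_sumr -!sumrN -!big_split/=.
  apply: sumr_ge0 => i _.
  set x := P i s; set y := G i s; set z := Gam i s.
  have -> : lambda * (gamma / 4 * x ^+ 2 + gamma^-1 * z ^+ 2) - y * x -
      4 / gamma * (z * y) + 5 / (gamma * lambda) * y ^+ 2 =
      gamma * lambda / 4 * (x - 2 / (gamma * lambda) * y) ^+ 2 +
      (gamma * lambda)^-1 * (lambda * z - 2 * y) ^+ 2.
    by field; rewrite !gt_eqF.
  by rewrite addr_ge0// mulr_ge0 ?sqr_ge0// ltW// ?invr_gt0// divr_gt0.
rewrite /dE' /Phi /S -[\sum_i (_ + _) * _]/pp hdE.
rewrite -subr_ge0.
have -> : w s * pp + 5 / (gamma * lambda) * (w s * \sum_i G i s ^+ 2) -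
    (w s * (pp + gP + 4 / gamma * gG) + - lambda * w s * E0 s) =
    w s * (lambda * E0 s - gP - 4 / gamma * gG +
    5 / (gamma * lambda) * \sum_i G i s ^+ 2) by ring.
exact: mulr_ge0.
Qed.

Let F s := expR (- (lambda * s)) * (\sum_i (\sum_j A i j * P j s + Gam i s) * p i s)
  + 5 / (gamma * lambda) * (expR (- (lambda * s)) * \sum_i G i s ^+ 2).

Lemma continuous_energy : continuous F.
Proof. by apply: cD => //; apply: cM. Qed.

(** The position in space is frozen, so that [A] is constant in time. By [key] the integrand
    dominates the derivative of the weighted functional, whose increment over [[0, T]] is its
    nonnegative value at [T]. The error term carries the factor [1 / lambda] that makes a large
    [lambda] effective. *)
Lemma energy_inequality : 0 <= \int[mu]_(s in `[0, T]) F s.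
Proof.
change (0 <= \int[mu]_(s in `[0, T]) (Phi s + 5 / (gamma * lambda) * S s)).
have ci (f : R -> R) : continuous f -> mu.-integrable `[0, T] (EFin \o f).
  move=> cf; apply: continuous_compact_integrable; first exact: segment_compact.
  exact: continuous_subspaceT.
have cE : continuous E by exact: dcont dE.
have ftc : \int[mu]_(s in `[0, T]) dE' s = E T - E 0.
  rewrite /Rintegral (@continuous_FTC2 _ dE' E)//.
  - exact: continuous_subspaceT.
  - split.
    + by move=> s _; have [] := dE s.
    + exact/cvg_at_right_filter/cE.
    + exact/cvg_at_left_filter/cE.
  - by move=> s _; rewrite derive1E; have [_ ->] := dE s.
have E_0 : E 0 = 0.
  rewrite /E /E0 /Q /U /N !big1 ?mulr0 ?addr0 ?mulr0//.
  - by move=> i _; rewrite Gam0 mulr0.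
  - by move=> i _; rewrite P0 mulr0.
  - by move=> i _; rewrite big1// => j _; rewrite P0 mul0r mulr0.
have E_T : 0 <= E T.
  rewrite mulr_ge0 ?expR_ge0//; apply: le_trans (E0_ge T).
  rewrite addr_ge0// mulr_ge0//; try (by apply: sumr_ge0 => i _; exact: sqr_ge0).
    by rewrite divr_ge0// ltW.
  by rewrite invr_ge0 ltW.
apply: (@le_trans _ _ (\int[mu]_(s in `[0, T]) dE' s)).
  by rewrite ftc E_0 subr0.
apply: le_Rintegral.
- exact: measurable_itv.
- exact: ci.
- by apply: ci; apply: cD => //; apply: cM.
- by move=> s _; exact: key.
Qed.

End energy_inequality.

(** * Mollification in space and time *)

Section mollification.
Context {R : realType} (d : nat).
Local Notation mu := (@lebesgue_measure R).
Local Notation T := (measurableTypeR R).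
Local Notation V := 'rV[R]_d.
Local Notation Z := (T * V)%type.
Local Notation mz := (@mtx R d).
Local Notation mV := (@lebesgue_rV R d).
Implicit Types (f : Z -> R) (n : 'I_d -> nat) (q z : Z).

Definition moll e m n (p : Z * Z) : R :=
  profile e m (p.1.1 - p.2.1) * eta e n (p.1.2, p.2.2).

Lemma measurable_moll e m n : measurable_fun setT (moll e m n).
Proof.
have m11 : measurable_fun setT (fun p : Z * Z => p.1.1).
  exact: (measurableT_comp measurable_fst measurable_fst).
have m12 : measurable_fun setT (fun p : Z * Z => p.1.2).
  exact: (measurableT_comp measurable_snd measurable_fst).
have m21 : measurable_fun setT (fun p : Z * Z => p.2.1).
  exact: (measurableT_comp measurable_fst measurable_snd).
have m22 : measurable_fun setT (fun p : Z * Z => p.2.2).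
  exact: (measurableT_comp measurable_snd measurable_snd).
apply: measurable_funM.
  by apply: (measurableT_comp (measurable_profile e m)); exact: measurable_funB.
by apply: (measurableT_comp (measurable_eta e n)); exact: measurable_fun_pair.
Qed.

(* [moll] vanishes when [p.2] is later than [p.1]; keeping this in the dominating
   kernel is what lets a time-decreasing weight pass through the average. *)
Definition fbox (e : R) (p : Z * Z) : R := (p.2.1 <= p.1.1)%R%:R * boxtx e p.

Lemma fbox_ge0 e p : 0 < e -> 0 <= fbox e p.
Proof. by move=> e0; rewrite mulr_ge0// mulr_ge0// ?box_ge0// box_rV_ge0. Qed.

Lemma fbox_le e p : 0 < e -> fbox e p <= boxtx e p.
Proof.
move=> e0; rewrite /fbox; case: (p.2.1 <= p.1.1)%R; rewrite ?mul1r// mul0r.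
by rewrite mulr_ge0// ?box_ge0// box_rV_ge0.
Qed.

Lemma measurable_fbox e : 0 < e -> measurable_fun setT (fbox e).
Proof.
move=> e0; have [mk _ _ _] := @markov_boxtx R d e e0.
apply: measurable_funM => //.
have mB : measurable_fun setT (fun p : Z * Z => p.2.1 <= p.1.1).
  apply: measurable_fun_ler.
    exact: (measurableT_comp measurable_fst measurable_snd).
  exact: (measurableT_comp measurable_fst measurable_fst).
rewrite (_ : (fun _ => _) = fun p : Z * Z => if p.2.1 <= p.1.1 then (1 : R) else 0); last first.
  by apply/funext => p; case: ifP.
exact: measurable_fun_ifT.
Qed.

(** Time order [m.+1] costs only [e ^- m], since one factor [1/e] normalizes [fbox]. With [m = 0] a
    single space derivative therefore costs exactly [1/e], the price a Lipschitz coefficient can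
    pay. *)
Lemma moll_fbox m n : exists2 C, 0 <= C & forall e p, 0 < e ->
  `|moll e m.+1 n p| <= C * e ^- (m + \sum_k n k) * fbox e p.
Proof.
have [C1 C10 H1] := @profile_box R m; have [C2 C20 H2] := @eta_box R d n.
exists (C1 * C2) => [|e p e0]; first exact: mulr_ge0.
rewrite /moll normrM exprD invfM.
apply: (le_trans (ler_pM (normr_ge0 _) (normr_ge0 _) (H1 _ _ e0) (H2 _ _ e0))).
rewrite /fbox /boxtx /kprod /boxk subr_ge0 le_eqVlt; apply/orP; left; apply/eqP.
by rewrite /=; ring.
Qed.

Section fixed_scale.
Variable e : R.
Hypothesis e_gt0 : 0 < e.

Let mkb : markov_kernel mz (boxtx e). Proof. exact: markov_boxtx. Qed.

Lemma fbox_mass1 q : L1 mz setT (fun z => fbox e (q, z)) /\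
  \int[mz]_z fbox e (q, z) <= 1.
Proof.
have [mk k0 kl kr] := mkb.
have Ib : L1 mz setT (fun z => boxtx e (q, z)).
  apply: ge0_L1; [exact: measurable_fun_pair2|by []|by rewrite kl ltry].
have If : L1 mz setT (fun z => fbox e (q, z)).
  apply: (L1_le _ _ Ib).
    by apply: (@measurable_fun_pair2 _ _ _ _ _ _ (fbox e) q); exact: measurable_fbox.
  by move=> z; rewrite ger0_norm ?fbox_ge0// fbox_le.
split=> //; apply: (@le_trans _ _ (\int[mz]_z boxtx e (q, z))).
  by apply: le_Rintegral => // z _; exact: fbox_le.
by rewrite /Rintegral kl.
Qed.

Lemma fbox_mass2 z : L1 mz setT (fun q => fbox e (q, z)) /\
  \int[mz]_q fbox e (q, z) <= 1.
Proof.
have [mk k0 kl kr] := mkb.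
have Ib : L1 mz setT (fun q => boxtx e (q, z)).
  by apply: ge0_L1; [exact: measurable_fun_pair1|by []|rewrite kr ltry].
have If : L1 mz setT (fun q => fbox e (q, z)).
  apply: (L1_le _ _ Ib).
    by apply: (@measurable_fun_pair1 _ _ _ _ _ _ (fbox e) z); exact: measurable_fbox.
  by move=> q; rewrite ger0_norm ?fbox_ge0// fbox_le.
split=> //; apply: (@le_trans _ _ (\int[mz]_q boxtx e (q, z))).
  by apply: le_Rintegral => // q _; exact: fbox_le.
by rewrite /Rintegral kr.
Qed.

Lemma moll_bounds m n : exists2 M, 0 <= M &
  [/\ forall p, `|moll e m.+1 n p| <= M,
    forall z, (\int[mz]_q `|moll e m.+1 n (q, z)|%:E <= M%:E)%E &
    forall q, (\int[mz]_z `|moll e m.+1 n (q, z)|%:E <= M%:E)%E].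
Proof.
have [C C0 HC] := moll_fbox m n.
have [mk k0 kl kr] := mkb.
pose D := C * e ^- (m + \sum_k n k).
have D0 : 0 <= D by rewrite mulr_ge0// invr_ge0 exprn_ge0// ltW.
pose b := (2 * e)^-1 * (2 * e) ^- d.
have b0 : 0 <= b by rewrite mulr_ge0// invr_ge0 ?exprn_ge0// mulr_ge0// ltW.
have mE := measurable_moll e m.+1 n.
have HD p : `|moll e m.+1 n p| <= D * boxtx e p.
  apply: (le_trans (HC _ _ e_gt0)); rewrite -[C * _]/D.
  by rewrite ler_wpM2l// fbox_le.
exists (D * b + D); first by rewrite addr_ge0// mulr_ge0.
split=> [p|z|q].
- apply: (le_trans (HD _)); apply: (@le_trans _ _ (D * b)); last by rewrite lerDl.
  rewrite ler_wpM2l// /boxtx /kprod; apply: ler_pM.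
  + exact: box_ge0.
  + exact: box_rV_ge0.
  + exact: box_bound.
  + exact: box_rV_bound.
- apply: (@le_trans _ _ (\int[mz]_q (D%:E * (boxtx e (q, z))%:E))%E).
    apply: ge0_le_integral => //.
    + by apply/measurable_EFinP; apply: measurableT_comp => //; exact: measurable_fun_pair1.
    + by apply: emeasurable_funM => //; apply/measurable_EFinP; exact: measurable_fun_pair1.
    + by move=> q _; rewrite -EFinM lee_fin; exact: HD.
  rewrite ge0_integralZl//; last 2 first.
  + by apply/measurable_EFinP; exact: measurable_fun_pair1.
  + by move=> q _; rewrite lee_fin.
  by rewrite kr mule1 lee_fin lerDr mulr_ge0.
- apply: (@le_trans _ _ (\int[mz]_z (D%:E * (boxtx e (q, z))%:E))%E).
    apply: ge0_le_integral => //.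
    + by apply/measurable_EFinP; apply: measurableT_comp => //; exact: measurable_fun_pair2.
    + by apply: emeasurable_funM => //; apply/measurable_EFinP; exact: measurable_fun_pair2.
    + by move=> z _; rewrite -EFinM lee_fin; exact: HD.
  rewrite ge0_integralZl//; last 2 first.
  + by apply/measurable_EFinP; exact: measurable_fun_pair2.
  + by move=> z _; rewrite lee_fin.
  by rewrite kl mule1 lee_fin lerDr mulr_ge0.
Qed.

(** Time order 0 is allowed here: the step is bounded but not integrable in time, which is why the
    mass bounds of [moll_bounds] start at order 1. *)
Lemma moll_bound m n : exists2 M, 0 <= M & forall p, `|moll e m n p| <= M.
Proof.
have [C C0 HC] := @profile_bound R m; have [M M0 [HM _ _]] := eta_bounds n e_gt0.
exists (C * e ^- m * M) => [|p].
  by rewrite !mulr_ge0// invr_ge0 exprn_ge0// ltW.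
by rewrite normrM; apply: ler_pM => //; exact: HC.
Qed.

(** Time order [m = 1] with the zero multi-index is the mollification of [f]; [m = 0] gives time
    primitives, and [n] counts the space derivatives. *)
Definition mop m n f (q : Z) : R := kop mz (moll e m n) f q.

Lemma measurable_mop m n f : measurable_fun setT f -> measurable_fun setT (mop m n f).
Proof. by move=> mf; apply: measurable_kop => //; exact: measurable_moll. Qed.

Lemma L1_mop m n f : L1 mz setT f -> L1 mz setT (mop m.+1 n f).
Proof.
move=> If; have [M M0 [_ HM _]] := moll_bounds m n.
exact: L1_kop (measurable_moll _ _ _) If HM.
Qed.

Lemma mop_bound m n f : L1 mz setT f -> exists M, forall q, `|mop m n f q| <= M.
Proof.
move=> If; have [M M0 HM] := moll_bound m n.
exists (M * \int[mz]_z `|f z|) => q.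
by apply: kop_bound => //; exact: measurable_moll.
Qed.

Lemma L1_mop_section m n f q : L1 mz setT f ->
  L1 mz setT (fun z => f z * moll e m n (q, z)).
Proof.
move=> If; have [M M0 HM] := moll_bound m n.
by apply: L1_kop_section HM => //; exact: measurable_moll.
Qed.

(** Differentiation under the integral, with the derivative dominated by a multiple of [|f|]. It is
    this relation between consecutive time orders that makes [mop 0] a primitive of [mop 1]. *)
Lemma is_derive_mop m n f y (s : R) : L1 mz setT f ->
  is_derive s (1 : R) (fun s => mop m n f (s, y)) (mop m.+1 n f (s, y)).
Proof.
move=> If; have mf := L1_measurable If.
have [M M0 HM] := moll_bound m.+1 n.
pose F (s : R) (z : Z) : R := f z * moll e m n ((s, y), z).
have dF (t : R) z : is_derive t (1 : R) (F ^~ z) (f z * moll e m.+1 n ((t, y), z)).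
  rewrite /F /moll /=.
  rewrite (_ : F^~ z = fun t => (f z * eta e n (y, z.2)) * profile e m (t - z.1)); last first.
    by apply/funext => t'; rewrite /F /moll /=; ring.
  have := @is_deriveZ _ _ _ _ (f z * eta e n (y, z.2)) _ _ _ (is_derive_profile_shift e m z.1 t).
  move=> h; apply: (is_derive_eq h).
  by rewrite /GRing.scale/= -mulrA [eta _ _ _ * _]mulrC.
have F1E (t : R) z : partial1of2 F t z = f z * moll e m.+1 n ((t, y), z).
  by rewrite partial1of2E; have [_ ->] := dF t z.
have Is : (`]s - 1, s + 1[%classic : set R) s by rewrite /= in_itv/=; lra.
have IF (t : R) : (`]s - 1, s + 1[%classic : set R) t -> mz.-integrable setT (EFin \o F t).
  by move=> _; exact: L1_mop_section.
have dF1 (t : R) z : (`]s - 1, s + 1[%classic : set R) t -> setT z -> derivable (F ^~ z) t 1.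
  by move=> _ _; have [] := dF t z.
have G0 z : 0 <= `|f z| * M by rewrite mulr_ge0.
have IG : mz.-integrable setT (EFin \o (fun z => `|f z| * M)).
  have := L1Zl M (L1_norm If); apply: eq_integrable => // z _.
  by rewrite /= mulrC.
have Gub (t : R) z : (`]s - 1, s + 1[%classic : set R) t -> setT z ->
    `|partial1of2 F t z| <= `|f z| * M.
  by move=> _ _; rewrite F1E normrM ler_wpM2l.
have D := @differentiation_under_integral R _ Z mz F setT measurableT s (s - 1) (s + 1)
  Is IF dF1 _ G0 IG Gub.
have D' := @derivable_under_integral R _ Z mz F setT measurableT s (s - 1) (s + 1)
  Is IF dF1 _ G0 IG Gub.
apply: DeriveDef; first exact: D'.
rewrite -derive1E; apply: (etrans D).
by apply: eq_Rintegral => z _; rewrite F1E.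
Qed.

Lemma mop_le0 n f q : (forall z, f z != 0 -> 0 < z.1) -> q.1 <= 0 -> mop 0 n f q = 0.
Proof.
move=> f0 q0; rewrite /mop /kop.
transitivity (\int[mz]_z (cst (0 : R) z)); last by rewrite Rintegral_cst// mul0r.
apply: eq_Rintegral => z _; rewrite /moll /=.
have [->|/f0 z0] := eqVneq (f z) 0; first by rewrite mul0r.
by rewrite profile_le0 ?mul0r ?mulr0// subr_le0 (le_trans q0)// ltW.
Qed.

Section fixed_time.
Variable s : R.

(** At a frozen time the time factor of the mollifier is absorbed into the function. What remains is
    a kernel between space and space-time, bounded and with bounded mass in space, whatever the time
    order. *)
Let prof k (h : Z -> R) z := h z * profile e k (s - z.1).
Let K n (p : V * Z) := eta e n (p.1, p.2.2).
Let K' n (p : V * Z) := - eta e n (p.1, p.2.2).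

Let Lp k h : L1 mz setT h -> L1 mz setT (prof k h).
Proof.
move=> Ih; have [C C0 HC] := @profile_bound R k.
apply: (@L1Ml _ _ _ mz _ _ (C * e ^- k)) => //; last by move=> z; exact: HC.
apply: (measurableT_comp (measurable_profile e k)).
exact: measurable_funB.
Qed.

Let mopE k n1 h y : mop k n1 h (s, y) = kop mz (K n1) (prof k h) y.
Proof. by apply: eq_Rintegral => z _; rewrite /prof /K /moll mulrA. Qed.

Let mK n1 : measurable_fun setT (K n1).
Proof.
apply: (measurableT_comp (measurable_eta e n1)).
apply: measurable_fun_pair => //.
exact: (measurableT_comp measurable_snd measurable_snd).
Qed.

Lemma L1_mop_space k n1 h : L1 mz setT h -> L1 mV setT (fun y => mop k n1 h (s, y)).
Proof.
move=> Ih; have [B B0 [_ iB _]] := eta_bounds n1 e_gt0.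
have : L1 mV setT (kop mz (K n1) (prof k h)).
  by apply: (L1_kop (mK n1) (Lp k Ih)) => z; exact: iB.
by congr (L1 _ _ _); apply/funext => y; rewrite mopE.
Qed.

(** The integration by parts is [eta_by_parts] for the kernels, transferred by [kop_transfer]: no
    decay of the mollified functions has to be established. *)
Lemma mop_by_parts m m' n n' i f g : L1 mz setT f -> L1 mz setT g ->
  \int[mV]_y (mop m (addi n i) f (s, y) * mop m' n' g (s, y)) =
  - \int[mV]_y (mop m n f (s, y) * mop m' (addi n' i) g (s, y)).
Proof.
move=> If Ig.
have mK' n1 : measurable_fun setT (K' n1).
  exact: (measurable_funN (mK n1)).
have [M1 M10 [b1 i1 _]] := eta_bounds (addi n i) e_gt0.
have [M2 M20 [b2 i2 _]] := eta_bounds n' e_gt0.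
have [M3 M30 [b3 i3 _]] := eta_bounds n e_gt0.
have [M4 M40 [b4 i4 _]] := eta_bounds (addi n' i) e_gt0.
pose M := M1 + M2 + M3 + M4.
have M1M : M1 <= M by rewrite /M; lra.
have M2M : M2 <= M by rewrite /M; lra.
have M3M : M3 <= M by rewrite /M; lra.
have M4M : M4 <= M by rewrite /M; lra.
have key := @kop_transfer _ _ V Z R mV mz (K (addi n i)) (K n') (K' n) (K (addi n' i))
  (prof m f) (prof m' g) M (mK _) (mK _) (mK' _) (mK _) (Lp _ If) (Lp _ Ig).
transitivity (\int[mV]_y (kop mz (K (addi n i)) (prof m f) y * kop mz (K n') (prof m' g) y)).
  by apply: eq_Rintegral => y _; rewrite !mopE.
rewrite key {key}; last first.
- by move=> z z'; exact: eta_by_parts.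
- by move=> z; apply: (le_trans (i4 z.2)).
- move=> z; under eq_integral do rewrite normrN.
  by apply: (le_trans (i3 z.2)).
- by move=> z; apply: (le_trans (i2 z.2)).
- by move=> z; apply: (le_trans (i1 z.2)).
- by move=> p; apply: (le_trans (b4 _)).
- by move=> p; rewrite normrN; apply: (le_trans (b3 _)).
- by move=> p; apply: (le_trans (b2 _)).
- by move=> p; apply: (le_trans (b1 _)).
have [B HB] := mop_bound m' (addi n' i) Ig.
transitivity (\int[mV]_y (- 1 * (mop m n f (s, y) * mop m' (addi n' i) g (s, y)))).
  apply: eq_Rintegral => y _; rewrite !mopE mulN1r -mulNr; congr (_ * _).
  rewrite -mulN1r /kop -RintegralZl//.
    by apply: eq_Rintegral => z _; rewrite /K' /K mulN1r mulrN.
  have : L1 mz setT (fun z => f z * moll e m n ((s, y), z)) by exact: L1_mop_section.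
  by congr (L1 _ _ _); apply/funext => z; rewrite /prof /K /moll mulrA.
rewrite RintegralZl ?mulN1r//.
apply: (L1Ml (L1_mop_space m n If) _ (fun y => HB (s, y))).
apply: (@measurable_fun_pair2 _ _ _ _ _ _ (mop m' (addi n' i) g) s).
exact: (measurable_mop _ _ (L1_measurable Ig)).
Qed.

End fixed_time.

End fixed_scale.

End mollification.

(** * Weak solutions of the linear equation *)

Section weak_solution.
Context {R : realType} (d : nat).
Local Notation mu := (@lebesgue_measure R).
Local Notation T := (measurableTypeR R).
Local Notation V := 'rV[R]_d.
Local Notation Z := (T * V)%type.
Local Notation mz := (@mtx R d).
Local Notation mV := (@lebesgue_rV R d).
Local Notation delta i := (addi (@mzero0 d) i).

Variables (a : V -> 'I_d -> 'I_d -> R) (v w : Z -> R) (h : 'I_d -> Z -> R).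
Variables (tau Ma L M gamma alpha : R).
Hypotheses (tau_gt0 : 0 < tau) (L_ge0 : 0 <= L) (gamma_gt0 : 0 < gamma)
  (alpha_ge0 : 0 <= alpha).
Hypothesis ma : forall i j, measurable_fun setT (fun x => a x i j).
Hypothesis a_bd : forall x i j, `|a x i j| <= Ma.
Hypothesis a_lip : forall (x y : V) i j (r : R), 0 <= r -> (forall k, `|x ord0 k - y ord0 k| <= r) ->
  `|a x i j - a y i j| <= L * r.
Hypothesis a_sym : forall x i j, a x i j = a x j i.
Hypothesis a_ell : forall x (xi : 'I_d -> R),
  gamma * \sum_i xi i ^+ 2 <= \sum_i \sum_j a x i j * xi i * xi j.
Hypotheses (Iv : L1 mz setT v) (Iw : L1 mz setT w) (Ih : forall i, L1 mz setT (h i)).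
Hypothesis w_bd : forall z, `|w z| <= M.
Hypothesis w_supp : forall z, w z != 0 -> 0 < z.1 < tau.
Hypothesis h_w : forall i z, `|h i z| <= alpha * `|w z|.

Let wa i j z := w z * a z.2 i j.

(** The equation with zero initial datum, tested with the kernel of time order 0 centred at [q]. The
    time derivative turns the step into the mollifier of order 1 on the left, while the fluxes on
    the right stay integrated in time; [q.1 < tau] makes the test function admissible. *)
Hypothesis weak_eq : forall e q, 0 < e -> q.1 < tau ->
  mop e 1 (@mzero0 d) v q =
  \sum_i (\sum_j mop e 0 (addi (delta j) i) (fun z => w z * a z.2 i j) q
          - mop e 0 (delta i) (h i) q).

Let Iwa i j : L1 mz setT (wa i j).
Proof.
apply: (@L1Ml _ _ _ mz _ _ Ma) => //.
exact: (measurableT_comp (ma i j) measurable_snd).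
Qed.

Let h_supp i z : h i z != 0 -> 0 < z.1 < tau.
Proof.
move=> hz; apply: w_supp; apply: contra hz => /eqP wz.
by have := h_w i z; rewrite wz normr0 mulr0 normr_le0.
Qed.

Let wa_supp i j z : wa i j z != 0 -> 0 < z.1 < tau.
Proof. by move=> wz; apply: w_supp; apply: contra wz => /eqP wz; rewrite /wa wz mul0r. Qed.

Section fixed_scale.
Variable e : R.
Hypothesis e_gt0 : 0 < e.

(** [flux 0 i] is the time-integrated flux whose divergence is the right-hand side of [weak_eq]. *)
Definition flux m i q := \sum_j mop e m (delta j) (wa i j) q - mop e m (@mzero0 d) (h i) q.
(* The error made in replacing [a z.2] by [a q.2] in the mollified flux: since [a] is
   Lipschitz and the kernel lives at scale [e], it is bounded by an average of [|w|],
   with no loss of powers of [e]. *)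
Definition flux_err m i q := \sum_j (mop e m (delta j) (wa i j) q - a q.2 i j * mop e m (delta j) w q)
  - mop e m (@mzero0 d) (h i) q.

Let fluxE m i q : flux m i q = \sum_j a q.2 i j * mop e m (delta j) w q + flux_err m i q.
Proof. by rewrite /flux /flux_err sumrB; ring. Qed.

Let L1MM m n f m' n' g (s : R) : L1 mz setT f -> L1 mz setT g ->
  L1 mV setT (fun y => mop e m n f (s, y) * mop e m' n' g (s, y)).
Proof.
move=> If Ig; have [B HB] := mop_bound e_gt0 m' n' Ig.
apply: (L1Ml (L1_mop_space e_gt0 s m n If) _ (fun y => HB (s, y))).
apply: (@measurable_fun_pair2 _ _ _ _ _ _ (mop e m' n' g) s).
exact: (measurable_mop _ _ _ (L1_measurable Ig)).
Qed.

(** [weak_eq] multiplied by the mollified [w] and integrated in space; in each term of the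
    divergence the outer derivative [i] moves onto [w] by [mop_by_parts]. *)
Let space_identity (s : R) : s < tau ->
  \int[mV]_y (mop e 1 (@mzero0 d) v (s, y) * mop e 1 (@mzero0 d) w (s, y)) =
  - \int[mV]_y (\sum_i flux 0 i (s, y) * mop e 1 (delta i) w (s, y)).
Proof.
move=> sT.
pose W0 y := mop e 1 (@mzero0 d) w (s, y).
pose Wi i y := mop e 1 (delta i) w (s, y).
pose A0 i j y := mop e 0 (addi (delta j) i) (wa i j) (s, y).
pose A1 i j y := mop e 0 (delta j) (wa i j) (s, y).
pose B0 i y := mop e 0 (delta i) (h i) (s, y).
pose B1 i y := mop e 0 (@mzero0 d) (h i) (s, y).
have IA0 i j : L1 mV setT (fun y => A0 i j y * W0 y) by exact: L1MM.
have IA1 i j : L1 mV setT (fun y => A1 i j y * Wi i y) by exact: L1MM.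
have IB0 i : L1 mV setT (fun y => B0 i y * W0 y) by exact: L1MM.
have IB1 i : L1 mV setT (fun y => B1 i y * Wi i y) by exact: L1MM.
have split (A : 'I_d -> 'I_d -> V -> R) (B W : 'I_d -> V -> R) :
    (forall i j, L1 mV setT (fun y => A i j y * W i y)) ->
    (forall i, L1 mV setT (fun y => B i y * W i y)) ->
    \int[mV]_y (\sum_i (\sum_j A i j y - B i y) * W i y) =
    \sum_i (\sum_j \int[mV]_y (A i j y * W i y) - \int[mV]_y (B i y * W i y)).
  move=> IA IB.
  have E i : (fun y => (\sum_j A i j y - B i y) * W i y) =
      fun y => \sum_j A i j y * W i y - B i y * W i y.
    by apply/funext => y; rewrite mulrBl mulr_suml.
  rewrite Rintegral_sum; last first.
    by move=> i; rewrite E; apply: L1B => //; exact: L1_sum.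
  apply: eq_bigr => i _.
  rewrite -[LHS]/(Rintegral mV setT (fun y => (\sum_j A i j y - B i y) * W i y)) E.
  apply: (etrans (RintegralB measurableT (L1_sum (index_enum 'I_d) (IA i)) (IB i))).
  by rewrite Rintegral_sum.
transitivity (\int[mV]_y (\sum_i (\sum_j A0 i j y - B0 i y) * W0 y)).
  by apply: eq_Rintegral => y _; rewrite weak_eq// mulr_suml.
apply: (etrans (split A0 B0 (fun=> W0) IA0 IB0)).
have -> : \int[mV]_y (\sum_i flux 0 i (s, y) * mop e 1 (delta i) w (s, y)) =
    \sum_i (\sum_j \int[mV]_y (A1 i j y * Wi i y) - \int[mV]_y (B1 i y * Wi i y)).
  exact: (split A1 B1 Wi IA1 IB1).
rewrite -sumrN; apply: eq_bigr => i _; rewrite opprB addrC -sumrN; congr (_ + _).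
  rewrite -[RHS]opprK; congr (- _).
  exact: (mop_by_parts e_gt0 s 0 1 (@mzero0 d) (@mzero0 d) i (Ih i) Iw).
apply: eq_bigr => j _.
exact: (mop_by_parts e_gt0 s 0 1 (delta j) (@mzero0 d) i (Iwa i j) Iw).
Qed.

Section weighted.
Variable lambda : R.
Hypothesis lambda_gt0 : 0 < lambda.

Local Notation K := (5 / (gamma * lambda)).

(** The cut-off to [[0, tau[] keeps the times where the mollified equation is available and lets
    every integral run over the whole space-time. *)
Definition weight (s : R) : R := (0 <= s < tau)%R%:R * expR (- (lambda * s)).

Lemma measurable_weight : measurable_fun setT (weight : T -> R).
Proof.
apply: measurable_funM.
  rewrite (_ : (fun _ => _) = (\1_(`[0, tau[%classic : set T) : T -> R)); last first.
    by apply/funext => s; rewrite indicE; congr (nat_of_bool _)%:R;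
      apply/idP/idP => [?|]; rewrite inE/= in_itv.
  by apply: measurable_indic; exact: measurable_itv.
apply: continuous_measurable_fun => s.
apply: (@continuous_comp _ _ _ (fun s => - (lambda * s)) expR); last exact: continuous_expR.
by apply: cvgN; apply: cvgMr; exact: cvg_id.
Qed.

Lemma weight_ge0 s : 0 <= weight s.
Proof. by rewrite mulr_ge0// expR_ge0. Qed.

Lemma weight_le1 s : `|weight s| <= 1.
Proof.
rewrite ger0_norm ?weight_ge0// /weight.
case: (boolP (0 <= s < tau)%R) => [/andP[s0 _]|_]; last by rewrite mul0r.
by rewrite mul1r expR_le1 oppr_le0 mulr_ge0// ltW.
Qed.

(** The cut-off at [tau] can only lower the later value, whereas the one at 0 breaks monotonicity;
    hence [0 <= t]. *)
Lemma weight_decr s t : 0 <= t -> t <= s -> weight s <= weight t.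
Proof.
move=> t0 ts; rewrite /weight.
case: (boolP (0 <= s < tau)%R) => [/andP[s0 sT]|_].
  rewrite t0 (le_lt_trans ts sT)/= !mul1r ler_expR lerN2.
  by rewrite ler_wpM2l// ltW.
by rewrite mul0r mulr_ge0// expR_ge0.
Qed.

Local Notation G2 q := (\sum_i flux_err 1 i q ^+ 2).

Let L1_flux_err i : L1 mz setT (flux_err 1 i).
Proof.
apply: L1B; last exact: L1_mop.
apply: (@L1_sum _ _ _ mz _ _ (fun j q =>
  mop e 1 (delta j) (wa i j) q - a q.2 i j * mop e 1 (delta j) w q)) => j.
apply: L1B; first exact: L1_mop.
apply: (@L1Mr _ _ _ mz _ _ Ma); [exact: L1_mop| |by move=> q].
exact: (measurableT_comp (ma i j) measurable_snd).
Qed.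

Let measurable_flux_err i : measurable_fun setT (flux_err 1 i).
Proof. exact: L1_measurable (L1_flux_err i). Qed.

Let flux_err_bound i : exists B, forall q, `|flux_err 1 i q| <= B.
Proof.
have [B1 H1] : exists B, forall q j, `|mop e 1 (delta j) (wa i j) q| <= B.
  have /choice[B HB] : forall j, exists B, forall q, `|mop e 1 (delta j) (wa i j) q| <= B.
    by move=> j; exact: mop_bound.
  exists (\sum_j `|B j|) => q j; rewrite (bigD1 j)//=.
  apply: (le_trans (HB j q)); apply: (le_trans (ler_norm _)).
  by rewrite lerDl sumr_ge0.
have [B2 H2] : exists B, forall q j, `|mop e 1 (delta j) w q| <= B.
  have /choice[B HB] : forall j, exists B, forall q, `|mop e 1 (delta j) w q| <= B.
    by move=> j; exact: mop_bound.
  exists (\sum_j `|B j|) => q j; rewrite (bigD1 j)//=.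
  apply: (le_trans (HB j q)); apply: (le_trans (ler_norm _)).
  by rewrite lerDl sumr_ge0.
have [B3 H3] := mop_bound e_gt0 1 (@mzero0 d) (Ih i).
exists (\sum_(j < d) (B1 + Ma * B2) + B3) => q.
apply: (le_trans (ler_normB _ _)); apply: lerD => //.
apply: (le_trans (ler_norm_sum _ _ _)); apply: ler_sum => j _.
apply: (le_trans (ler_normB _ _)); apply: lerD => //.
by rewrite normrM; apply: ler_pM.
Qed.

Let L1_weighted (f : Z -> R) : L1 mz setT f -> L1 mz setT (fun q => weight q.1 * f q).
Proof.
move=> If; apply: (@L1Mr _ _ _ mz _ _ 1) => //; last by move=> q; exact: weight_le1.
exact: (measurableT_comp measurable_weight measurable_fst).
Qed.

Let L1_NW : L1 mz setT (fun q => mop e 1 (@mzero0 d) v q * mop e 1 (@mzero0 d) w q).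
Proof.
have [B HB] := mop_bound e_gt0 1 (@mzero0 d) Iw.
apply: (L1Ml (L1_mop e_gt0 _ _ Iv) _ HB).
exact: (measurable_mop _ _ _ (L1_measurable Iw)).
Qed.

Let L1_Jp : L1 mz setT (fun q => \sum_i flux 0 i q * mop e 1 (delta i) w q).
Proof.
apply: L1_sum => i.
have E : (fun q => flux 0 i q * mop e 1 (delta i) w q) = fun q =>
    \sum_j mop e 0 (delta j) (wa i j) q * mop e 1 (delta i) w q
    - mop e 0 (@mzero0 d) (h i) q * mop e 1 (delta i) w q.
  by apply/funext => q; rewrite mulrBl mulr_suml.
have IMM m n f : L1 mz setT f -> L1 mz setT (fun q => mop e m n f q * mop e 1 (delta i) w q).
  move=> If; have [B HB] := mop_bound e_gt0 m n If.
  apply: (L1Mr (L1_mop e_gt0 _ _ Iw) _ HB).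
  exact: (measurable_mop _ _ _ (L1_measurable If)).
by rewrite E; apply: L1B; [apply: L1_sum => j|]; exact: IMM.
Qed.

Lemma L1_flux_err2 : L1 mz setT (fun q => G2 q).
Proof.
apply: L1_sum => i; have [B HB] := flux_err_bound i.
exact: (L1Ml (L1_flux_err i) (measurable_flux_err i) HB).
Qed.

(** [energy_inequality] at a fixed position [y], with the matrix [a y]. The primitives of time order
    0 vanish at time 0 because [w] and [h] live at positive times, and [fluxE] recognizes the flux
    in the integrand. *)
Let time_inequality y : 0 <= \int[mu]_s
  (weight s * (\sum_i flux 0 i (s, y) * mop e 1 (delta i) w (s, y))
   + K * (weight s * G2 (s, y))).
Proof.
pose P i s := mop e 0 (delta i) w (s, y).
pose p i s := mop e 1 (delta i) w (s, y).
pose Ga i s := flux_err 0 i (s, y).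
pose G i s := flux_err 1 i (s, y).
have dP i (s : R) : is_derive s (1 : R) (P i) (p i s) by exact: is_derive_mop.
have dGm m i (s : R) : is_derive s (1 : R) (fun s => flux_err m i (s, y)) (flux_err m.+1 i (s, y)).
  pose X m j (s : R) := mop e m (delta j) (wa i j) (s, y) - a y i j * mop e m (delta j) w (s, y).
  have dX j : is_derive s (1 : R) (X m j) (X m.+1 j s).
    exact: (is_deriveB (is_derive_mop e_gt0 m (delta j) y s (Iwa i j))
      (is_deriveZ (a y i j) (is_derive_mop e_gt0 m (delta j) y s Iw))).
  have dS : is_derive s (1 : R) (fun s => \sum_j X m j s) (\sum_j X m.+1 j s).
    have := @is_derive_sum _ _ _ d (X m) s 1 (X m.+1 ^~ s) dX.
    rewrite (_ : \sum_(j < d) X m j = fun s => \sum_j X m j s)//.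
    by apply/funext => t; rewrite fct_sumE.
  exact: (is_deriveB dS (is_derive_mop e_gt0 m (@mzero0 d) y s (Ih i))).
have dcont (f df : R -> R) : (forall s : R, is_derive s (1 : R) f (df s)) -> continuous f.
  move=> H s; apply/differentiable_continuous/derivable1_diffP.
  by have [] := H s.
have cp i : continuous (p i).
  exact: (dcont _ _ (fun s => is_derive_mop e_gt0 1 (delta i) y s Iw)).
have cG i : continuous (G i).
  exact: (dcont _ _ (dGm 1%N i)).
have mop0 n f : (forall z, f z != 0 -> 0 < z.1 < tau) -> mop e 0 n f (0, y) = 0.
  by move=> Hf; apply: mop_le0 => // z /Hf /andP[].
have P0 i : P i 0 = 0 by exact: mop0.
have Ga0 i : Ga i 0 = 0.
  rewrite /Ga /flux_err mop0; last exact: h_supp.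
  rewrite subr0 big1// => j _; rewrite !mop0 ?mulr0 ?subr0//.
  exact: wa_supp.
have cF := continuous_energy dP (dGm 0%N) cp cG.
have := energy_inequality (a_sym y) gamma_gt0 (a_ell y) lambda_gt0 tau_gt0 dP (dGm 0%N) cp cG P0 Ga0.
move: (cF (a y) gamma lambda) => {cF}.
set F := (X in continuous X) => cF.
(* The weight excludes [tau] while the energy inequality is on the closed interval; the endpoint is
   negligible. *)
have IF : mu.-integrable `[0, tau[ (EFin \o F).
  have : mu.-integrable `[0, tau] (EFin \o F).
    apply: continuous_compact_integrable; first exact: segment_compact.
    exact: continuous_subspaceT.
  apply: integrableS => //.
  by apply: subset_itvl; rewrite bnd_simp.
rewrite -(Rintegral_itv_bndo_bndc IF) Rintegral_mkcond.
congr (0 <= _); apply: eq_Rintegral => s _.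
rewrite patchE mem_setE in_itv/= /weight.
case: ifPn => _; last by rewrite !mul0r mulr0 addr0.
rewrite !mul1r /F; congr (_ * _ + _).
by apply: eq_bigr => i _; rewrite fluxE.
Qed.

(** Fubini is used in both orders: [space_identity] needs the inner integral in space at a fixed
    time, [time_inequality] the inner integral in time at a fixed position. *)
Lemma weighted_energy :
  \int[mz]_q (weight q.1 * (mop e 1 (@mzero0 d) v q * mop e 1 (@mzero0 d) w q)) <=
  K * \int[mz]_q (weight q.1 * G2 q).
Proof.
pose NW q := mop e 1 (@mzero0 d) v q * mop e 1 (@mzero0 d) w q.
pose Jp q := \sum_i flux 0 i q * mop e 1 (delta i) w q.
have I1 : L1 mz setT (fun q => weight q.1 * NW q) by exact: L1_weighted.
have I2 : L1 mz setT (fun q => weight q.1 * Jp q) by exact: L1_weighted.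
have I3 : L1 mz setT (fun q => weight q.1 * G2 q) by exact: L1_weighted L1_flux_err2.
have E : \int[mz]_q (weight q.1 * NW q) = - \int[mz]_q (weight q.1 * Jp q).
  have [J1 <-] := @L1_Rintegral1 _ _ _ _ _ mu mV _ I1.
  have [J2 <-] := @L1_Rintegral1 _ _ _ _ _ mu mV _ I2.
  rewrite -[RHS]mulN1r -(RintegralZl (-1) measurableT J2).
  apply: eq_Rintegral => s _ /=; rewrite mulN1r.
  have [sT|sT] := ltP s tau; last first.
    have -> : weight s = 0 by rewrite /weight [(s < tau)%R]ltNge sT andbF mul0r.
    rewrite /Rintegral; under eq_integral do rewrite mul0r.
    by under [in RHS]eq_integral do rewrite mul0r; rewrite integral0 oppr0.
  have IN : L1 mV setT (fun y => NW (s, y)) by exact: L1MM.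
  have IJ : L1 mV setT (fun y => Jp (s, y)).
    apply: L1_sum => i.
    have -> : (fun y => flux 0 i (s, y) * mop e 1 (delta i) w (s, y)) = fun y =>
      \sum_j mop e 0 (delta j) (wa i j) (s, y) * mop e 1 (delta i) w (s, y)
      - mop e 0 (@mzero0 d) (h i) (s, y) * mop e 1 (delta i) w (s, y).
      by apply/funext => y; rewrite mulrBl mulr_suml.
    by apply: L1B; [apply: L1_sum => j|]; exact: L1MM.
  rewrite (RintegralZl _ measurableT IN) (RintegralZl _ measurableT IJ).
  by rewrite -mulrN; congr (_ * _); exact: space_identity.
rewrite E -subr_ge0 opprK addrC.
have I4 : L1 mz setT (fun q => weight q.1 * Jp q + K * (weight q.1 * G2 q)).
  by apply: L1D => //; exact: L1Zl.
have -> : \int[mz]_q (weight q.1 * Jp q) + K * \int[mz]_q (weight q.1 * G2 q) =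
    \int[mz]_q (weight q.1 * Jp q + K * (weight q.1 * G2 q)).
  rewrite (RintegralD measurableT I2 (L1Zl K I3)); congr (_ + _).
  by rewrite (RintegralZl _ measurableT I3).
have [_ <-] := @L1_Rintegral2 _ _ _ _ _ mu mV _ I4.
by apply: Rintegral_ge0 => // y _; exact: time_inequality.
Qed.

End weighted.
End fixed_scale.

Let L1w2 : L1 mz setT (fun z => w z ^+ 2).
Proof. exact: (L1Ml Iw (L1_measurable Iw) w_bd). Qed.

Let L1_fbox e (f : Z -> R) B q : 0 < e -> measurable_fun setT f ->
  (forall z, `|f z| <= B) -> L1 mz setT (fun z => f z * fbox e (q, z)).
Proof. by move=> e0 mf Bf; apply: (L1Mr (fbox_mass1 e0 q).1 mf Bf). Qed.

Let mw : measurable_fun setT w. Proof. exact: L1_measurable Iw. Qed.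
Let mnw : measurable_fun setT (fun z => `|w z|). Proof. exact: measurableT_comp. Qed.
Let nw_bd z : `| `|w z| | <= M. Proof. by rewrite normr_id. Qed.

Let flux_err_fbox i : exists2 C, 0 <= C & forall e q, 0 < e ->
  `|flux_err e 1 i q| <= C * kop mz (fbox e) (fun z => `|w z|) q.
Proof.
have /choice[C HC] : forall j : 'I_d, exists C : R, 0 <= C /\ forall (e : R) (p : Z * Z), 0 < e ->
    `|moll e 1 (delta j) p| <= C * e ^- 1 * fbox e p.
  move=> j; have [C C0 HC] := @moll_fbox R d 0 (delta j); exists C; split=> // e p e0.
  apply: (le_trans (HC e p e0)); rewrite add0n.
  by rewrite /addi /mzero0 (bigD1 j)//= eqxx big1 ?addn0// => k /negbTE ->.
have [C0 C00 HC0] := @moll_fbox R d 0 (@mzero0 d).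
exists (\sum_j L * C j + alpha * C0) => [|e q e0].
  by rewrite addr_ge0 ?mulr_ge0// sumr_ge0// => j _; rewrite mulr_ge0//; case: (HC j).
set k := kop _ _ _ _.
have dom (f : Z -> R) (D : R) : L1 mz setT f -> (forall z, `|f z| <= D * (`|w z| * fbox e (q, z))) ->
    `|\int[mz]_z f z| <= D * k.
  move=> If Hf; apply: (le_trans (normr_Rintegral If)).
  have Ik : L1 mz setT (fun z => `|w z| * fbox e (q, z)) by exact: (L1_fbox q e0 mnw nw_bd).
  rewrite /k /kop -(RintegralZl D measurableT Ik).
  by apply: (le_Rintegral measurableT (L1_norm If) (L1Zl D Ik)) => z _.
rewrite mulrDl mulr_suml; apply: (le_trans (ler_normB _ _)); apply: lerD; last first.
  apply: dom; first exact: L1_mop_section.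
  move=> z; rewrite normrM.
  have -> : alpha * C0 * (`|w z| * fbox e (q, z)) = alpha * `|w z| * (C0 * fbox e (q, z)) by ring.
  apply: ler_pM => //; apply: (le_trans (HC0 e (q, z) e0)).
  by rewrite /mzero0 big1// addn0 expr0 invr1 mulr1.
apply: (le_trans (ler_norm_sum _ _ _)); apply: ler_sum => j _.
have I1 : L1 mz setT (fun z => wa i j z * moll e 1 (delta j) (q, z)) by exact: L1_mop_section.
have I2 : L1 mz setT (fun z => w z * moll e 1 (delta j) (q, z)) by exact: L1_mop_section.
have -> : mop e 1 (delta j) (wa i j) q - a q.2 i j * mop e 1 (delta j) w q =
    \int[mz]_z (wa i j z * moll e 1 (delta j) (q, z) - a q.2 i j * (w z * moll e 1 (delta j) (q, z))).
  rewrite (RintegralB measurableT I1 (L1Zl _ I2)); congr (_ - _).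
  by rewrite (RintegralZl _ measurableT I2).
apply: dom; first by apply: L1B => //; exact: L1Zl.
move=> z; rewrite /wa.
have -> : w z * a z.2 i j * moll e 1 (delta j) (q, z) - a q.2 i j * (w z * moll e 1 (delta j) (q, z)) =
  w z * ((a z.2 i j - a q.2 i j) * moll e 1 (delta j) (q, z)) by ring.
have -> : L * C j * (`|w z| * fbox e (q, z)) = `|w z| * (L * e * (C j * e ^- 1 * fbox e (q, z))).
  by field; rewrite gt_eqF.
rewrite normrM ler_wpM2l// normrM.
(* If some coordinate of [z] is farther than [e] from that of [q], the kernel vanishes; otherwise
   the Lipschitz bound [L * e] cancels the factor [1/e] of the derivative. *)
have [far|near] := boolP [exists l, e < `|q.2 ord0 l - z.2 ord0 l|].
  have /existsP[l el] := far.
  have B0 : fbox e (q, z) = 0.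
    by rewrite /fbox /boxtx /kprod /= (box_rV_eq0 (p := (q.2, z.2)) el) !mulr0.
  have := (HC j).2 e (q, z) e0; rewrite B0 !mulr0 normr_le0 => /eqP ->.
  by rewrite normr0 mulr0.
apply: ler_pM => //; last exact: (HC j).2.
apply: a_lip => [|l]; first exact: ltW.
rewrite distrC leNgt; apply: contra near => el.
by apply/existsP; exists l.
Qed.

(** Jensen's inequality for a kernel of mass at most 1: expand the nonnegative integral of
    [(|w| - c)^2] against [fbox], with [c] the average of [|w|]. *)
Let fbox_jensen e q : 0 < e -> kop mz (fbox e) (fun z => `|w z|) q ^+ 2 <=
  kop mz (fbox e) (fun z => w z ^+ 2) q.
Proof.
move=> e0; have [If mass1] := fbox_mass1 e0 q.
have I1 := L1_fbox q e0 mnw nw_bd.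
have I2 : L1 mz setT (fun z => w z ^+ 2 * fbox e (q, z)).
  apply: (@L1_fbox _ _ (M ^+ 2)) => //; first exact: measurable_funM.
  by move=> z; rewrite normrX lerXn2r ?nnegrE// (le_trans _ (w_bd z)).
rewrite /kop; set c := Rintegral _ _ _; set D := Rintegral _ _ _.
have : 0 <= \int[mz]_z ((w z ^+ 2 * fbox e (q, z) - 2 * c * (`|w z| * fbox e (q, z)))
    + c ^+ 2 * fbox e (q, z)).
  apply: Rintegral_ge0 => // z _.
  have -> : w z ^+ 2 * fbox e (q, z) - 2 * c * (`|w z| * fbox e (q, z))
    + c ^+ 2 * fbox e (q, z) = (`|w z| - c) ^+ 2 * fbox e (q, z).
    by rewrite -(real_normK (num_real (w z))); ring.
  by rewrite mulr_ge0 ?sqr_ge0// fbox_ge0.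
rewrite (RintegralD measurableT (L1B I2 (L1Zl _ I1)) (L1Zl _ If)).
rewrite (RintegralB measurableT I2 (L1Zl _ I1)) !(RintegralZl _ measurableT)//.
rewrite -/c -/D.
have : c ^+ 2 * \int[mz]_z fbox e (q, z) <= c ^+ 2.
  by rewrite -[leRHS]mulr1 ler_wpM2l ?sqr_ge0.
set m := \int[mz]_z _; nra.
Qed.

(** Fubini transposes the average onto the weight. The kernel [fbox e (q, z)] vanishes unless [q] is
    at least as late as [z], where the weight is no larger than at [z], and its mass in [q] is at
    most 1. *)
Let weight_fbox lambda e : 0 < lambda -> 0 < e ->
  \int[mz]_q (weight lambda q.1 * kop mz (fbox e) (fun z => w z ^+ 2) q) <=
  \int[mz]_z (weight lambda z.1 * w z ^+ 2).
Proof.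
move=> l0 e0.
have mW : measurable_fun setT (fun q : Z => weight lambda q.1).
  exact: (measurableT_comp (measurable_weight lambda) measurable_fst).
have W1 (q : Z) : `|weight lambda q.1| <= 1 by exact: weight_le1.
pose bd := (2 * e)^-1 * (2 * e) ^- d.
have fB (p : Z * Z) : `|fbox e p| <= bd.
  rewrite ger0_norm ?fbox_ge0//; apply: (le_trans (fbox_le _ e0)).
  by apply: ler_pM; [exact: box_ge0|exact: box_rV_ge0|exact: box_bound|exact: box_rV_bound].
have E := @Rintegral_kopM _ _ Z Z R mz mz (fbox e) (fun z => w z ^+ 2)
  (fun q => weight lambda q.1) bd 1 1 (measurable_fbox e0) L1w2 mW fB.
have -> : \int[mz]_q (weight lambda q.1 * kop mz (fbox e) (fun z => w z ^+ 2) q) =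
    \int[mz]_q (kop mz (fbox e) (fun z => w z ^+ 2) q * weight lambda q.1).
  by apply: eq_Rintegral => q _; rewrite mulrC.
rewrite {}E//; last first.
  move=> z; have [I1 H1] := fbox_mass2 e0 z.
  under eq_integral do rewrite ger0_norm ?fbox_ge0//.
  by rewrite -(EFin_Rintegral I1) lee_fin.
have IG : L1 mz setT (fun z => weight lambda z.1 * w z ^+ 2) by exact: (L1Mr L1w2 mW W1).
have Bd z : `|\int[mz]_q (fbox e (q, z) * weight lambda q.1)| <= 1.
  have [I1 H1] := fbox_mass2 e0 z.
  have I2 := L1Ml I1 mW W1.
  apply: (le_trans (normr_Rintegral I2)); apply: (le_trans _ H1).
  apply: (le_Rintegral measurableT (L1_norm I2) I1) => q _.
  by rewrite normrM ger0_norm ?fbox_ge0// ler_piMr// fbox_ge0.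
have IL : L1 mz setT (fun z => w z ^+ 2 * \int[mz]_q (fbox e (q, z) * weight lambda q.1)).
  apply: (L1Ml L1w2 _ Bd).
  apply: (@measurable_Rintegral1 _ _ Z Z R mz (fun p : Z * Z => fbox e (p.2, p.1) * weight lambda p.2.1)).
  apply: measurable_funM.
    by apply: (measurableT_comp (measurable_fbox e0)); exact: measurable_fun_pair.
  exact: (measurableT_comp mW measurable_snd).
apply: (le_Rintegral measurableT IL IG) => z _.
rewrite [leRHS]mulrC; have [->|wz] := eqVneq (w z) 0; first by rewrite expr0n !mul0r.
rewrite ler_wpM2l ?sqr_ge0//.
have /andP[z0 zT] := w_supp wz.
have [I1 H1] := fbox_mass2 e0 z.
have -> : weight lambda z.1 = weight lambda z.1 * 1 by rewrite mulr1.
apply: (@le_trans _ _ (\int[mz]_q (weight lambda z.1 * fbox e (q, z)))); last first.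
  by rewrite (RintegralZl _ measurableT I1) ler_wpM2l// weight_ge0.
apply: (le_Rintegral measurableT (L1Ml I1 mW W1) (L1Zl _ I1)) => q _.
rewrite /fbox mulrC; have [zq|] := boolP (z.1 <= q.1)%R; last by rewrite /= !mul0r !mulr0.
rewrite !mul1r; apply: ler_wpM2r; last exact: (weight_decr l0 (ltW z0) zq).
by rewrite mulr_ge0// ?box_ge0// box_rV_ge0.
Qed.

(** After [weighted_energy], the squares of [flux_err] are bounded by squares of averages of [|w|],
    then by averages of [w^2] through Jensen, which [weight_fbox] integrates. The constant depends
    neither on [e], which can tend to 0, nor on [lambda], which can then be taken large. *)
Lemma weighted_bound : exists2 C, 0 <= C & forall e lambda, 0 < e -> 0 < lambda ->
  \int[mz]_q (weight lambda q.1 * (mop e 1 (@mzero0 d) v q * mop e 1 (@mzero0 d) w q)) <=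
  C / lambda * \int[mz]_z (weight lambda z.1 * w z ^+ 2).
Proof.
have /choice[C HC] : forall i : 'I_d, exists C : R, 0 <= C /\ forall (e : R) (q : Z), 0 < e ->
    `|flux_err e 1 i q| <= C * kop mz (fbox e) (fun z => `|w z|) q.
  by move=> i; have [C ? ?] := flux_err_fbox i; exists C.
exists (5 / gamma * \sum_i C i ^+ 2).
  by rewrite !mulr_ge0 ?invr_ge0 ?(ltW gamma_gt0)// sumr_ge0// => i _; exact: sqr_ge0.
move=> e lambda e0 l0; apply: (le_trans (weighted_energy e0 l0)).
have -> : 5 / gamma * (\sum_i C i ^+ 2) / lambda * \int[mz]_z (weight lambda z.1 * w z ^+ 2) =
  5 / (gamma * lambda) * ((\sum_i C i ^+ 2) * \int[mz]_z (weight lambda z.1 * w z ^+ 2)).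
  by field; rewrite !gt_eqF.
rewrite ler_wpM2l ?divr_ge0 ?mulr_ge0 ?(ltW gamma_gt0) ?(ltW l0)//.
have mW : measurable_fun setT (fun q : Z => weight lambda q.1).
  exact: (measurableT_comp (measurable_weight lambda) measurable_fst).
have W1 (q : Z) : `|weight lambda q.1| <= 1 by exact: weight_le1.
have Ik : L1 mz setT (kop mz (fbox e) (fun z => w z ^+ 2)).
  apply: (L1_kop (M := 1) (measurable_fbox e0) L1w2) => z.
  have [I1 H1] := fbox_mass2 e0 z.
  under eq_integral do rewrite ger0_norm ?fbox_ge0//.
  by rewrite -(EFin_Rintegral I1) lee_fin.
apply: (@le_trans _ _ (\int[mz]_q ((\sum_i C i ^+ 2) *
    (weight lambda q.1 * kop mz (fbox e) (fun z => w z ^+ 2) q)))); last first.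
  rewrite (RintegralZl _ measurableT (L1Mr Ik mW W1)) ler_wpM2l ?weight_fbox//.
  by apply: sumr_ge0 => i _; exact: sqr_ge0.
apply: (le_Rintegral measurableT (L1Mr (L1_flux_err2 e0) mW W1)
  (L1Zl _ (L1Mr Ik mW W1))) => q _.
rewrite mulrCA ler_wpM2l ?weight_ge0// mulr_suml; apply: ler_sum => i _.
apply: (@le_trans _ _ (C i ^+ 2 * kop mz (fbox e) (fun z => `|w z|) q ^+ 2)).
  have [C0 {}HC] := HC i.
  rewrite -exprMn -[leLHS]real_normK ?num_real// lerXn2r ?nnegrE//; last exact: HC.
  exact: (le_trans _ (HC e q e0)).
by rewrite ler_wpM2l ?sqr_ge0// fbox_jensen.
Qed.

End weak_solution.

(** * Convergence of the mollifications in L1 *)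

Section mollification_limit.
Context {R : realType} (d : nat).
Local Notation mu := (@lebesgue_measure R).
Local Notation T := (measurableTypeR R).
Local Notation V := 'rV[R]_d.
Local Notation Z := (T * V)%type.
Local Notation mz := (@mtx R d).
Local Notation mV := (@lebesgue_rV R d).
Local Notation smooth e f := (mop e 1 (@mzero0 d) f).

Lemma moll_mass e (q : Z) : 0 < e ->
  L1 mz setT (fun z => moll e 1 (@mzero0 d) (q, z)) /\
  \int[mz]_z moll e 1 (@mzero0 d) (q, z) = 1.
Proof.
move=> e0; have [Ie ie] := integral_eta q.2 e0.
have Ip : L1 mu setT (fun t => profile e 1 (q.1 - t)) by exact: L1_profile.
have [I E] := @L1_tensor _ _ _ _ _ mu mV _ _ Ip Ie; split; first exact: I.
by apply: (etrans E); rewrite ie mulr1; exact: Rintegral_profile.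
Qed.

(** As the mollifier has integral 1, the error at [q] is the integral of [f z - f q] against it;
    domination by [boxtx] in absolute value then suffices. *)
Lemma smooth_error : exists2 C : R, 0 <= C & forall e f, 0 < e -> L1 mz setT f ->
  (\int[mz]_q `|smooth e f q - f q|%:E <= C%:E * modulus mz (boxtx e) f)%E.
Proof.
have [C C0 HC] := @moll_fbox R d 0 (@mzero0 d); exists C => // e f e0 If.
have mk := @markov_boxtx R d e e0; have [mb b0 bl br] := mk.
have mf := L1_measurable If.
have mm := measurable_modulus mk mf.
have H p : `|moll e 1 (@mzero0 d) p| <= C * boxtx e p.
  apply: (le_trans (HC e p e0)); rewrite add0n big1// expr0 invr1 mulr1.
  by rewrite ler_wpM2l// fbox_le.
rewrite /modulus -ge0_integralZl//; last 2 first.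
- exact: measurable_modulus1.
- by move=> q _; apply: integral_ge0 => z _; rewrite lee_fin mulr_ge0.
apply: ge0_le_integral => //.
- apply/measurable_EFinP; apply: measurableT_comp => //; apply: measurable_funB => //.
  exact: measurable_mop.
- by apply: emeasurable_funM => //; exact: measurable_modulus1.
move=> q _; rewrite -ge0_integralZl//; last 2 first.
- apply/measurable_EFinP.
  exact: (@measurable_fun_pair2 _ _ _ _ _ _ (fun p : Z * Z => boxtx e p * `|f p.2 - f p.1|) q).
- by move=> z _; rewrite lee_fin mulr_ge0.
have [I1 m1] := moll_mass q e0.
have I2 : L1 mz setT (fun z => f z * moll e 1 (@mzero0 d) (q, z)) by exact: L1_mop_section.
have I3 : L1 mz setT (fun z => f z * moll e 1 (@mzero0 d) (q, z)
    - f q * moll e 1 (@mzero0 d) (q, z)) by apply: L1B => //; exact: L1Zl.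
have -> : smooth e f q - f q = \int[mz]_z (f z * moll e 1 (@mzero0 d) (q, z)
    - f q * moll e 1 (@mzero0 d) (q, z)).
  rewrite (RintegralB measurableT I2 (L1Zl _ I1)); congr (_ - _).
  by rewrite (RintegralZl _ measurableT I1) m1 mulr1.
apply: (@le_trans _ _ (\int[mz]_z `|f z * moll e 1 (@mzero0 d) (q, z)
    - f q * moll e 1 (@mzero0 d) (q, z)|)%:E).
  by rewrite lee_fin; exact: normr_Rintegral.
rewrite (EFin_Rintegral (L1_norm I3)); apply: ge0_le_integral => //.
- apply/measurable_EFinP; apply: measurableT_comp => //; exact: L1_measurable I3.
- apply: emeasurable_funM => //; apply/measurable_EFinP.
  exact: (@measurable_fun_pair2 _ _ _ _ _ _ (fun p : Z * Z => boxtx e p * `|f p.2 - f p.1|) q).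
move=> z _; rewrite -EFinM lee_fin -mulrBl normrM mulrA mulrC.
by rewrite ler_wpM2r.
Qed.

Lemma smooth_cvg f (r : R) : L1 mz setT f -> 0 < r ->
  \forall k \near \oo, \int[mz]_q `|smooth k.+1%:R^-1 f q - f q| <= r.
Proof.
move=> If r0; have [C C0 HC] := smooth_error.
have [_ /(_ f If)] := @approximate_identity_tx R d.
(* Dividing by [C + 1] avoids the case [C = 0]. *)
have rC : 0 < r / (C + 1) by rewrite divr_gt0// ltr_wpDl.
move=> /(cvge0_le rC); apply: filterS => k Hk.
have e0 : 0 < k.+1%:R^-1 :> R by rewrite invr_gt0.
rewrite -lee_fin (EFin_Rintegral (L1_norm (L1B (L1_mop e0 0 (@mzero0 d) If) If))).
apply: (le_trans (HC _ _ e0 If)).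
apply: (@le_trans _ _ (C%:E * (r / (C + 1))%:E)%E); first exact: lee_wpmul2l.
rewrite -EFinM lee_fin mulrCA ler_piMr ?(ltW r0)// ler_pdivrMr ?mul1r ?lerDl//.
by rewrite ltr_wpDl.
Qed.

Lemma smooth_bound : exists2 C : R, 0 <= C & forall e f M q, 0 < e -> L1 mz setT f ->
  (forall z, `|f z| <= M) -> `|smooth e f q| <= C * M.
Proof.
have [C C0 HC] := @moll_fbox R d 0 (@mzero0 d); exists C => // e f M q e0 If fM.
have M0 : 0 <= M by exact: (le_trans _ (fM q)).
have [I1 m1] := fbox_mass1 e0 q.
have I2 : L1 mz setT (fun z => f z * moll e 1 (@mzero0 d) (q, z)) by exact: L1_mop_section.
apply: (le_trans (normr_Rintegral I2)).
apply: (@le_trans _ _ (\int[mz]_z (C * M * fbox e (q, z)))).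
  apply: (le_Rintegral measurableT (L1_norm I2) (L1Zl _ I1)) => z _.
  rewrite normrM mulrAC [leRHS]mulrC; apply: ler_pM => //.
  apply: (le_trans (HC e (q, z) e0)).
  by rewrite add0n big1// expr0 invr1 mulr1.
by rewrite (RintegralZl _ measurableT I1) ler_piMr// mulr_ge0.
Qed.

End mollification_limit.

(** * From the weighted estimate to uniqueness *)

Section uniqueness.
Context {R : realType} (d : nat).
Local Notation T := (measurableTypeR R).
Local Notation V := 'rV[R]_d.
Local Notation Z := (T * V)%type.
Local Notation mz := (@mtx R d).
Local Notation delta i := (addi (@mzero0 d) i).
Local Notation smooth e f := (mop e 1 (@mzero0 d) f).

Lemma Rintegral_sqr0 (f : Z -> R) M : L1 mz setT f -> (forall z, `|f z| <= M) ->
  \int[mz]_z (f z ^+ 2) <= 0 -> \int[mz]_z `|f z| = 0.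
Proof.
move=> If fM f0; have mf := L1_measurable If.
have If2 : L1 mz setT (fun z => f z ^+ 2) by exact: (L1Ml If mf fM).
have I0 : \int[mz]_z (f z ^+ 2) = 0.
  by apply/eqP; rewrite eq_le f0; apply: Rintegral_ge0 => z _; exact: sqr_ge0.
have /(ae_eq_integral_abs mz measurableT) : (\int[mz]_z `|(f z ^+ 2)%:E| = 0)%E.
  under eq_integral do rewrite abse_EFin ger0_norm ?sqr_ge0//.
  by rewrite -(EFin_Rintegral If2) I0.
move=> /(_ _)/wrap[|H]; first by apply/measurable_EFinP; exact: L1_measurable If2.
have : ae_eq mz setT (EFin \o f) (cst 0%E).
  apply: filterS H => z /= Hz _; have /eqP := Hz I.
  by rewrite eqe sqrf_eq0 => /eqP ->.
move=> /(ae_eq_integral_abs mz measurableT).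
move=> /(_ _)/wrap[|H']; first exact/measurable_EFinP.
by rewrite /Rintegral H'.
Qed.

Variables (v w : Z -> R) (tau M Cg : R).
Hypothesis Cg_gt0 : 0 < Cg.
Hypotheses (Iv : L1 mz setT v) (Iw : L1 mz setT w).
Hypotheses (v_bd : forall z, `|v z| <= M) (w_bd : forall z, `|w z| <= M).
Hypothesis v_supp : forall z, v z != 0 -> 0 < z.1 < tau.
Hypothesis w_supp : forall z, w z != 0 -> 0 < z.1 < tau.
Hypothesis w_v : forall z, w z ^+ 2 <= Cg * (v z * w z).

Lemma weighted_limit (C : R) :
  0 <= C -> (forall e lambda, 0 < e -> 0 < lambda ->
  \int[mz]_q (weight tau lambda q.1 * (smooth e v q * smooth e w q)) <=
  C / lambda * \int[mz]_z (weight tau lambda z.1 * w z ^+ 2)) ->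
  forall lambda, 0 < lambda ->
  \int[mz]_q (weight tau lambda q.1 * (v q * w q)) <=
  C / lambda * \int[mz]_z (weight tau lambda z.1 * w z ^+ 2).
Proof.
move=> C0 H lambda l0.
have M0 : 0 <= M by exact: (le_trans _ (v_bd (0, 0))).
have mW : measurable_fun setT (fun q : Z => weight tau lambda q.1).
  exact: (measurableT_comp (measurable_weight tau lambda) measurable_fst).
have W1 (q : Z) : `|weight tau lambda q.1| <= 1 by exact: weight_le1.
have [B B0 HB] := @smooth_bound R d.
apply/ler_addgt0Pr => r r0.
(* Chosen so that [M * r' + B * M * r'] stays below [r]: [M] bounds [w] and [B * M] bounds the
   mollified [v], the factors that multiply the two mollification errors. *)
pose r' := r / (2 * (B * M + M + 1)).
have D0 : 0 < 2 * (B * M + M + 1) by rewrite mulr_gt0// ltr_wpDl// addr_ge0// mulr_ge0.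
have r'0 : 0 < r' by rewrite divr_gt0.
have : \forall k \near \oo,
    \int[mz]_q `|smooth k.+1%:R^-1 v q - v q| <= r' /\
    \int[mz]_q `|smooth k.+1%:R^-1 w q - w q| <= r'.
  by apply: filterS2 (smooth_cvg Iv r'0) (smooth_cvg Iw r'0) => k.
case=> k _ /(_ k (leqnn k)) [].
set e := k.+1%:R^-1 => Hv Hw; have e0 : 0 < e by rewrite invr_gt0.
have ISv : L1 mz setT (smooth e v) by exact: L1_mop.
have ISw : L1 mz setT (smooth e w) by exact: L1_mop.
have Bv q : `|smooth e v q| <= B * M by exact: HB.
have I1 := L1Mr Iw (L1_measurable Iv) v_bd.
have I2 := L1Mr ISw (L1_measurable ISv) Bv.
have IWv := L1Mr I1 mW W1; have IWs := L1Mr I2 mW W1.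
apply: le_trans (lerD (H e lambda e0 l0) (lexx r)).
rewrite -lerBlDl -(RintegralB measurableT IWv IWs).
apply: (le_trans (ler_norm _)); apply: (le_trans (normr_Rintegral (L1B IWv IWs))).
have Id1 := L1_norm (L1B ISv Iv); have Id2 := L1_norm (L1B ISw Iw).
apply: (@le_trans _ _ (\int[mz]_q (M * `|smooth e v q - v q|
    + B * M * `|smooth e w q - w q|))).
  apply: (le_Rintegral measurableT (L1_norm (L1B IWv IWs)) (L1D (L1Zl M Id1) (L1Zl (B * M) Id2))) => q _.
  rewrite -mulrBr normrM; apply: (@le_trans _ _ (1 * `|v q * w q - smooth e v q * smooth e w q|)).
    by apply: ler_wpM2r.
  rewrite mul1r.
  have -> : v q * w q - smooth e v q * smooth e w q =
    - ((smooth e v q - v q) * w q + smooth e v q * (smooth e w q - w q)) by ring.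
  rewrite normrN; apply: (le_trans (ler_normD _ _)); rewrite !normrM.
  by apply: lerD; [rewrite mulrC|]; apply: ler_pM.
rewrite (RintegralD measurableT (L1Zl M Id1) (L1Zl (B * M) Id2)).
rewrite (RintegralZl _ measurableT Id1) (RintegralZl _ measurableT Id2).
apply: (@le_trans _ _ (M * r' + B * M * r')).
  by apply: lerD; apply: ler_wpM2l => //; exact: mulr_ge0.
rewrite -mulrDl /r' mulrCA ler_piMr ?(ltW r0)// ler_pdivrMr// mul1r.
have := mulr_ge0 B0 M0; lra.
Qed.

Lemma weighted_zero (C : R) :
  0 <= C -> (forall lambda, 0 < lambda ->
  \int[mz]_q (weight tau lambda q.1 * (v q * w q)) <=
  C / lambda * \int[mz]_z (weight tau lambda z.1 * w z ^+ 2)) ->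
  \int[mz]_z `|w z| = 0.
Proof.
(* With this choice [Cg * C / l] is less than 1/2, so that [X <= Cg * C / l * X] forces [X <= 0];
   the summand 1 keeps [l] positive. *)
move=> C0 H; pose l := 2 * (Cg * C) + 1.
have CC : 0 <= Cg * C by rewrite mulr_ge0// ltW.
have l0 : 0 < l by rewrite /l ltr_wpDl// mulr_ge0.
have mW : measurable_fun setT (fun q : Z => weight tau l q.1).
  exact: (measurableT_comp (measurable_weight tau l) measurable_fst).
have W1 (q : Z) : `|weight tau l q.1| <= 1 by exact: weight_le1.
have Iw2 : L1 mz setT (fun z => w z ^+ 2) by exact: (L1Ml Iw (L1_measurable Iw) w_bd).
have IWw := L1Mr Iw2 mW W1.
have IWv := L1Mr (L1Mr Iw (L1_measurable Iv) v_bd) mW W1.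
set X := \int[mz]_z (weight tau l z.1 * w z ^+ 2) in H *.
have X0 : X <= 0.
  have HX : X <= Cg * \int[mz]_q (weight tau l q.1 * (v q * w q)).
    rewrite -(RintegralZl _ measurableT IWv).
    apply: (le_Rintegral measurableT IWw (L1Zl _ IWv)) => z _.
    by rewrite [leRHS]mulrCA ler_wpM2l// weight_ge0.
  have := H l l0; rewrite -/X => H2.
  have X'0 : 0 <= X.
    by apply: Rintegral_ge0 => z _; rewrite mulr_ge0 ?sqr_ge0// weight_ge0.
  have : X <= Cg * (C / l * X).
    by apply: (le_trans HX); rewrite ler_wpM2l// ltW.
  have -> : Cg * (C / l * X) = (Cg * C) * X / l by field; rewrite gt_eqF.
  rewrite ler_pdivlMr// /l; nra.
apply: (Rintegral_sqr0 Iw w_bd).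
(* On the support of [w] the weight is at least [exp(- l * tau)]. *)
have E : \int[mz]_z (w z ^+ 2) <= expR (l * tau) * X.
  rewrite -(RintegralZl _ measurableT IWw).
  apply: (le_Rintegral measurableT Iw2 (L1Zl _ IWw)) => z _.
  have [->|wz] := eqVneq (w z) 0; first by rewrite expr0n/= !mulr0.
  have /andP[z0 zT] := w_supp wz.
  rewrite mulrA ler_peMl ?sqr_ge0// /weight (ltW z0) zT mul1r -expRD.
  by rewrite -expR0 ler_expR -mulrN -mulrDr mulr_ge0 ?subr_ge0 ?(ltW l0)// ltW.
by apply: (le_trans E); rewrite mulr_ge0_le0// expR_ge0.
Qed.

(** Everywhere [|v|] is at most the mollification error: before [tau] because the mollification
    vanishes, later because [v] does. The error tends to 0 in L1. *)
Lemma smooth_zero : (forall e q, 0 < e -> q.1 < tau -> smooth e v q = 0) ->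
  \int[mz]_z `|v z| = 0.
Proof.
move=> H; apply/eqP; rewrite eq_le; apply/andP; split; last first.
  by apply: Rintegral_ge0 => z _.
apply/ler_addgt0Pr => r r0; rewrite add0r.
case: (smooth_cvg Iv r0) => k _ /(_ k (leqnn k)).
set e := k.+1%:R^-1; have e0 : 0 < e by rewrite invr_gt0.
apply: le_trans; apply: (le_Rintegral measurableT (L1_norm Iv)).
  by apply: L1_norm; apply: L1B => //; exact: L1_mop.
move=> q _; have [qT|qT] := ltP q.1 tau; first by rewrite H// sub0r normrN.
have -> : v q = 0; last by rewrite normr0.
by apply/eqP; apply: contraTT qT => /v_supp/andP[_]; rewrite ltNge.
Qed.

Lemma mop_null e m n f q : 0 < e -> L1 mz setT f -> \int[mz]_z `|f z| = 0 ->
  mop e m n f q = 0.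
Proof.
move=> e0 If f0; have [B B0 HB] := moll_bound e0 m n.
have := kop_bound q (measurable_moll e m n) If HB.
by rewrite f0 mulr0 normr_le0 => /eqP.
Qed.

End uniqueness.

Lemma weak_uniqueness {R : realType} (d : nat)
    (a : 'rV[R]_d -> 'I_d -> 'I_d -> R) (v w : measurableTypeR R * 'rV[R]_d -> R)
    (h : 'I_d -> measurableTypeR R * 'rV[R]_d -> R)
    (tau Ma L M gamma alpha Cg : R) :
  0 < tau -> 0 <= L -> 0 < gamma -> 0 <= alpha -> 0 < Cg ->
  (forall i j, measurable_fun setT (fun x => a x i j)) ->
  (forall x i j, `|a x i j| <= Ma) ->
  (forall (x y : 'rV[R]_d) i j (r : R), 0 <= r -> (forall k, `|x ord0 k - y ord0 k| <= r) ->
    `|a x i j - a y i j| <= L * r) ->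
  (forall x i j, a x i j = a x j i) ->
  (forall x (xi : 'I_d -> R),
    gamma * \sum_i xi i ^+ 2 <= \sum_i \sum_j a x i j * xi i * xi j) ->
  L1 (mtx d) setT v -> L1 (mtx d) setT w -> (forall i, L1 (mtx d) setT (h i)) ->
  (forall z, `|v z| <= M) -> (forall z, `|w z| <= M) ->
  (forall z, v z != 0 -> 0 < z.1 < tau) -> (forall z, w z != 0 -> 0 < z.1 < tau) ->
  (forall i z, `|h i z| <= alpha * `|w z|) ->
  (forall z, w z ^+ 2 <= Cg * (v z * w z)) ->
  (forall e q, 0 < e -> q.1 < tau ->
    mop e 1 (@mzero0 d) v q =
    \sum_i (\sum_j mop e 0 (addi (addi (@mzero0 d) j) i) (fun z => w z * a z.2 i j) q
            - mop e 0 (addi (@mzero0 d) i) (h i) q)) ->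
  \int[mtx d]_z `|v z| = 0.
Proof.
move=> tau0 L0 gamma0 alpha0 Cg0 ma aM aL asym aell Iv Iw Ih vM wM vT wT hw wv weq.
have [C C0 HC] := weighted_bound tau0 L0 gamma0 alpha0 ma aM aL asym aell
  Iv Iw Ih wM wT hw weq.
have w0 : \int[mtx d]_z `|w z| = 0.
  apply: (weighted_zero Cg0 Iv Iw vM wM wT wv C0).
  exact: (weighted_limit Iv Iw vM wM C0 HC).
(* Both the drift and the products of [w] with entries of [a] are dominated by multiples of [|w|],
   hence are null. *)
have null (f : measurableTypeR R * 'rV[R]_d -> R) (B : R) : L1 (mtx d) setT f ->
    (forall z, `|f z| <= B * `|w z|) -> \int[mtx d]_z `|f z| = 0.
  move=> If fw; apply/eqP; rewrite eq_le; apply/andP; split; last first.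
    by apply: Rintegral_ge0 => z _.
  apply: (@le_trans _ _ (\int[mtx d]_z (B * `|w z|))).
    by apply: (le_Rintegral measurableT (L1_norm If) (L1Zl B (L1_norm Iw))) => z _.
  by rewrite (RintegralZl _ measurableT (L1_norm Iw)) w0 mulr0.
apply: (smooth_zero Iv vT) => e q e0 qT; rewrite weq//; apply: big1 => i _.
rewrite (mop_null _ _ _ e0 (Ih i) (null _ alpha (Ih i) (hw i))) subr0.
apply: big1 => j _.
have Iwa : L1 (mtx d) setT (fun z => w z * a z.2 i j).
  apply: (L1Ml (M := Ma) Iw) => [|z]; last exact: aM.
  exact: (measurableT_comp (ma i j) measurable_snd).
apply: (mop_null _ _ _ e0 Iwa); apply: (null _ Ma Iwa) => z.
by rewrite normrM mulrC ler_wpM2r.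
Qed.

(** * Test functions *)

Section test_function.
Context {R : realType} (d : nat).
Local Notation V := 'rV[R]_d.
Implicit Types (q z : R * V) (n : 'I_d -> nat) (i : 'I_d) (e : R).
Local Notation delta i := (addi (@mzero0 d) i).

Lemma differentiable_linear (U W : normedModType R) (f : U -> W) x :
  linear f -> continuous f -> differentiable f x.
Proof.
move=> lf cf; pose fM := GRing.isLinear.Build _ _ _ _ _ lf.
pose fL : {linear U -> W} := HB.pack f fM.
exact: (@linear_differentiable _ _ _ fL).
Qed.

Lemma differentiable_fst z : differentiable (fst : R * V -> R) z.
Proof.
by apply: differentiable_linear => // x; exact: cvg_fst.
Qed.

Lemma differentiable_snd_coord i z : differentiable (fun z : R * V => z.2 ord0 i) z.
Proof.
apply: (@differentiable_comp _ _ _ _ (snd : R * V -> V) (fun x : V => x ord0 i)).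
  by apply: differentiable_linear => // x; exact: cvg_snd.
exact: differentiable_coord.
Qed.

Lemma derive_affine (f : R * V -> R) (z v : R * V) (c : R) :
  (forall h, f (h *: v + z) = h * c + f z) -> 'D_v f z = c.
Proof.
move=> fh; rewrite (derive_line fh) derive1E deriveD//.
by rewrite derive_cst addr0 deriveMr// derive_id /GRing.scale/= mulr1.
Qed.

(* The cut-off [profile 1 _ (t + 2)] only serves to make the support compact:
   for [m' = 0] it is identically 1 for nonnegative times. *)
Definition test_mol e m m' n q z : R :=
  profile e m (q.1 - z.1) * profile 1 m' (z.1 + 2) * eta e n (q.2, z.2).

Lemma test_mol_Ck k e m m' n q : Ck k (test_mol e m m' n q).
Proof.
apply: CkM; first apply: CkM.
- apply: (@Ck_comp_affine _ _ k m (profile e) (fun z : R * V => q.1 - z.1)).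
  + by move=> j x; exact: is_derive_profile.
  + by move=> x; apply: differentiableB => //; exact: differentiable_fst.
  + move=> v; exists (- v.1) => x; apply: derive_affine => h /=.
    by rewrite /GRing.scale/=; ring.
- apply: (@Ck_comp_affine _ _ k m' (profile 1) (fun z : R * V => z.1 + 2)).
  + by move=> j x; exact: is_derive_profile.
  + by move=> x; apply: differentiableD => //; exact: differentiable_fst.
  + move=> v; exists v.1 => x; apply: derive_affine => h /=.
    by rewrite /GRing.scale/=; ring.
- apply: Ck_prod => l.
  apply: (@Ck_comp_affine _ _ k (n l).+1 (profile e) (fun z : R * V => q.2 ord0 l - z.2 ord0 l)).
  + by move=> j x; exact: is_derive_profile.
  + by move=> x; apply: differentiableB => //; exact: differentiable_snd_coord.
  + move=> v; exists (- v.2 ord0 l) => x; apply: derive_affine => h /=.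
    by rewrite !mxE; ring.
Qed.

Lemma test_mol_fun T e q : 0 < e -> q.1 < T -> test_fun T (test_mol e 0 0 (@mzero0 d) q).
Proof.
move=> e0 qT; split=> [k|]; first exact: test_mol_Ck.
(* The step vanishes at times after [q.1], which is before [T], and the cut-off at times before
   [-2]; in space the mollifier lives within [e] of [q.2]. *)
exists (`[-2, q.1]%classic `*` [set x : V | forall i, `[q.2 ord0 i - e, q.2 ord0 i + e]%classic (x ord0 i)]).
split.
- apply: compact_setX; first exact: segment_compact.
  apply: (@rV_compact _ d (fun i => `[q.2 ord0 i - e, q.2 ord0 i + e]%classic)) => i.
  exact: segment_compact.
- by move=> z [/=]; rewrite in_itv/= => /andP[_ zq] _; exact: le_lt_trans zq qT.
- move=> z Kz; rewrite /test_mol.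
  have [qz|qz] := leP q.1 z.1.
    by rewrite profile_le0 ?mul0r// subr_le0.
  have [z2|z2] := leP (z.1 + 2) 0.
    by rewrite [profile 1 0 _]profile_le0// mulr0 mul0r.
  have [i iz] : exists i, ~ `[q.2 ord0 i - e, q.2 ord0 i + e]%classic (z.2 ord0 i).
    apply/existsNP => H; apply: Kz; split=> //=; rewrite in_itv/=.
    by rewrite (ltW qz) andbT; lra.
  suff -> : eta e (@mzero0 d) (q.2, z.2) = 0 by rewrite mulr0.
  rewrite /eta (bigD1 i)//=; case: (ltP (q.2 ord0 i - z.2 ord0 i) 0) => qi.
    by rewrite profile_lt0// mul0r.
  case: (ltP e (q.2 ord0 i - z.2 ord0 i)) => qe.
    by rewrite profile_gt// mul0r.
  by exfalso; apply: iz; rewrite /= in_itv/=; apply/andP; split; lra.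
Qed.

Lemma dt_test_mol e n q z :
  dt (test_mol e 0 0 n q) z = test_mol e 0 1 n q z - test_mol e 1 0 n q z.
Proof.
set c := eta e n (q.2, z.2).
have L h : test_mol e 0 0 n q (h *: ((1, 0) : R * V) + z) =
    profile e 0 (q.1 - (h + z.1)) * profile 1 0 (h + z.1 + 2) * c.
  by rewrite /test_mol /= scaler0 add0r /GRing.scale/= mulr1.
rewrite /dt (derive_line L) derive1E.
have d1 : is_derive (0 : R) (1 : R) (fun h => profile e 0 (q.1 - (h + z.1)))
    (- profile e 1 (q.1 - z.1)).
  have dl : is_derive (0 : R) (1 : R) (fun h => q.1 - (h + z.1)) (- 1).
    apply: (is_derive_eq (is_deriveB (is_derive_cst q.1 (0 : R) (1 : R))
      (is_deriveD (is_derive_id (0 : R) (1 : R)) (is_derive_cst z.1 (0 : R) (1 : R))))).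
    by rewrite addr0 sub0r.
  have dp := is_derive_profile e 0 (q.1 - (0 + z.1)).
  apply: (is_derive_eq (@is_derive1_comp _ (profile e 0) (fun h => q.1 - (h + z.1)) 0 _ _ dp dl)).
  by rewrite add0r mulrN1.
have d2 : is_derive (0 : R) (1 : R) (fun h => profile 1 0 (h + z.1 + 2))
    (profile 1 1 (z.1 + 2)).
  have dl : is_derive (0 : R) (1 : R) (fun h => h + z.1 + 2) 1.
    apply: (is_derive_eq (is_deriveD (is_deriveD (is_derive_id (0 : R) (1 : R))
      (is_derive_cst z.1 (0 : R) (1 : R))) (is_derive_cst (2 : R) (0 : R) (1 : R)))).
    by rewrite !addr0.
  have dp := is_derive_profile 1 0 (0 + z.1 + 2).
  apply: (is_derive_eq (@is_derive1_comp _ (profile 1 0) (fun h => h + z.1 + 2) 0 _ _ dp dl)).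
  by rewrite add0r mulr1.
have [_ ->] := is_deriveM (is_deriveM d1 d2) (is_derive_cst c (0 : R) (1 : R)).
rewrite /test_mol -/c /GRing.scale/= !add0r.
by rewrite mulr0 add0r; ring.
Qed.

(** The sign comes from differentiating in [z] a function of [q - z], whereas the multi-index counts
    derivatives in [q]. *)
Lemma dx_test_mol e n i q z :
  dx i (test_mol e 0 0 n q) z = - test_mol e 0 0 (addi n i) q z.
Proof.
set c := profile e 0 (q.1 - z.1) * profile 1 0 (z.1 + 2).
set c' := \prod_(k | k != i) profile e (n k).+1 (q.2 ord0 k - z.2 ord0 k).
have L h : test_mol e 0 0 n q (h *: ((0, delta_mx ord0 i) : R * V) + z) =
    profile e (n i).+1 (q.2 ord0 i - (h + z.2 ord0 i)) * (c * c').
  rewrite /test_mol /= scaler0 add0r -/c /eta (bigD1 i)//= !mxE !eqxx mulr1.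
  rewrite mulrCA; congr (_ * (_ * _)); apply: eq_bigr => k ki.
  by rewrite !mxE (negbTE ki) andbF mulr0 add0r.
rewrite /dx (derive_line L) derive1E.
have d1 : is_derive (0 : R) (1 : R) (fun h => profile e (n i).+1 (q.2 ord0 i - (h + z.2 ord0 i)))
    (- profile e (n i).+2 (q.2 ord0 i - z.2 ord0 i)).
  have dl : is_derive (0 : R) (1 : R) (fun h => q.2 ord0 i - (h + z.2 ord0 i)) (- 1).
    apply: (is_derive_eq (is_deriveB (is_derive_cst (q.2 ord0 i) (0 : R) (1 : R))
      (is_deriveD (is_derive_id (0 : R) (1 : R)) (is_derive_cst (z.2 ord0 i) (0 : R) (1 : R))))).
    by rewrite addr0 sub0r.
  have dp := is_derive_profile e (n i).+1 (q.2 ord0 i - (0 + z.2 ord0 i)).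
  apply: (is_derive_eq (@is_derive1_comp _ (profile e (n i).+1) (fun h => q.2 ord0 i - (h + z.2 ord0 i)) 0 _ _ dp dl)).
  by rewrite add0r mulrN1.
have [_ ->] := is_deriveM d1 (is_derive_cst (c * c') (0 : R) (1 : R)).
rewrite /test_mol -/c /eta (bigD1 i)//= {1}/addi eqxx addn1.
have -> : \prod_(k | k != i) profile e (addi n i k).+1 (q.2 ord0 k - z.2 ord0 k) = c'.
  by apply: eq_bigr => k ki; rewrite /addi (negbTE ki) addn0.
by rewrite /GRing.scale/= mulr0 add0r; ring.
Qed.

Lemma dx_dx_test_mol e n i j q z :
  dx i (dx j (test_mol e 0 0 n q)) z = test_mol e 0 0 (addi (addi n j) i) q z.
Proof.
have -> : dx j (test_mol e 0 0 n q) = - test_mol e 0 0 (addi n j) q.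
  by apply/funext => x; rewrite dx_test_mol.
rewrite /dx deriveN; first by have := dx_test_mol e (addi n j) i q z; rewrite /dx => ->; rewrite opprK.
by have [/(_ z) + _] := test_mol_Ck 1 e 0 0 (addi n j) q => /diff_derivable.
Qed.

Lemma test_mol_moll e m n q z : 0 < z.1 ->
  test_mol e m 0 n q z = moll e m n (q, z) /\ test_mol e m 1 n q z = 0.
Proof.
move=> z0; rewrite /test_mol /moll; split.
  by rewrite [profile 1 0 _]profile_ge ?mulr1//; lra.
by rewrite [profile 1 1 _]profile_gt ?mulr0 ?mul0r//; lra.
Qed.

End test_function.

(** * Regularity of the coefficients *)

Section regularity.
Context {R : realType}.

Lemma continuous_measurable_rV n (f : 'rV[R]_n -> R) : continuous f ->
  measurable_fun setT (f : 'rV[R]_n -> measurableTypeR R).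
Proof.
move=> cf; apply: (measurability _ (RGenOInfty.measurableE R)).
move=> /= _ [_ [a ->]] <-; rewrite setTI; apply: open_measurable_rV.
by apply: open_comp => // x _; exact: cf.
Qed.

(** The product is identified with a space of row vectors with one more coordinate, where open sets
    are known to be measurable. *)
Lemma continuous_measurable_rVR n (f : 'rV[R]_n * R -> R) : continuous f ->
  measurable_fun setT (f : 'rV[R]_n * measurableTypeR R -> measurableTypeR R).
Proof.
move=> cf; pose g (x : 'rV[R]_n.+1) := f ((uncons_rV x).2, (uncons_rV x).1).
have cg : continuous g.
  move=> x; apply: (@continuous_comp _ _ _ (fun x => ((uncons_rV x).2, (uncons_rV x).1) : 'rV[R]_n * R) f).
    move=> A /nbhs_ballP[e e0 eA]; apply/nbhs_ballP; exists e => // y [_ xy].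
    by apply: eA; split=> /=; [split=> // i j; rewrite !mxE|]; exact: xy.
  exact: cf.
have -> : f = g \o (fun p => cons_rV (p.2, p.1)).
  by apply/funext => -[x r]; rewrite /g /comp cons_rVK.
apply: (measurableT_comp (continuous_measurable_rV cg)).
apply: (measurableT_comp (@measurable_cons_rV R n)).
exact: measurable_fun_pair.
Qed.

Lemma Linfty_ae d (X : measurableType d) (mu : {measure set X -> \bar R})
    (D : set X) (f : X -> R) : Linfty mu D f ->
  exists2 M : R, 0 < M & {ae mu, forall x, D x -> `|f x| <= M}.
Proof.
rewrite /Linfty /finite_norm unlock => -[mf]; case: ifPn => [mu0|mu0 _].
  move=> H; have [M HM] : exists M : R, (ess_sup_inf.ess_sup mu (abse \o (EFin \o f \_ D)) <= M%:E)%E.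
    case: (ess_sup_inf.ess_sup _ _) H => [r _|//|_]; first by exists r.
    by exists 0; rewrite leNye.
  exists (`|M| + 1); first by rewrite ltr_wpDl.
  have := ess_sup_inf.ess_sup_ge mu (abse \o (EFin \o f \_ D)).
  apply: filterS => x Hx Dx; have := le_trans Hx HM.
  rewrite /= patchE mem_set// lee_fin => /le_trans; apply.
  by apply: (le_trans (ler_norm _)); rewrite lerDl.
(* If the whole space is null, every property holds almost everywhere and any bound will do. *)
exists 1 => //; exists setT; split=> //.
by apply/eqP; rewrite eq_le measure_ge0 leNgt mu0.
Qed.

Lemma bounded_fun_le (V W : normedModType R) (f : V -> W) : bounded_fun f ->
  exists2 M : R, 0 < M & forall x, `|f x| <= M.
Proof.
move=> [M [_ HM]]; exists (`|M| + 1) => [|x]; first by rewrite ltr_wpDl.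
by apply: HM => //; rewrite (le_lt_trans (ler_norm _))// ltrDl.
Qed.

Lemma coord_le_norm n (x : 'rV[R]_n) i : `|x ord0 i| <= `|x|.
Proof.
by rewrite [leRHS]mx_normE; apply: (le_bigmax _ (fun i => `|x i.1 i.2|%:nng) (ord0, i)).
Qed.

Lemma coord_le_enorm n (x : 'rV[R]_n) i : `|x ord0 i| <= enorm x.
Proof.
rewrite -sqrtr_sqr ler_wsqrtr// (bigD1 i)//= lerDl.
by apply: sumr_ge0 => j _; exact: sqr_ge0.
Qed.

(** The mean value theorem on the segment from [y] to [x]. Closeness is measured coordinatewise, as
    the supports of the kernels are; the summand 1 keeps the constant positive in dimension 0. *)
Lemma grad_lipschitz n (f : 'rV[R]_n -> R) : (forall x, differentiable f x) ->
  bounded_fun (grad f) -> exists2 L : R, 0 < L & forall (x y : 'rV[R]_n) (r : R),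
  0 <= r -> (forall k, `|x ord0 k - y ord0 k| <= r) -> `|f x - f y| <= L * r.
Proof.
move=> df /bounded_fun_le[M M0 HM]; exists (n%:R * M + 1) => [|x y r r0 xyr].
  by rewrite ltr_wpDl// mulr_ge0// ltW.
pose v := x - y; pose g (t : R) := f (t *: v + y).
have D z : 'D_v f z = \sum_k v ord0 k * pd k f z.
  rewrite deriveE// {1}(row_sum_delta v) linear_sum; apply: eq_bigr => k _.
  by rewrite linearZ/= -deriveE.
have dg (t : R) : is_derive t (1 : R) g ('D_v f (t *: v + y)).
  have H h : g (h *: (1 : R) + t) = f (h *: v + (t *: v + y)).
    have -> : h *: (1 : R) = h by rewrite /GRing.scale/= mulr1.
    by rewrite /g scalerDl addrA.
  have E : (fun h => h^-1 *: ((g \o shift t) (h *: (1 : R)) - g t)) =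
      (fun h => h^-1 *: ((f \o shift (t *: v + y)) (h *: v) - f (t *: v + y))).
    by apply/funext => h /=; rewrite H.
  split; first by rewrite /derivable E; exact: diff_derivable.
  by rewrite /derive E.
have [|t _] := MVT_segment ler01 (fun t _ => dg t).
  apply: continuous_subspaceT => t; apply/differentiable_continuous/derivable1_diffP.
  by have [] := dg t.
rewrite /g scale1r scale0r add0r subrK => ->; rewrite subr0 mulr1 D.
apply: (le_trans (ler_norm_sum _ _ _)).
apply: (@le_trans _ _ (\sum_(k < n) (r * M))).
  apply: ler_sum => k _; rewrite normrM; apply: ler_pM => //.
    by rewrite !mxE.
  by apply: le_trans (HM (t *: v + y)); have := coord_le_norm (grad f (t *: v + y)) k; rewrite mxE.
rewrite sumr_const card_ord (_ : (r * M) *+ n = n%:R * M * r).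
  by rewrite ler_wpM2r// lerDl.
by rewrite -mulr_natl; ring.
Qed.

End regularity.

Section positive_open.
Context {R : realType} (d : nat).
Local Notation V := 'rV[R]_d.

(** Every ball contains a box of positive measure, which no null set can cover. This turns almost
    everywhere bounds on continuous functions into bounds at every point. *)
Lemma ae_ball_exists (P : set (V * R)) (p : V * R) (e : R) : 0 < e ->
  {ae (@leb_xr R d), forall q, P q} -> exists2 q, ball p e q & P q.
Proof.
move=> e0 [A [mA A0 PA]]; apply: contrapT => H.
pose I (i : 'I_d) : set (measurableTypeR R) := `]p.1 ord0 i - e, p.1 ord0 i + e[%classic.
pose J : set (measurableTypeR R) := `]p.2 - e, p.2 + e[%classic.
pose B := [set x : V | forall i, I i (x ord0 i)].
have mI i : measurable (I i) by exact: measurable_itv.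
have mJ : measurable J by exact: measurable_itv.
have mB : measurable B.
  rewrite (_ : B = \bigcap_(i in [set: 'I_d]) ((fun x : V => x ord0 i) @^-1` I i)).
    apply: fin_bigcap_measurable => // i _; rewrite -[X in measurable X]setTI.
    exact: measurable_coord.
  by apply/seteqP; split => x /= Bx i; [move=> _|]; exact: Bx.
have lenI (c : R) : lebesgue_measure (`]c - e, c + e[%classic : set R) = (e *+ 2)%:E.
  rewrite lebesgue_measure_itv/= lte_fin ifT; last by rewrite ltrBlDr -addrA ltrDl addr_gt0.
  by rewrite -EFinB opprB addrC addrA subrK -mulr2n.
have BA : B `*` J `<=` A.
  move=> q [Bq Jq]; apply: PA => Pq; apply: H; exists q => //; split.
    split=> // i j; rewrite ord1 -ball_normE/= ltr_distlC.
    by have := Bq j; rewrite /I /= in_itv/= => /andP[-> ->].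
  by rewrite -ball_normE/= ltr_distlC; move: Jq; rewrite /J /= in_itv.
have : (leb_xr (B `*` J) <= 0)%E.
  by rewrite -A0; apply: le_measure => //; rewrite inE//; exact: measurableX.
rewrite leNgt => /negP; apply.
have -> : leb_xr (B `*` J) = (lebesgue_rV d B * lebesgue_measure J)%E.
  exact: product_measure1E.
rewrite (lebesgue_rV_box mI) mule_gt0//.
  apply: (big_ind (fun x : \bar R => 0 < x)%E) => [//|x y|i _]; first exact: mule_gt0.
  by rewrite lenI lte_fin mulrn_wgt0.
by rewrite lenI lte_fin mulrn_wgt0.
Qed.

End positive_open.

(** * The quotient beta(x,r)/r and its comparison with the drift *)

Section nonlinearity.
Context {R : realType} (d : nat).
Local Notation V := 'rV[R]_d.
Variable beta : V * R -> R.
Hypotheses (beta_C1 : Ck 1 beta) (beta_r_ge0 : forall p, 0 <= beta_r beta p)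
  (beta_0 : forall x, beta (x, 0) = 0).

Let beta_line x (r : R) :
  (fun h => h^-1 *: ((beta \o shift (x, r)) (h *: ((0, 1) : V * R)) - beta (x, r))) =
  (fun h => h^-1 *: (((fun r => beta (x, r)) \o shift r) (h *: (1 : R)) - beta (x, r))).
Proof.
apply/funext => h /=; congr (_ *: (beta _ - _)).
by rewrite [LHS]surjective_pairing/= scaler0 add0r.
Qed.

Let D_beta x r : 'D_(0, 1) beta (x, r) = beta_r beta (x, r).
Proof. by rewrite /beta_r derive1E /derive beta_line. Qed.

Lemma is_derive_beta x (r : R) :
  is_derive r (1 : R) (fun r => beta (x, r)) (beta_r beta (x, r)).
Proof.
rewrite /beta_r derive1E; apply: derivableP.
have [/(_ (x, r)) db _] := beta_C1.
have := @diff_derivable _ _ _ beta (x, r) (0, 1) db.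
by rewrite /derivable beta_line.
Qed.

Lemma continuous_beta_r : continuous (beta_r beta).
Proof.
suff <- : 'D_(0, 1) beta = beta_r beta by have [_] := beta_C1; exact.
by apply/funext => -[x r]; exact: D_beta.
Qed.

(** By continuity of [beta_r], exceeding the essential bound at one point means exceeding it on a
    whole ball, against [ae_ball_exists]. *)
Lemma beta_r_le (N : R) : Linfty leb_xr (setT `*` `]- N, N[) (beta_r beta) ->
  exists2 C : R, 0 < C & forall x r, `|r| < N -> beta_r beta (x, r) <= C.
Proof.
move=> /Linfty_ae[C C0 HC]; exists C => // x r rN; rewrite leNgt; apply/negP => Cb.
have : \forall p \near (x, r), C < beta_r beta p /\ `|p.2| < N.
  near=> p; split.
    by near: p; exact: (cvgr_gt _ (@continuous_beta_r (x, r))).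
  near: p; apply: (cvgr_lt `|r|) rN; apply: cvg_norm; exact: cvg_snd.
move=> /nbhs_ballP[e /= e0 He].
have [q xq Hq] := @ae_ball_exists R d _ (x, r) e e0 HC.
have [Cq qN] := He q xq.
have : `|beta_r beta q| <= C.
  by apply: Hq; split=> //=; rewrite in_itv/= -ltr_norml.
by rewrite ger0_norm// leNgt Cq.
Unshelve. all: by end_near. Qed.

(** Since [beta (x, 0) = 0], the mean value theorem makes the quotient a value of [beta_r] at a
    point between 0 and [r]. *)
Lemma beta_quot_bounds (C N : R) :
  (forall x r, `|r| < N -> beta_r beta (x, r) <= C) ->
  forall x r, `|r| < N -> 0 <= beta_quot beta x r <= C.
Proof.
move=> HC x r rN; rewrite /beta_quot; case: ifPn => [_|r0].
  by rewrite beta_r_ge0 HC// normr0 (le_lt_trans _ rN).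
have cb : continuous (fun r => beta (x, r)).
  move=> t; apply/differentiable_continuous/derivable1_diffP.
  by have [] := is_derive_beta x t.
have [c cN ->] : exists2 c : R, `|c| < N & beta (x, r) / r = beta_r beta (x, c).
  have [r_gt0|r_le0] := ltP 0 r.
    have [|c] := @MVT _ _ (fun c => beta_r beta (x, c)) 0 r r_gt0 (fun t _ => is_derive_beta x t).
      exact: continuous_subspaceT.
    rewrite in_itv/= => /andP[c0 cr]; rewrite beta_0 !subr0 => ->.
    by exists c; [rewrite gtr0_norm// (lt_trans cr)// -(gtr0_norm r_gt0)|rewrite mulfK].
  have r_lt0 : r < 0 by rewrite lt_neqAle r0.
  have [|c] := @MVT _ _ (fun c => beta_r beta (x, c)) r 0 r_lt0 (fun t _ => is_derive_beta x t).
    exact: continuous_subspaceT.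
  rewrite in_itv/= => /andP[rc c0]; rewrite beta_0 !sub0r mulrN => /oppr_inj ->.
  exists c; last by rewrite mulfK.
  by rewrite ltr0_norm// (lt_trans _ rN)// ltr0_norm// ltrN2.
by rewrite beta_r_ge0 HC.
Qed.

(** The comparison hypothesis with [r1 = r] and [r2 = 0], divided by [|r|]. At [r = 0], where the
    quotient is [beta_r] by convention, the inequality is the limit of those for nonzero [r]. *)
Lemma drift_beta_quot (b : V * R -> V) (M alpha : R) : 0 < M -> continuous b ->
  (forall r1 r2, `[- M, M]%classic r1 -> `[- M, M]%classic r2 -> forall x,
    enorm (r1 *: b (x, r1) - r2 *: b (x, r2)) <= alpha * `|beta (x, r1) - beta (x, r2)|) ->
  (forall x r, `|r| <= M -> 0 <= beta_quot beta x r) ->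
  forall i x r, `|r| <= M -> `|b (x, r) ord0 i| <= alpha * beta_quot beta x r.
Proof.
move=> M0 cb H q0 i x.
have nz r : r != 0 -> `|r| <= M -> `|b (x, r) ord0 i| <= alpha * (beta (x, r) / r).
  move=> r0 rM; have := q0 x r rM; rewrite /beta_quot (negbTE r0) => q.
  have := H r 0; rewrite /= !in_itv/= -!ler_norml normr0 => /(_ rM (ltW M0) x).
  rewrite beta_0 subr0 scale0r subr0 => h.
  have rp : 0 < `|r| by rewrite normr_gt0.
  rewrite -(ler_pM2l rp) -normrM.
  have -> : `|r| * (alpha * (beta (x, r) / r)) = alpha * `|beta (x, r)|.
    have -> : beta (x, r) / r = `|beta (x, r)| / `|r| by rewrite -normfV -normrM ger0_norm.
    by field; rewrite gt_eqF.
  by apply: le_trans h; have := coord_le_enorm (r *: b (x, r)) i; rewrite mxE.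
move=> r rM; rewrite /beta_quot; case: eqVneq => [->|r0]; last exact: nz.
have [/(_ 0) D1 D2] := (conj (is_derive_beta x) I).
have cq : (alpha * (beta (x, h) / h) @[h --> 0^']) --> alpha * beta_r beta (x, 0).
  apply: cvgMr; have [dv <-] := D1.
  have := dv; rewrite /derivable /derive => /cvg_ex[l Hl].
  rewrite (cvg_lim _ Hl)//; apply: cvg_trans Hl; apply: near_eq_cvg.
  near=> h; rewrite /= addr0 beta_0 subr0 /GRing.scale/= mulr1.
  by rewrite mulrC.
have cn : (`|b (x, h) ord0 i| @[h --> 0^']) --> `|b (x, 0) ord0 i|.
  apply: cvg_norm; apply: cvg_within_filter.
  have c1 : {for (0 : R), continuous (fun h => b (x, h))}.
    apply: (@continuous_comp _ _ _ (fun h : R => (x, h) : V * R) b); last exact: cb.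
    move=> A /nbhs_ballP[e /= e0 eA]; apply/nbhs_ballP; exists e => // y xy.
    by apply: eA; split=> //; exact: ballxx.
  apply: (@continuous_comp _ _ _ (fun h => b (x, h)) (fun y : V => y ord0 i)) => //.
  exact: coord_continuous.
apply: (ler_cvg_to cn cq); near=> h.
apply: nz; first by near: h; exact: nbhs_dnbhs_neq.
by near: h; apply: dnbhs0_le.
Unshelve. all: by end_near. Qed.

End nonlinearity.

(** * Uniqueness for the linearized equation *)

Section linearized_equation.
Context {R : realType} (d : nat).
Local Notation T := (measurableTypeR R).
Local Notation V := 'rV[R]_d.
Local Notation Z := (T * V)%type.
Local Notation mz := (@mtx R d).
Local Notation delta i := (addi (@mzero0 d) i).

Lemma measurable_inv : measurable_fun setT (GRing.inv : T -> T).
Proof.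
have op : open [set x : R | x != 0] by exact: open_neq.
(* The convention that the inverse of 0 is 0 makes inversion the extension by 0 of a function
   continuous on an open set. *)
have -> : (GRing.inv : T -> T) = GRing.inv \_ [set x : T | x != 0].
  apply/funext => x; rewrite patchE; case: ifPn => //.
  by rewrite notin_setE/= => /negP; rewrite negbK => /eqP ->; rewrite invr0.
apply/(@measurable_restrictT _ _ T T [set x : T | x != 0] GRing.inv (open_measurable op)).
apply: open_continuous_measurable_fun => // x; rewrite inE/= => x0.
exact: inv_continuous.
Qed.

Lemma measurable_beta_quot (beta : V * R -> R) (u : Z -> T) : Ck 1 beta ->
  (forall x, beta (x, 0) = 0) -> measurable_fun setT u ->
  measurable_fun setT (fun z : Z => beta_quot beta z.2 (u z)).
Proof.
move=> bC b0 mu; pose c (f : V * R -> R) (h : Z -> T) z := f (z.2, h z).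
have mc f h : continuous f -> measurable_fun setT h -> measurable_fun setT (c f h).
  move=> cf mh; apply: (measurableT_comp (continuous_measurable_rVR cf)).
  exact: measurable_fun_pair.
apply: (@measurable_fun_ifT _ _ _ _ (c (beta_r beta) (fun=> 0))
  (fun z => c beta u z / u z) (fun z => u z == 0)).
- exact: measurable_fun_eqr.
- by apply: mc => //; exact: continuous_beta_r.
- apply: measurable_funM; last exact: (measurableT_comp measurable_inv mu).
  by apply: mc => //; exact: (Ck_continuous bC).
Qed.

Variables (a : V -> 'I_d -> 'I_d -> R) (g : Z -> R) (c : 'I_d -> Z -> R) (Ma : R).
Hypotheses (ma : forall i j, measurable_fun setT (fun x => a x i j))
  (a_bd : forall x i j, `|a x i j| <= Ma).

(** The bracket of the linearized equation evaluated on the test function [moll e 0] centred at [q],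
    as a function of [z]; odd orders change sign because the derivatives are taken in [z]. *)
Definition mollified_operator e (q z : Z) : R :=
  - moll e 1 (@mzero0 d) (q, z)
  + \sum_i \sum_j a z.2 i j * g z * moll e 0 (addi (delta j) i) (q, z)
  - \sum_i c i z * moll e 0 (delta i) (q, z).

Lemma mollified_pairing e q n : 0 < e -> L1 mz setT n ->
  L1 mz setT (fun z => g z * n z) -> (forall i, L1 mz setT (fun z => c i z * n z)) ->
  L1 mz setT (fun z => mollified_operator e q z * n z) /\
  \int[mz]_z (mollified_operator e q z * n z) =
  \sum_i (\sum_j mop e 0 (addi (delta j) i) (fun z => g z * n z * a z.2 i j) q
          - mop e 0 (delta i) (fun z => c i z * n z) q) - mop e 1 (@mzero0 d) n q.
Proof.
move=> e0 In Ig Ic.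
have Iga i j : L1 mz setT (fun z => g z * n z * a z.2 i j).
  apply: (L1Ml (M := Ma) Ig) => [|z]; last exact: a_bd.
  exact: (measurableT_comp (ma i j) measurable_snd).
pose A i j z := g z * n z * a z.2 i j * moll e 0 (addi (delta j) i) (q, z).
pose B i z := c i z * n z * moll e 0 (delta i) (q, z).
pose N z := n z * moll e 1 (@mzero0 d) (q, z).
have IA i j : L1 mz setT (A i j) by exact: L1_mop_section.
have IB i : L1 mz setT (B i) by exact: L1_mop_section.
have IN : L1 mz setT N by exact: L1_mop_section.
have IAi i := L1_sum (index_enum 'I_d) (IA i).
have IAB i := L1B (IAi i) (IB i).
have IS := L1_sum (index_enum 'I_d) IAB.
have -> : (fun z => mollified_operator e q z * n z) =
    (fun z => \sum_i (\sum_j A i j z - B i z) - N z).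
  apply/funext => z; rewrite sumrB /mollified_operator /N.
  have -> : \sum_i \sum_j A i j z =
      n z * \sum_i \sum_j a z.2 i j * g z * moll e 0 (addi (delta j) i) (q, z).
    rewrite mulr_sumr; apply: eq_bigr => i _; rewrite mulr_sumr; apply: eq_bigr => j _.
    by rewrite /A; ring.
  have -> : \sum_i B i z = n z * \sum_i c i z * moll e 0 (delta i) (q, z).
    by rewrite mulr_sumr; apply: eq_bigr => i _; rewrite /B; ring.
  set X := \sum_i \sum_j _; set Y := \sum_i _; set m := moll _ _ _ _.
  by clearbody X Y m; ring.
split; first exact: L1B.
apply: (etrans (RintegralB measurableT IS IN)); congr (_ - _).
apply: (etrans (Rintegral_sum (index_enum 'I_d) IAB)); apply: eq_bigr => i _.
apply: (etrans (RintegralB measurableT (IAi i) (IB i))); congr (_ - _).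
exact: (Rintegral_sum (index_enum 'I_d) (IA i)).
Qed.

Lemma measurable_mollified_operator e q : measurable_fun setT g ->
  (forall i, measurable_fun setT (c i)) ->
  measurable_fun setT (mollified_operator e q).
Proof.
move=> mg mc.
have mm m n : measurable_fun setT (fun z => moll e m n (q, z)).
  by apply: (@measurable_fun_pair2 _ _ _ _ _ _ (moll e m n) q); exact: measurable_moll.
apply: measurable_funB.
  apply: measurable_funD; first exact: (measurable_funN (mm 1%N (@mzero0 d))).
  apply: (@measurable_sum _ _ _ _ _ (index_enum 'I_d) (fun i z =>
    \sum_j a z.2 i j * g z * moll e 0 (addi (delta j) i) (q, z))) => i.
  apply: (@measurable_sum _ _ _ _ _ (index_enum 'I_d) (fun j z =>
    a z.2 i j * g z * moll e 0 (addi (delta j) i) (q, z))) => j.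
  apply: measurable_funM => //; apply: measurable_funM => //.
  exact: (measurableT_comp (ma i j) measurable_snd).
apply: (@measurable_sum _ _ _ _ _ (index_enum 'I_d) (fun i z =>
  c i z * moll e 0 (delta i) (q, z))) => i.
exact: measurable_funM.
Qed.

End linearized_equation.

Section test_equation.
Context {R : realType} (d : nat).
Local Notation T := (measurableTypeR R).
Local Notation V := 'rV[R]_d.
Local Notation Z := (T * V)%type.
Local Notation mz := (@mtx R d).

Lemma measurable_QT (tau : R) : measurable (QT tau : set Z).
Proof.
rewrite (_ : (QT tau : set Z) = setT `&` (fst @^-1` `]0, tau[%classic)).
  by apply: measurable_fst => //; exact: measurable_itv.
by rewrite setTI; apply/seteqP; split => z; rewrite /QT /= in_itv.
Qed.

(** At positive times the cut-off in the test function is invisible, which leaves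
    [mollified_operator]. The set [S] has full measure in the cylinder, so [nu] may be replaced by
    its restriction to [S], on which bounds will hold at every point. The initial term does not
    involve [nu] and will cancel in a difference. *)
Lemma linearized_mollified (a : V -> 'M[R]_d) (beta : V * R -> R) (b : V * R -> V)
    (tau : R) (u : R * V -> R) (nu0 : V -> R) (nu : R * V -> R)
    (g : Z -> R) (c : 'I_d -> Z -> R) (S : set Z) (e : R) (q : Z) :
  0 < e -> q.1 < tau -> measurable S -> S `<=` QT tau ->
  {ae (@leb_tx R d), forall z, QT tau z -> S z} ->
  (forall z, QT tau z -> g z = beta_quot beta z.2 (u z)) ->
  (forall i z, QT tau z -> c i z = b (z.2, u z) ord0 i) ->
  measurable_fun setT (mollified_operator (fun x i j => a x i j) g c e q) ->
  measurable_fun (QT tau : set Z) (nu : Z -> T) ->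
  linearized_FP_solution a beta b tau u nu0 nu ->
  \int[mz]_z (mollified_operator (fun x i j => a x i j) g c e q z * (nu \_ S) z) +
  \int[lebesgue_rV d]_x (nu0 x * test_mol e 0 0 (@mzero0 d) q (0, x)) = 0.
Proof.
move=> e0 qT mS SQ aeS gE cE mL mnu sol.
apply: etrans (sol _ (test_mol_fun e0 qT)); congr (_ + _); apply/esym.
have mQ := measurable_QT tau.
set L := mollified_operator _ _ _ _ _.
transitivity (\int[leb_tx]_(z in QT tau) (L z * nu z)).
  apply: eq_Rintegral => z; rewrite inE => Qz; have /andP[z0 _] := Qz; congr (_ * _).
  have mE m n := test_mol_moll e m n q z0.
  rewrite dt_test_mol (mE 0%N (@mzero0 d)).2 (mE 1%N (@mzero0 d)).1 sub0r.
  rewrite /L /mollified_operator; congr (_ + _ + _).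
    apply: eq_bigr => i _; apply: eq_bigr => j _.
    by rewrite dx_dx_test_mol (mE 0%N _).1 gE.
  rewrite -sumrN; apply: eq_bigr => i _.
  by rewrite dx_test_mol (mE 0%N _).1 cE// mulrN.
transitivity (\int[leb_tx]_(z in QT tau) (L z * (nu \_ S) z)).
  rewrite /Rintegral; congr fine; apply: ae_eq_integral => //.
  - apply/measurable_EFinP; apply: measurable_funM => //; exact: measurable_funTS.
  - apply/measurable_EFinP; apply: measurable_funM; first exact: measurable_funTS.
    apply: measurable_funTS; apply/(measurable_restrictT _ mS).
    exact: (measurable_funS mQ SQ).
  - case: aeS => A [mA A0 SA]; exists A; split=> // z Hz; apply: SA => Sz.
    by apply: Hz => Qz /=; rewrite patchE mem_set//; exact: Sz.
rewrite Rintegral_mkcond; apply: eq_Rintegral => z _; rewrite !patchE.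
case: ifPn => // Qz; rewrite ifN ?mulr0//.
by apply: contra Qz; rewrite !inE; exact: SQ.
Qed.

End test_equation.

Theorem corollary4p1 (R : realType) (d : nat) (hd : (1 <= d)%N)
    (a : 'rV[R]_d -> 'M[R]_d) (beta : 'rV[R]_d * R -> R)
    (b : 'rV[R]_d * R -> 'rV[R]_d)
    (beta_C1 : Ck 1 beta)
    (beta_r_ge0 : forall p, 0 <= beta_r beta p)
    (beta_0 : forall x, beta (x, 0) = 0)
    (beta_r_bounded : forall N : R, 0 < N ->
       Linfty leb_xr (setT `*` `]- N, N[) (beta_r beta))
    (a_Cinfty : forall i j, Cinfty (fun x => a x i j))
    (a_Cb : forall i j, Cb (fun x => a x i j))
    (grad_a_Cb : forall i j, Cb (grad (fun x => a x i j)))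
    (a_sym : forall x i j, a x i j = a x j i)
    (a_elliptic : exists2 gamma : R, 0 < gamma & forall xi x : 'rV[R]_d,
       gamma * enorm xi ^+ 2 <=
       \sum_(i < d) \sum_(j < d) a x i j * xi ord0 i * xi ord0 j)
    (b_Cb : Cb b)
    (b_C1 : forall x, Ck 1 (fun r : R => b (x, r)))
    (b_beta : forall K : set R, compact K ->
       exists2 alpha : R, 0 < alpha & forall r1 r2, K r1 -> K r2 -> forall x,
         enorm (r1 *: b (x, r1) - r2 *: b (x, r2)) <=
         alpha * `|beta (x, r1) - beta (x, r2)|)
    (T : R) (T_gt0 : 0 < T)
    (nu0 : 'rV[R]_d -> R) (nu0_P : prob_density nu0)
    (nu0_Linfty : Linfty (lebesgue_rV d) setT nu0)
    (u0 : 'rV[R]_d -> R) (u0_L1 : L1 (lebesgue_rV d) setT u0)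
    (u : R * 'rV[R]_d -> R)
    (u_L1 : L1 leb_tx (QT T) u) (u_Linfty : Linfty leb_tx (QT T) u)
    (u_sol : nonlinear_FP_solution a beta b T u0 u)
    (nu1 nu2 : R * 'rV[R]_d -> R)
    (nu1_L1 : L1 leb_tx (QT T) nu1) (nu1_Linfty : Linfty leb_tx (QT T) nu1)
    (nu1_ge0 : {ae leb_tx, forall z, QT T z -> 0 <= nu1 z})
    (nu1_sol : linearized_FP_solution a beta b T u nu0 nu1)
    (nu2_L1 : L1 leb_tx (QT T) nu2) (nu2_Linfty : Linfty leb_tx (QT T) nu2)
    (nu2_ge0 : {ae leb_tx, forall z, QT T z -> 0 <= nu2 z})
    (nu2_sol : linearized_FP_solution a beta b T u nu0 nu2) :
  nu1 = nu2 %[ae leb_tx in QT T].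
Proof.
pose Z := (measurableTypeR R * 'rV[R]_d)%type.
have mQ : measurable (QT T : set Z) := @measurable_QT R d T.
have [Mu Mu0 uM] := Linfty_ae u_Linfty.
have [M1 M10 nu1M] := Linfty_ae nu1_Linfty.
have [M2 M20 nu2M] := Linfty_ae nu2_Linfty.
pose M := Mu + M1 + M2; have M0 : 0 < M by rewrite !addr_gt0.
(* The almost everywhere bounds on [u], [nu1] and [nu2] hold at every point of [S], which fills the
   cylinder up to a null set; restricting to [S] provides the pointwise hypotheses of
   [weak_uniqueness]. *)
pose S : set Z := QT T `&` [set z | `|u z| <= M /\ (`|nu1 z| <= M /\ `|nu2 z| <= M)].
have SQ : S `<=` QT T by move=> z [].
have aeS : {ae (@leb_tx R d), forall z, QT T z -> S z}.
  apply: filterS2 uM (filterI nu1M nu2M) => z Hu [H1 H2] Qz; split=> //.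
  by split; [|split]; rewrite /M; [have := Hu Qz|have := H1 Qz|have := H2 Qz]; lra.
(* The coefficients must be measurable on the whole space, while [u] is controlled only in the
   cylinder. *)
pose u' : Z -> R := u \_ (QT T).
have mu' : measurable_fun setT u' by apply/(measurable_restrictT _ mQ); exact: u_Linfty.1.
have u'E z : QT T z -> u' z = u z by move=> Qz; rewrite /u' patchE mem_set.
have mS : measurable S.
  have mle (f : Z -> R) : measurable_fun (QT T : set Z) f ->
      measurable (QT T `&` [set z | `|f z| <= M] : set Z).
    move=> mf; have mn : measurable_fun (QT T : set Z) (fun z => `|f z|).
      exact: measurableT_comp.
    have -> : [set z : Z | `|f z| <= M] = (fun z => `|f z|) @^-1` `]-oo, M]%classic.
      by apply/seteqP; split=> z; rewrite /= in_itv.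
    exact: mn.
  have -> : S = (QT T `&` [set z | `|u z| <= M]) `&`
      ((QT T `&` [set z | `|nu1 z| <= M]) `&` (QT T `&` [set z | `|nu2 z| <= M])).
    apply/seteqP; split=> z; first by move=> [? [? []]].
    by move=> [[? ?] [[? ?] [? ?]]].
  apply: measurableI; first by apply: mle; exact: u_Linfty.1.
  by apply: measurableI; apply: mle; [exact: nu1_Linfty.1|exact: nu2_Linfty.1].
pose g (z : Z) := beta_quot beta z.2 (u' z).
pose c (i : 'I_d) (z : Z) := b (z.2, u' z) ord0 i.
have mg : measurable_fun setT g by exact: measurable_beta_quot.
have mc i : measurable_fun setT (c i).
  have cb : continuous (fun p => b p ord0 i).
    move=> p; apply: (@continuous_comp _ _ _ b (fun y : 'rV[R]_d => y ord0 i)).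
      exact: b_Cb.1.
    exact: coord_continuous.
  apply: (measurableT_comp (continuous_measurable_rVR cb)).
  exact: measurable_fun_pair.
have Su z : S z -> `|u' z| <= M by move=> [Qz [+ _]]; rewrite u'E.
(* The bound on [beta_r] holds on an open interval and that on [u] is not strict, hence [M + 1]. *)
have [C C0 HC] := beta_r_le beta_C1 beta_r_ge0 (beta_r_bounded (M + 1) (addr_gt0 M0 ltr01)).
have lt1 (r : R) : `|r| <= M -> `|r| < M + 1 by move=> rM; rewrite (le_lt_trans rM)// ltrDl.
have gb x r : `|r| <= M -> 0 <= beta_quot beta x r <= C.
  by move=> rM; apply: (beta_quot_bounds beta_C1 beta_r_ge0 beta_0 HC); exact: lt1.
have gS z : S z -> 0 <= g z <= C by move=> Sz; apply: gb; exact: Su.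
have [alpha alpha0 Ha] := b_beta _ (@segment_compact R (- M) M).
have cg i z : S z -> `|c i z| <= alpha * g z.
  move=> Sz; apply: (drift_beta_quot beta_C1 beta_0 M0 b_Cb.1 Ha) (Su z Sz) => x r rM.
  by have /andP[] := gb x r rM.
have [Mb Mb0 bM] := bounded_fun_le b_Cb.2.
have cM i z : `|c i z| <= Mb by apply: le_trans (bM _); exact: coord_le_norm.
pose a' x (i j : 'I_d) := a x i j.
have ma i j : measurable_fun setT (fun x => a' x i j).
  exact: continuous_measurable_rV (a_Cb i j).1.
have /choice[A HA] : forall ij : 'I_d * 'I_d, exists A : R, forall x, `|a x ij.1 ij.2| <= A.
  by move=> ij; have [A _ HA] := bounded_fun_le (a_Cb ij.1 ij.2).2; exists A.
have /choice[L HL] : forall ij : 'I_d * 'I_d, exists L : R, 0 < L /\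
    forall (x y : 'rV[R]_d) (r : R), 0 <= r ->
    (forall k, `|x ord0 k - y ord0 k| <= r) -> `|a x ij.1 ij.2 - a y ij.1 ij.2| <= L * r.
  move=> ij; have [da _] := a_Cinfty ij.1 ij.2 1%N.
  by have [L L0 HL] := grad_lipschitz da (grad_a_Cb ij.1 ij.2).2; exists L.
pose Ma := \sum_ij `|A ij|; pose La := \sum_ij L ij.
have aM x i j : `|a' x i j| <= Ma.
  apply: (le_trans (HA (i, j) x)); apply: (le_trans (ler_norm _)).
  by rewrite /Ma (bigD1 (i, j))//= lerDl sumr_ge0.
have L0 : 0 <= La by apply: sumr_ge0 => ij _; exact: ltW (HL ij).1.
have aL (x y : 'rV[R]_d) i j (r : R) : 0 <= r ->
    (forall k, `|x ord0 k - y ord0 k| <= r) -> `|a' x i j - a' y i j| <= La * r.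
  move=> r0 xy; apply: (le_trans ((HL (i, j)).2 x y r r0 xy)).
  rewrite ler_wpM2r// /La (bigD1 (i, j))//= lerDl.
  by apply: sumr_ge0 => ij _; exact: ltW (HL ij).1.
have [gamma gamma0 Hell] := a_elliptic.
have aell x (xi : 'I_d -> R) :
    gamma * \sum_i xi i ^+ 2 <= \sum_i \sum_j a' x i j * xi i * xi j.
  have := Hell (\row_i xi i) x; rewrite /enorm sqr_sqrtr; last first.
    by apply: sumr_ge0 => i _; exact: sqr_ge0.
  under eq_bigr do rewrite mxE.
  by under [X in _ <= X -> _]eq_bigr do under eq_bigr do rewrite !mxE.
have restr (nu : Z -> R) : L1 leb_tx (QT T : set Z) nu ->
    (forall z, S z -> `|nu z| <= M) ->
    [/\ L1 (mtx d) setT (nu \_ S), L1 (mtx d) setT (fun z => g z * (nu \_ S) z) &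
      forall i, L1 (mtx d) setT (fun z => c i z * (nu \_ S) z)].
  move=> Inu nuM.
  have In : L1 (mtx d) setT (nu \_ S).
    have : L1 leb_tx S nu by exact: integrableS mQ mS SQ Inu.
    move=> /(integrable_mkcond _ mS); rewrite restrict_EFin; exact.
  split=> // [|i]; last exact: L1Mr In (mc i) (cM i).
  apply: L1_le (L1Zl C (L1_norm In)) => [|z].
    by apply: measurable_funM => //; exact: L1_measurable In.
  rewrite normrM patchE; case: ifPn => [|_]; last by rewrite normr0 !mulr0.
  by rewrite inE => /gS /andP[g0 gC]; rewrite ger0_norm// ler_wpM2r.
have [I1 Ig1 Ic1] := restr nu1 nu1_L1 (fun z Sz => Sz.2.2.1).
have [I2 Ig2 Ic2] := restr nu2 nu2_L1 (fun z Sz => Sz.2.2.2).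
set n1 : Z -> R := nu1 \_ S in I1 Ig1 Ic1 *; set n2 : Z -> R := nu2 \_ S in I2 Ig2 Ic2 *.
pose v (z : Z) := n1 z - n2 z; pose w (z : Z) := g z * v z.
pose h (i : 'I_d) (z : Z) := c i z * v z.
have Iv : L1 (mtx d) setT v by exact: L1B.
have Iw : L1 (mtx d) setT w.
  by have := L1B Ig1 Ig2; congr (L1 _ _ _); apply/funext => z; rewrite -mulrBr.
have Ih i : L1 (mtx d) setT (h i).
  by have := L1B (Ic1 i) (Ic2 i); congr (L1 _ _ _); apply/funext => z; rewrite -mulrBr.
have vS z : v z != 0 -> S z.
  apply: contra_neqP => Sz; rewrite /v /n1 /n2 !patchE memNset//.
  by rewrite /point/= subrr.
have wS z : w z != 0 -> S z.
  by move=> wz; apply: vS; apply: contra_neq wz => vz; rewrite /w vz mulr0.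
have QTE z : S z -> 0 < z.1 < T by case.
have nM (nu : Z -> R) z : (forall z, S z -> `|nu z| <= M) -> `|(nu \_ S) z| <= M.
  move=> nuM; rewrite patchE; case: ifPn => [|_]; first by rewrite inE => /nuM.
  by rewrite normr0 ltW.
have vM z : `|v z| <= M + M.
  apply: (le_trans (ler_normB _ _)); apply: lerD; apply: nM => {}z Sz.
    exact: Sz.2.2.1.
  exact: Sz.2.2.2.
have wv_le z : `|w z| <= C * `|v z|.
  have [vz|vz] := eqVneq (v z) 0; first by rewrite /w vz normr0 !mulr0 normr0.
  by have /andP[g0 gC] := gS z (vS z vz); rewrite normrM ger0_norm// ler_wpM2r.
have wM z : `|w z| <= (C + 1) * (M + M).
  apply: (le_trans (wv_le z)); apply: ler_pM => //; first exact: ltW.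
  by rewrite lerDl.
(* [weak_uniqueness] takes one common bound for [v] and [w]; [C + 1] is at least both 1 and [C]. *)
have vM' z : `|v z| <= (C + 1) * (M + M).
  apply: (le_trans (vM z)); apply: ler_peMl; first by apply: addr_ge0; exact: ltW.
  by rewrite lerDr ltW.
have hw i z : `|h i z| <= alpha * `|w z|.
  have [vz|vz] := eqVneq (v z) 0; first by rewrite /h /w vz !mulr0 normr0 mulr0.
  have Sz := vS z vz; have /andP[g0 gC] := gS z Sz.
  rewrite /h /w !normrM mulrA (ger0_norm g0) ler_wpM2r//; exact: cg.
(* [w^2] is [g * (v * w)], where [g] is at most [C] on [S] and [v * w = g * v^2] is nonnegative. *)
have wv z : w z ^+ 2 <= C * (v z * w z).
  have [vz|vz] := eqVneq (v z) 0; first by rewrite /w vz !mulr0 expr0n.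
  have /andP[g0 gC] := gS z (vS z vz).
  have -> : w z ^+ 2 = g z * (v z * w z) by rewrite /w; ring.
  by rewrite ler_wpM2r// /w mulrCA mulr_ge0// -expr2 sqr_ge0.
have weq e (q : Z) : 0 < e -> q.1 < T ->
    mop e 1 (@mzero0 d) v q =
    \sum_i (\sum_j mop e 0 (addi (addi (@mzero0 d) j) i) (fun z => w z * a' z.2 i j) q
            - mop e 0 (addi (@mzero0 d) i) (h i) q).
  move=> e0 qT.
  have [J1 _] := mollified_pairing ma aM q e0 I1 Ig1 Ic1.
  have [J2 _] := mollified_pairing ma aM q e0 I2 Ig2 Ic2.
  have [_ E] := mollified_pairing ma aM q e0 Iv Iw Ih.
  have mL := measurable_mollified_operator ma e q mg mc.
  have gE z : QT T z -> g z = beta_quot beta z.2 (u z) by move=> Qz; rewrite /g u'E.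
  have cE i z : QT T z -> c i z = b (z.2, u z) ord0 i by move=> Qz; rewrite /c u'E.
  have K1 := linearized_mollified e0 qT mS SQ aeS gE cE mL nu1_Linfty.1 nu1_sol.
  have K2 := linearized_mollified e0 qT mS SQ aeS gE cE mL nu2_Linfty.1 nu2_sol.
  apply/esym/eqP; rewrite -subr_eq0 -E; apply/eqP.
  transitivity (\int[mtx d]_z (mollified_operator a' g c e q z * n1 z -
      mollified_operator a' g c e q z * n2 z)).
    by apply: eq_Rintegral => z _; rewrite -mulrBr.
  rewrite (RintegralB measurableT J1 J2); apply/eqP; rewrite subr_eq0; apply/eqP.
  (* The initial term is the same in both equations and cancels. *)
  by apply: (addIr _ (etrans K1 (esym K2))).
have v0 := weak_uniqueness T_gt0 L0 gamma0 (ltW alpha0) C0 ma aM aL a_sym aell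
  Iv Iw Ih vM' wM (fun z vz => QTE z (vS z vz)) (fun z wz => QTE z (wS z wz)) hw wv weq.
have : ae_eq (mtx d) setT (EFin \o v) (cst 0%E).
  apply/ae_eq_integral_abs => //.
    by apply/measurable_EFinP; exact: L1_measurable Iv.
  by rewrite -[LHS](EFin_Rintegral (L1_norm Iv)) v0.
move: aeS => [A1 [mA1 A10 SA1]] [A2 [mA2 A20 SA2]].
(* The exceptional points lie either in the cylinder outside [S] or where [v] is nonzero; on [S] the
   vanishing of [v] is the equality of the two solutions. *)
exists (A1 `|` A2); split; first exact: measurableU.
  by rewrite measureU0.
move=> z Hz; apply: contrapT => /not_orP[/= zA1 zA2]; apply: Hz => Qz.
have Sz : S z by apply: contrapT => nS; apply: zA1; apply: SA1 => H; exact: nS (H Qz).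
have : v z = 0.
  by apply: contrapT => nv; apply: zA2; apply: SA2 => H; apply: nv; have /= [] := H I.
by rewrite /v /n1 /n2 !patchE mem_set// => /eqP; rewrite subr_eq0 => /eqP.
Qed.
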